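(* Let $k,b,n,c,m\in\mathbb{N}^*$ with $k,bn,cm\geq 2$ and $n\wedge m=1$, and let $k',b',n',c',m'\in\mathbb{N}^*$ with $k',b'n',c'm'\geq 2$ and $n'\wedge m'=1$. The groups $W_b^c(k,bn,cm)$ and $W_{b'}^{c'}(k',b'n',c'm')$ are isomorphic in reflection if and only if the multisets of columns $$\left\{\begin{pmatrix} k \\ 1 \end{pmatrix},\begin{pmatrix} bn \\ n \end{pmatrix},\begin{pmatrix} cm \\ m \end{pmatrix}\right\}\quad\text{and}\quad \left\{\begin{pmatrix} k' \\ 1 \end{pmatrix},\begin{pmatrix} b'n' \\ n' \end{pmatrix},\begin{pmatrix} c'm' \\ m' \end{pmatrix}\right\}$$ are equal as multisets.
   Context: $\mathbb{N}^*$ is the set of positive integers and $n\wedge m$ denotes the gcd of $n$ and $m$. For integers $k,n,m\geq 2$, $J(k,n,m)$ is the group with presentation $\langle s,t,u\mid s^k=t^n=u^m=1,\ stu=tus=ust\rangle$; $s,t,u$ are its canonical generators. For $k,b,n,c,m\in\mathbb{N}^*$ with $k,bn,cm\geq 2$ and $n\wedge m=1$, $W_b^c(k,bn,cm)$ denotes the normal closure of $\{s,t^n,u^m\}$ in $J(k,bn,cm)$, where $s,t,u$ are the canonical generators of $J(k,bn,cm)$ (the notation records the tuple $(k,b,n,c,m)$). These are called $J$-reflection groups. For $H=W_b^c(k,bn,cm)$, the set $R(H)$ of reflections of $H$ is the set of conjugates in $J(k,bn,cm)$ of non-trivial powers (powers different from $1$) of $s$, $t^n$ or $u^m$. Two such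 groups $H_1,H_2$ are isomorphic in reflection if there is a group isomorphism $H_1\to H_2$ sending $R(H_1)$ onto $R(H_2)$. *)

(* Defs.v *)
From HB Require Import structures.
From mathcomp Require Import all_boot.
From mathcomp Require Import boolp classical_sets functions.
Set Implicit Arguments.
Unset Strict Implicit.
Unset Printing Implicit Defensive.

Local Open Scope classical_set_scope.
Local Open Scope quotient_scope.
Local Open Scope group_scope.

(* A word over X is a sequence of letters (x, e), with (x, true) standing for
   the generator x and (x, false) for its formal inverse. *)
Section Presentation.
Context {X : choiceType}.

Definition letter : Type := X * bool.
Definition word : Type := seq letter.

Definition letter_inv (a : letter) : letter := (a.1, ~~ a.2).
Definition word_inv (w : word) : word := rev (map letter_inv w).

Variable rels : set (word * word).

Inductive word_eq : word -> word -> Prop :=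
| word_eq_refl w : word_eq w w
| word_eq_sym v w : word_eq v w -> word_eq w v
| word_eq_trans u v w : word_eq u v -> word_eq v w -> word_eq u w
| word_eq_cat v v' w w' :
    word_eq v v' -> word_eq w w' -> word_eq (v ++ w) (v' ++ w')
| word_eq_cancel a : word_eq [:: a; letter_inv a] [::]
| word_eq_rel v w : rels (v, w) -> word_eq v w.

Definition word_eqb : rel word := fun v w => `[< word_eq v w >].

Lemma word_eqb_refl : reflexive word_eqb.
Proof. by move=> w; apply/asboolP/word_eq_refl. Qed.

Lemma word_eqb_sym : symmetric word_eqb.
Proof. by move=> v w; apply/asboolP/asboolP; apply: word_eq_sym. Qed.

Lemma word_eqb_trans : transitive word_eqb.
Proof.
move=> v u w /asboolP uv /asboolP vw.
by apply/asboolP; apply: word_eq_trans uv vw.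
Qed.

Canonical word_equiv :=
  EquivRel word_eqb word_eqb_refl word_eqb_sym word_eqb_trans.

(* The group with generators X and relations v = w for (v, w) in rels. *)
Definition presented : Type := {eq_quot word_equiv}.

HB.instance Definition _ := Choice.on presented.

Definition pres_class (w : word) : presented := \pi w.

Lemma pres_classP v w : pres_class v = pres_class w <-> word_eq v w.
Proof.
split=> [vw|vw]; last by apply/eqmodP/asboolP.
by apply/asboolP; move/eqmodP: vw.
Qed.

Lemma pres_classK x : pres_class (repr x) = x.
Proof. exact: reprK. Qed.

Lemma repr_word_eq w : word_eq (repr (pres_class w)) w.
Proof. by apply/pres_classP; rewrite pres_classK. Qed.

Lemma letter_invK : involutive letter_inv.
Proof. by case=> x e; rewrite /letter_inv /= negbK. Qed.

Lemma word_invK : involutive word_inv.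
Proof. by move=> w; rewrite /word_inv map_rev revK (mapK letter_invK). Qed.

Lemma word_eq_catV w : word_eq (w ++ word_inv w) [::].
Proof.
elim: w => [|a w IHw]; first exact: word_eq_refl.
rewrite /word_inv /= rev_cons -cats1 catA -cat1s.
apply: (@word_eq_trans _ ([:: a] ++ [::] ++ [:: letter_inv a])).
  apply: (@word_eq_cat [:: a] _ ((w ++ word_inv w) ++ [:: letter_inv a])).
    exact: word_eq_refl.
  by apply: word_eq_cat IHw _; apply: word_eq_refl.
exact: word_eq_cancel.
Qed.

Lemma word_eq_catK w : word_eq (word_inv w ++ w) [::].
Proof. by have := word_eq_catV (word_inv w); rewrite word_invK. Qed.

Lemma word_eq_inv v w : word_eq v w -> word_eq (word_inv v) (word_inv w).
Proof.
move=> vw; rewrite -[word_inv v]cats0 -[word_inv w]cat0s.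
apply: (@word_eq_trans _ (word_inv v ++ (w ++ word_inv w))).
  apply: word_eq_cat; first exact: word_eq_refl.
  exact/word_eq_sym/word_eq_catV.
rewrite catA; apply: word_eq_cat (word_eq_refl _).
apply: word_eq_trans (word_eq_catK v).
by apply: word_eq_cat; [exact: word_eq_refl | exact: word_eq_sym].
Qed.

Definition pres_one : presented := pres_class [::].
Definition pres_mul (x y : presented) : presented :=
  pres_class (repr x ++ repr y).
Definition pres_inv (x : presented) : presented :=
  pres_class (word_inv (repr x)).

Lemma pres_mulE v w :
  pres_mul (pres_class v) (pres_class w) = pres_class (v ++ w).
Proof. by apply/pres_classP; apply: word_eq_cat; apply: repr_word_eq. Qed.

Lemma pres_invE w : pres_inv (pres_class w) = pres_class (word_inv w).
Proof. by apply/pres_classP/word_eq_inv/repr_word_eq. Qed.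

Lemma pres_mulA : associative pres_mul.
Proof.
move=> x y z; rewrite -[x]pres_classK -[y]pres_classK -[z]pres_classK.
by rewrite !pres_mulE catA.
Qed.

Lemma pres_mul1 : left_id pres_one pres_mul.
Proof. by move=> x; rewrite -[x]pres_classK pres_mulE. Qed.

Lemma pres_mulr1 : right_id pres_one pres_mul.
Proof. by move=> x; rewrite -[x]pres_classK pres_mulE cats0. Qed.

Lemma pres_mulV : left_inverse pres_one pres_inv pres_mul.
Proof.
move=> x; rewrite -[x]pres_classK pres_invE pres_mulE.
exact/pres_classP/word_eq_catK.
Qed.

Lemma pres_mulrV : right_inverse pres_one pres_inv pres_mul.
Proof.
move=> x; rewrite -[x]pres_classK pres_invE pres_mulE.
exact/pres_classP/word_eq_catV.
Qed.

HB.instance Definition _ := isGroup.Build presented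
  pres_mulA pres_mul1 pres_mulr1 pres_mulV pres_mulrV.

End Presentation.

Definition normal_subgroup (G : groupType) (N : set G) : Prop :=
  [/\ N 1,
      forall x y, N x -> N y -> N (x / y)
    & forall x g, N x -> N (x ^ g)].

Definition normal_closure (G : groupType) (A : set G) : set G :=
  smallest (@normal_subgroup G) A.

Definition Jletter (i : nat) : letter := (inord i : 'I_3, true).

Definition Jrels (k n m : nat) : set (word * word) :=
  let s := Jletter 0 in let t := Jletter 1 in let u := Jletter 2 in
  [set (nseq k s, [::]); (nseq n t, [::]); (nseq m u, [::]);
       ([:: s; t; u], [:: t; u; s]); ([:: t; u; s], [:: u; s; t])].

Definition J (k n m : nat) : groupType := presented (Jrels k n m).

Section CanonicalGenerators.
Variables k n m : nat.
Definition Js : J k n m := pres_class (Jrels k n m) [:: Jletter 0].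
Definition Jt : J k n m := pres_class (Jrels k n m) [:: Jletter 1].
Definition Ju : J k n m := pres_class (Jrels k n m) [:: Jletter 2].
End CanonicalGenerators.

Definition Wgens (k b n c m : nat) : set (J k (b * n) (c * m)) :=
  [set Js k (b * n) (c * m); Jt k (b * n) (c * m) ^+ n;
       Ju k (b * n) (c * m) ^+ m].
Arguments Wgens : clear implicits.

Definition W (k b n c m : nat) : set (J k (b * n) (c * m)) :=
  normal_closure (Wgens k b n c m).
Arguments W : clear implicits.

(* The generators of J have finite order, so natural exponents give all
   powers. *)
Definition reflections (k b n c m : nat) : set (J k (b * n) (c * m)) :=
  [set x | exists r i g, [/\ Wgens k b n c m r, r ^+ i <> 1
                         & x = (r ^+ i) ^ g]].
Arguments reflections : clear implicits.

(* A map between the ambient groups is only constrained on W, where it must be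
   a bijective homomorphism onto the other subgroup. *)
Definition isomorphic_in_reflection (k b n c m k' b' n' c' m' : nat) : Prop :=
  exists f : J k (b * n) (c * m) -> J k' (b' * n') (c' * m'),
    [/\ set_bij (W k b n c m) (W k' b' n' c' m') f,
        {in W k b n c m &, {morph f : x y / x * y}}
      & f @` (reflections k b n c m) = reflections k' b' n' c' m'].

(* Main.v *)
(** A J-reflection group H is a normal subgroup of J with J = H Z(J), because
    n and m are coprime, and Z(J) is the kernel of the map from J onto the
    triangle group T with vertex orders k, bn, cm.  Hence an isomorphism in
    reflection induces an isomorphism of triangle groups.  The reflections split
    into (at most) three families of powers of conjugates of s, t^n, u^m, told
    apart by the abelianisation of J.  For x in {s, t, u}, every finite cyclic
    subgroup of T containing a nontrivial power of x lies in <x>; so each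
    nonempty family determines its column.  The columns of the empty families
    are recovered from the torsion of T: every element of finite order is
    conjugate to a power of s, t or u, and two of these generators can be
    conjugate to powers of each other only when they have the same order; one
    ambiguous case is settled by the abelianisation of T.

    The facts on T, spherical, Euclidean or hyperbolic alike, come from the
    Coxeter group of the triangle acting on its Tits cone: an element of finite
    order of T is a rotation which fixes a nonzero vector of that cone, and
    stabilisers of vectors of the cone are parabolic. *)
From HB Require Import structures.
From mathcomp Require Import fingroup perm cyclic.
From mathcomp Require Import all_boot all_order all_algebra.
From mathcomp Require Import ring lra zify.
From mathcomp Require Import boolp classical_sets reals Rstruct trigo.
Require Import Defs.
Set Implicit Arguments.
Unset Strict Implicit.
Unset Printing Implicit Defensive.
Import Order.TTheory GRing.Theory Num.Theory.

(** An isomorphism in reflection is controlled on [W] only. It still reaches the triangle groups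
    because the kernel of [JT] on [W] is the centre of [W], a subgroup that any isomorphism
    respects. The delicate point is that central elements of J die in T: T may have a centre of its
    own (orders 2, 2, r with r even), and a monomial representation of J shows that no central
    element of J lies above its nontrivial elements. A family of reflections is empty exactly when b
    = 1 or c = 1; its column is then (n, n) or (m, m), and coprimality of n and m is what separates
    two such columns. The Coxeter group is built by adjoining a flip automorphism to T, so that T is
    its even subgroup by construction and facts on the Coxeter group restrict to T at once. The
    converse comes from isomorphisms between the groups J themselves: a cyclic shift of the
    generators preserves the relations, and so does a transposition combined with inversion. *)

Local Notation i0 := (inord 0 : 'I_3).
Local Notation i1 := (inord 1 : 'I_3).
Local Notation i2 := (inord 2 : 'I_3).
Local Notation nx := (@ordS 3).

(** * Coxeter groups and the Tits cone *)

Local Open Scope ring_scope.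

Section Trig.
Variable R : realType.

Definition angle (m : nat) : R := pi / m%:R.

Definition sinn (m n : nat) : R := sin (n%:R * angle m).

Lemma sinn0 m : sinn m 0 = 0.
Proof. by rewrite /sinn mul0r sin0. Qed.

Lemma sinn_rec m n :
  2 * cos (angle m) * sinn m n.+1 - sinn m n = sinn m n.+2.
Proof.
rewrite /sinn; set x := angle m.
have -> : n.+2%:R * x = n.+1%:R * x + x by rewrite -!natr1; ring.
have -> : n%:R * x = n.+1%:R * x - x by rewrite -!natr1; ring.
rewrite sinB sinD; ring.
Qed.

Lemma angleE m : (0 < m)%N -> m%:R * angle m = pi.
Proof. by move=> m0; rewrite mulrC divfK // pnatr_eq0 -lt0n. Qed.

Lemma angle_gt0 m : (0 < m)%N -> 0 < angle m.
Proof. by move=> m0; rewrite divr_gt0 ?pi_gt0 ?ltr0n. Qed.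

Lemma sinn_gt0 m n : (0 < n < m)%N -> 0 < sinn m n.
Proof.
case/andP=> n0 nm; have m0 : (0 < m)%N by apply: leq_trans nm.
apply: sin_gt0_pi; rewrite mulr_gt0 ?ltr0n ?angle_gt0 //=.
by rewrite -[ltRHS](angleE m0) ltr_pM2r ?angle_gt0 // ltr_nat.
Qed.

Lemma sinnm m : (0 < m)%N -> sinn m m = 0.
Proof. by move=> m0; rewrite /sinn angleE // sinpi. Qed.

Lemma sinn_ge0 m n : (n <= m)%N -> 0 <= sinn m n.
Proof.
rewrite leq_eqVlt => /orP[/eqP -> | nm].
  by case: m => [|m]; rewrite ?sinn0 // sinnm.
by case: n nm => [|n] nm; rewrite ?sinn0 // ltW // sinn_gt0.
Qed.

Lemma sinnDm m n : (0 < m)%N -> sinn m (n + m) = - sinn m n.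
Proof. by move=> m0; rewrite /sinn natrD mulrDl angleE // sinDpi. Qed.

End Trig.

(** * Length and alternating words in a group generated by involutions *)

Section Coxeter.
Variables (I : eqType) (W : groupType) (a : I -> W) (par : W -> bool).
Hypothesis a_inv : forall i, (a i * a i = 1)%g.
Hypothesis par_gen : forall i, par (a i) = true.
Hypothesis parM : forall x y, par (x * y)%g = par x (+) par y.

Definition ev (s : seq I) : W := foldr (fun i w => a i * w)%g 1%g s.

Hypothesis a_gen : forall w, exists s, ev s = w.

Lemma ev_cat s t : ev (s ++ t) = (ev s * ev t)%g.
Proof. by elim: s => [|i s IHs] /=; rewrite ?mul1g // IHs mulgA. Qed.

Lemma par1 : par 1%g = false.
Proof. by have := parM 1%g 1%g; rewrite mul1g; case: (par _). Qed.

Lemma par_ev s : par (ev s) = odd (size s).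
Proof. by elim: s => [|i s IHs] /=; rewrite ?par1 // parM par_gen IHs. Qed.

Lemma mulaK i w : (w * a i * a i = w)%g.
Proof. by rewrite -mulgA a_inv mulg1. Qed.

Lemma mulKa i w : (a i * (a i * w) = w)%g.
Proof. by rewrite mulgA a_inv mul1g. Qed.

Lemma a_V i : ((a i)^-1 = a i)%g.
Proof. exact/mulg1_eq/a_inv. Qed.

Lemma ell_ex w : exists n, `[< exists s, size s = n /\ ev s = w >].
Proof.
by have [s sw] := a_gen w; exists (size s); apply/asboolP; exists s.
Qed.

Definition ell w : nat := ex_minn (ell_ex w).

Lemma ell_ev s : (ell (ev s) <= size s)%N.
Proof.
rewrite /ell; case: ex_minnP => n _; apply.
by apply/asboolP; exists s.
Qed.

Lemma ellP w : exists2 s, size s = ell w & ev s = w.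
Proof.
by rewrite /ell; case: ex_minnP => n /asboolP[s [sn sw]] _; exists s.
Qed.

Lemma ell1 : ell 1%g = 0%N.
Proof. by apply/eqP; rewrite -leqn0; apply: (ell_ev [::]). Qed.

Lemma ell_a i : (ell (a i) <= 1)%N.
Proof. by have := ell_ev [:: i]; rewrite /= mulg1. Qed.

Lemma ellM x y : (ell (x * y)%g <= ell x + ell y)%N.
Proof.
have [s <- <-] := ellP x; have [t <- <-] := ellP y.
by rewrite -ev_cat -size_cat ell_ev.
Qed.

Lemma ell_par w : odd (ell w) = par w.
Proof. by have [s <- <-] := ellP w; rewrite par_ev. Qed.

Lemma ellMa w i : (ell (w * a i)%g <= (ell w).+1)%N.
Proof. by rewrite -addn1 (leq_trans (ellM _ _)) // leq_add2l ell_a. Qed.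

(** [par] is the sign character: a generator changes the parity of the length, so the length cannot
    stay the same. *)
Lemma ellMa_neq w i : (ell (w * a i)%g < ell w)%N || (ell w < ell (w * a i)%g)%N.
Proof.
rewrite -neq_ltn; apply/eqP => E.
by have := ell_par (w * a i)%g; rewrite E ell_par parM par_gen addbT; case: par.
Qed.

Lemma ell_descent w : w != 1%g -> exists i, (ell (w * a i)%g < ell w)%N.
Proof.
move=> w1; have [s sw ws] := ellP w.
case: (lastP s) sw ws => [|s' i] sw ws; first by rewrite -ws eqxx in w1.
exists i; rewrite -sw -ws -cats1 ev_cat /= mulg1 mulaK.
by rewrite size_cat addn1 ltnS ell_ev.
Qed.

Fixpoint alt (n : nat) (i j : I) : W :=
  if n is n'.+1 then (alt n' j i * a j)%g else 1%g.

Lemma ell_alt n i j : (ell (alt n i j) <= n)%N.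
Proof.
elim: n i j => [|n IHn] i j /=; first by rewrite ell1.
by rewrite (leq_trans (ellMa _ _)) ?ltnS.
Qed.

Lemma altl n i j : alt n.+1 i j = (a (if odd n then i else j) * alt n i j)%g.
Proof.
elim: n i j => [|n IHn] i j; first by rewrite /= mul1g mulg1.
by rewrite -[LHS]/(alt n.+1 j i * a j)%g IHn -mulgA /=; case: (odd n).
Qed.

Lemma alt_split k m i j :
  exists2 y, alt (k + m) i j = (y * alt m i j)%g & (ell y <= k)%N.
Proof.
elim: m i j => [|m IHm] i j.
  by exists (alt k i j); rewrite ?addn0 ?mulg1 ?ell_alt.
have [y Ey yk] := IHm j i; exists y => //.
by rewrite addnS /= Ey mulgA.
Qed.

Lemma expgM_shift (x y : W) n : (x * (y * x) ^+ n * y = (x * y) ^+ n.+1)%g.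
Proof.
elim: n => [|n IHn]; first by rewrite mulg1.
by rewrite [in RHS]expgS -IHn expgS !mulgA.
Qed.

(** Inverting an alternating word reverses it, so this quotient is an alternating word of length
    [2 n]. It turns [(a i * a j) ^+ n = 1] into the braid relation. *)
Lemma alt_divE n i j :
  (alt n i j / alt n j i =
   (a (if odd n then j else i) * a (if odd n then i else j)) ^+ n)%g.
Proof.
elim: n => [|n IHn]; first by rewrite /= divg1.
rewrite !altl invgM a_V.
have E (x y z t : W) : (x * y * (z * t) = x * (y * z) * t)%g by rewrite !mulgA.
by rewrite E IHn /=; case: (odd n); rewrite expgM_shift.
Qed.

Lemma alt_comm n i j :
  ((a i * a j) ^+ n = 1)%g -> ((a j * a i) ^+ n = 1)%g ->
  alt n i j = alt n j i.
Proof.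
move=> H1 H2; apply: divg1_eq; rewrite alt_divE.
by case: (odd n).
Qed.

Lemma alt_double n i j : alt n.*2 i j = ((a i * a j) ^+ n)%g.
Proof.
elim: n => [|n IHn] //.
by rewrite doubleS /= IHn expgSr mulgA.
Qed.

(** A reflection inverts the rotation; the inverse is written as the power [m.-1] to keep exponents
    natural. *)
Lemma flip_rot j k m e : (0 < m)%N -> ((a j * a k) ^+ m = 1)%g ->
  (a j * (a j * a k) ^+ e = (a j * a k) ^+ (m.-1 * e) * a j)%g.
Proof.
move=> m0 xm; have xV : ((a j * a k) ^+ m.-1 = a k * a j)%g.
  apply: (@mulIg _ (a j * a k)%g).
  by rewrite -expgSr prednK // xm mulgA mulaK a_inv.
rewrite expgnA xV; elim: e => [|e IHe]; first by rewrite mulg1 mul1g.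
by rewrite [in LHS]expgSr [LHS]mulgA IHe expgSr !mulgA !mulaK.
Qed.

Lemma dihedral_word j k m s : (0 < m)%N -> ((a j * a k) ^+ m = 1)%g ->
  all (fun i => (i == j) || (i == k)) s ->
  exists e, ev s = ((a j * a k) ^+ (e : nat))%g \/
            ev s = ((a j * a k) ^+ e * a j)%g.
Proof.
move=> m0 xm; elim: s => [|i s IHs] /=; first by exists 0%N; left.
case/andP=> [ijk /IHs[e {IHs} Ee]].
have [->|ij] := eqVneq i j.
  exists (m.-1 * e)%N; case: Ee => ->; [right|left]; rewrite ?mulgA (flip_rot _ m0 xm) ?mulaK //.
have -> : a i = (a j * (a j * a k))%g.
  by rewrite mulKa; move: ijk; rewrite (negPf ij) => /eqP ->.
exists (m.-1 * e.+1)%N; case: Ee => ->; [right|left].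
  by rewrite -mulgA -expgS (flip_rot _ m0 xm).
by rewrite mulgA -[(_ * _ * _ ^+ _)%g]mulgA -expgS (flip_rot _ m0 xm) mulaK.
Qed.

End Coxeter.

(** * The geometric representation, its roots and its chamber *)

Section Reflections.
Variables (R : realType) (N : nat) (mm : 'I_N -> 'I_N -> nat).
Hypothesis mm_sym : forall i j, mm i j = mm j i.
Hypothesis mm_ge2 : forall i j, i != j -> (1 < mm i j)%N.

Definition Bform (i j : 'I_N) : R := if i == j then 1 else - cos (angle R (mm i j)).

(** On columns, which are coordinates in the simple roots, this is the reflection in the simple root
    [i]. On rows, which are linear forms given by their values on the simple roots, it is the dual
    action. Roots are columns; points of the Tits cone are rows. *)
Definition Mref (i : 'I_N) : 'M[R]_N :=
  \matrix_(k, l) ((k == l)%:R - 2 * (k == i)%:R * Bform i l).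

Lemma Bform_sym i j : Bform i j = Bform j i.
Proof. by rewrite /Bform eq_sym mm_sym. Qed.

Lemma Bform_refl i : Bform i i = 1.
Proof. by rewrite /Bform eqxx. Qed.

Lemma sum_delta (i : 'I_N) (F : 'I_N -> R) : \sum_k (k == i)%:R * F k = F i.
Proof.
rewrite (bigD1 i) //= eqxx mul1r big1 ?addr0 // => k /negPf ->.
by rewrite mul0r.
Qed.

Lemma mul_Mref i p (X : 'M[R]_(N, p)) k c :
  (Mref i *m X) k c = X k c - 2 * (k == i)%:R * \sum_l Bform i l * X l c.
Proof.
rewrite mxE (eq_bigr (fun l => (l == k)%:R * X l c
  - 2 * (k == i)%:R * (Bform i l * X l c))) => [|l _].
  by rewrite sumrB sum_delta -mulr_sumr.
by rewrite mxE [l == k]eq_sym; ring.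
Qed.

Lemma Mref_mul i p (X : 'M[R]_(p, N)) r l :
  (X *m Mref i) r l = X r l - 2 * X r i * Bform i l.
Proof.
rewrite mxE (eq_bigr (fun k => (k == l)%:R * X r k
  - (k == i)%:R * (2 * X r k * Bform i l))) => [|k _].
  by rewrite sumrB !sum_delta.
by rewrite mxE; ring.
Qed.

Lemma MrefK i : Mref i *m Mref i = 1%:M.
Proof.
apply/matrixP=> k l; rewrite Mref_mul !mxE Bform_refl; ring.
Qed.

Section Representation.
Variables (W : groupType) (a : 'I_N -> W) (par : W -> bool) (rho : W -> 'M[R]_N).
Hypothesis a_inv : forall i, (a i * a i = 1)%g.
Hypothesis par_gen : forall i, par (a i) = true.
Hypothesis parM : forall x y, par (x * y)%g = par x (+) par y.
Hypothesis a_gen : forall w, exists s, ev a s = w.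
Hypothesis rho1 : rho 1%g = 1%:M.
Hypothesis rhoM : forall x y, rho (x * y)%g = rho x *m rho y.
Hypothesis rho_gen : forall i, rho (a i) = Mref i.
Hypothesis a_braid : forall i j, i != j -> ((a i * a j) ^+ mm i j = 1)%g.

Local Notation alt := (alt a).
Local Notation ell := (ell a_gen).

(** Column [i] is the image of the simple root [i]. The coordinates of roots in a dihedral plane are
    quotients of sines of multiples of [pi / m]; here the denominator is cleared. *)
Lemma rho_alt i j n l : i != j ->
  sinn R (mm i j) 1 * rho (alt n i j) l i =
  sinn R (mm i j) n.+1 * (l == if odd n then j else i)%:R +
  sinn R (mm i j) n * (l == if odd n then i else j)%:R.
Proof.
move=> ij; elim: n l => [|n IHn] l.
  by rewrite /= rho1 mxE sinn0 mul0r addr0.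
rewrite altl // rhoM rho_gen mul_Mref mulrBr IHn.
set x := if odd n then i else j; set y := if odd n then j else i.
have -> : (if odd n.+1 then j else i) = x by rewrite /x /=; case: (odd n).
have -> : (if odd n.+1 then i else j) = y by rewrite /y /=; case: (odd n).
have xy : x != y by rewrite /x /y; case: (odd n); rewrite // eq_sym.
have Bxy : Bform x y = - cos (angle R (mm i j)).
  by rewrite /Bform (negPf xy) /x /y; case: (odd n) => //; rewrite mm_sym.
have -> : sinn R (mm i j) 1 *
    (2 * (l == x)%:R * \sum_k Bform x k * rho (alt n i j) k i) =
  2 * (l == x)%:R *
    (sinn R (mm i j) n.+1 * Bform x y + sinn R (mm i j) n * Bform x x).
  rewrite mulrCA; congr (_ * _); rewrite mulr_sumr.
  rewrite (eq_bigr (fun k => (k == y)%:R * (sinn R (mm i j) n.+1 * Bform x k)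
    + (k == x)%:R * (sinn R (mm i j) n * Bform x k))) => [|k _].
    by rewrite big_split /= !sum_delta.
  by rewrite mulrCA IHn -/x -/y; ring.
rewrite Bxy Bform_refl -sinn_rec.
have [lx|lx] := eqVneq l x; last by ring.
by rewrite lx (negPf xy); ring.
Qed.

Lemma alt_mm i j : i != j -> alt (mm i j) i j = alt (mm i j) j i.
Proof.
move=> ij; apply: alt_comm => //; first exact: a_braid.
by rewrite mm_sym a_braid // eq_sym.
Qed.

(* Write [w = v x] with [x] in the dihedral subgroup of [a_i], [a_j] and [v] as
   short as possible: the induction applies to [v], and the coordinates of
   [x alpha_i] are sines of angles between [0] and [pi]. *)
Lemma Tits_pos w i : (ell w < ell (w * a i)%g)%N -> forall k, 0 <= rho w k i.
Proof.
have [n] := ubnP (ell w); elim: n => // n IHn in w i *.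
rewrite ltnS => wn wi.
have [w1|w1] := eqVneq w 1%g; first by move=> k; rewrite w1 rho1 mxE ler0n.
have [j wj] := ell_descent a_inv a_gen w1.
have ij : i != j by apply: contraTneq wi => ->; rewrite -leqNgt ltnW.
pose P l := `[< exists v p, [/\ ell v = l, (v * alt p i j = w)%g
   & (ell v + p = ell w)%N] >].
have exP : exists l, P l.
  exists (ell (w * a j)%g); apply/asboolP; exists (w * a j)%g, 1%N.
  split=> //=; first by rewrite mul1g mulaK.
  apply/eqP; rewrite addn1 eqn_leq wj /=.
  by have := ellMa a_gen (w * a j)%g j; rewrite mulaK.
case: (ex_minnP exP) => l /asboolP[v [p [vl vpw lvp]]] lmin.
have lw : (l < ell w)%N.
  apply: leq_trans (wj); rewrite ltnS; apply: lmin.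
  apply/asboolP; exists (w * a j)%g, 1%N.
  split=> //=; first by rewrite mul1g mulaK.
  apply/eqP; rewrite addn1 eqn_leq wj /=.
  by have := ellMa a_gen (w * a j)%g j; rewrite mulaK.
(* Otherwise [v * a c] is shorter than [v]. The letter [c] then either extends the alternating word,
   against the minimality of [v], or cancels its first letter, which makes [w] too short. *)
have nextE c : c = i \/ c = j ->
    (ell v < ell (v * a c)%g)%N.
  move=> cij; have /orP[vc|//] := ellMa_neq par_gen parM a_gen v c.
  have Ew : w = (v * a c * (a c * alt p i j))%g by rewrite mulgA mulaK.
  have Evc : (ell (v * a c)%g).+1 = ell v.
    apply/eqP; rewrite eqn_leq vc /=.
    by have := ellMa a_gen (v * a c)%g c; rewrite mulaK.
  have [cE|cE] := eqVneq c (if odd p then i else j).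
    suff /lmin : P (ell (v * a c)%g) by rewrite -vl leqNgt vc.
    apply/asboolP; exists (v * a c)%g, p.+1; split=> //.
      by rewrite altl // -cE -Ew.
    by rewrite addnS -addSn Evc.
  have [p' Ep] : exists p', p = p'.+1.
    by exists p.-1; rewrite prednK //; lia.
  have cE' : c = if odd p' then i else j.
    move: cE; rewrite Ep /=; case: (odd p') => /=; by case: cij => ->; rewrite ?eqxx.
  have := ellM a_gen (v * a c)%g (alt p' i j).
  have := ell_alt a_gen p' i j.
  have -> : (v * a c * alt p' i j)%g = w.
    by rewrite Ew Ep altl // -cE' mulKa.
  lia.
have vi := IHn v i _ (nextE i (or_introl erefl)).
have vj := IHn v j _ (nextE j (or_intror erefl)).
(* With [mm i j] letters or more, the braid relation would let the alternating word end in [a i],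
   and [w * a i] would be shorter than [w]. *)
have pm : (p < mm i j)%N.
  rewrite ltnNge; apply/negP => mp.
  have [y Ey yp] := alt_split a_gen (p - mm i j) (mm i j) i j.
  rewrite subnK // in Ey.
  have m0 : (0 < mm i j)%N by apply: leq_trans (mm_ge2 ij).
  have Ewi : (w * a i = v * y * alt (mm i j).-1 i j)%g.
    rewrite -vpw Ey alt_mm // -[in alt (mm i j) j i](prednK m0) /=.
    by rewrite !mulgA mulaK.
  have := ellM a_gen (v * y)%g (alt (mm i j).-1 i j).
  have := ellM a_gen v y; have := ell_alt a_gen (mm i j).-1 i j.
  rewrite -Ewi; lia.
move=> k; rewrite -vpw rhoM mxE.
have s1 : 0 < sinn R (mm i j) 1 by rewrite sinn_gt0 // mm_ge2.
apply: sumr_ge0 => h _; rewrite -(pmulr_rge0 _ s1) mulrCA.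
rewrite rho_alt // .
have [hi|hi] := eqVneq h i.
  rewrite hi; apply: mulr_ge0; first by apply: vi; rewrite ?vl; lia.
  by apply: addr_ge0; apply: mulr_ge0; rewrite ?sinn_ge0 ?ler0n // ltnW.
have [hj|hj] := eqVneq h j.
  rewrite hj; apply: mulr_ge0; first by apply: vj; rewrite ?vl; lia.
  by apply: addr_ge0; apply: mulr_ge0; rewrite ?sinn_ge0 ?ler0n // ltnW.
by case: (odd p); rewrite (negPf hi) (negPf hj) !mulr0 addr0 mulr0.
Qed.

Lemma rho_mula w i k : rho (w * a i)%g k i = - rho w k i.
Proof. by rewrite rhoM rho_gen Mref_mul Bform_refl; ring. Qed.

Lemma Tits_neg w i : (ell (w * a i)%g < ell w)%N -> forall k, rho w k i <= 0.
Proof.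
move=> wi k; rewrite -oppr_ge0 -rho_mula; apply: Tits_pos.
by rewrite mulaK.
Qed.

Definition chamber (f : 'rV[R]_N) := forall i, 0 <= f 0 i.

(** At a descent [i] of [w], column [i] of [rho w] is nonpositive, so coordinate [i] of [f *m rho w]
    has both signs and vanishes. Hence [a i] fixes [f *m rho w], and the induction goes on with
    [w * a i]. *)
Lemma chamber_stab w f : chamber f -> chamber (f *m rho w) ->
  f *m rho w = f /\ exists2 s, ev a s = w & all (fun i => f 0 i == 0) s.
Proof.
have [n] := ubnP (ell w); elim: n => // n IHn in w *.
rewrite ltnS => wn Df Dfw.
have [->|w1] := eqVneq w 1%g.
  by rewrite rho1 mulmx1; split=> //; exists [::].
have [i wi] := ell_descent a_inv a_gen w1.
have fwi : (f *m rho w) 0 i = 0.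
  apply: le_anti; rewrite Dfw andbT mxE; apply: sumr_le0 => k _.
  by rewrite mulr_ge0_le0 // Tits_neg.
have Ewi : f *m rho (w * a i)%g = f *m rho w.
  apply/matrixP=> r k; rewrite rhoM rho_gen mulmxA Mref_mul.
  by rewrite (ord1 r) fwi mulr0 mul0r subr0.
have [||fE [s sw sf]] := IHn (w * a i)%g _ Df; rewrite ?Ewi //.
  exact: leq_trans wi wn.
rewrite Ewi in fE; split=> //; exists (rcons s i).
  by rewrite -cats1 ev_cat sw /= mulg1 mulaK.
by rewrite all_rcons sf andbT -{1}fE fwi eqxx.
Qed.

Definition Bmx : 'M[R]_N := \matrix_(i, j) Bform i j.

Lemma Mref_isometry i : (Mref i)^T *m Bmx *m Mref i = Bmx.
Proof.
apply/matrixP=> k l; rewrite Mref_mul.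
have E (X : 'M[R]_N) r c : ((Mref i)^T *m X) r c = X r c - 2 * X i c * Bform i r.
  by rewrite -[X in _ *m X]trmxK -trmx_mul mxE Mref_mul !mxE.
by rewrite !E !mxE Bform_refl (Bform_sym k i); ring.
Qed.

Lemma rho_isometry w : (rho w)^T *m Bmx *m rho w = Bmx.
Proof.
have [s <-] := a_gen w; elim: s => [|i s IHs] /=.
  by rewrite rho1 trmx1 mul1mx mulmx1.
rewrite rhoM rho_gen trmx_mul -!mulmxA [Bmx *m (_ *m _)]mulmxA.
by rewrite [X in _ *m X]mulmxA [X in X *m rho _]mulmxA Mref_isometry mulmxA.
Qed.

Definition isroot (b : 'cV[R]_N) := exists w i, b = col i (rho w).
Definition nonneg (b : 'cV[R]_N) := forall k, 0 <= b k 0.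
Definition simple (j : 'I_N) : 'cV[R]_N := delta_mx j 0.

Lemma isroot_mul w b : isroot b -> isroot (rho w *m b).
Proof.
case=> v [i ->]; exists (w * v)%g, i.
by rewrite rhoM !colE mulmxA.
Qed.

Lemma isroot_sign b : isroot b -> nonneg b \/ nonneg (- b).
Proof.
case=> w [i ->]; have /orP[wi|wi] := ellMa_neq par_gen parM a_gen w i.
  by right=> k; rewrite !mxE oppr_ge0 Tits_neg.
by left=> k; rewrite mxE Tits_pos.
Qed.

Lemma isroot_norm b : isroot b -> b^T *m Bmx *m b = 1%:M.
Proof.
case=> w [i ->]; rewrite colE trmx_mul -!mulmxA [Bmx *m (_ *m _)]mulmxA.
rewrite [X in _ *m X]mulmxA [X in X *m delta_mx _ _]mulmxA rho_isometry.
rewrite mulmxA trmx_delta -rowE -colE.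
by apply/matrixP=> r c; rewrite !mxE !ord1 eqxx Bform_refl.
Qed.

Lemma isroot_simple b j : isroot b -> nonneg b ->
  (forall k, k != j -> b k 0 = 0) -> b = simple j.
Proof.
move=> rb pb bj.
have bE : b = b j 0 *: simple j.
  apply/matrixP=> k c; rewrite !mxE !ord1 eqxx andbT.
  have [->|kj] := eqVneq k j; first by rewrite mulr1.
  by rewrite mulr0 bj.
have := isroot_norm rb.
have -> : b^T *m Bmx *m b = (b j 0 * b j 0) *: ((simple j)^T *m Bmx *m simple j).
  by rewrite {1 2}bE [(_ *: _)^T]linearZ /= -!scalemxAl -!scalemxAr scalerA.
rewrite trmx_delta -rowE -colE => /matrixP/(_ 0 0).
rewrite !mxE Bform_refl mulr1 eqxx -expr2 => /eqP.
rewrite sqrf_eq1 => /orP[/eqP b1|/eqP b1]; first by rewrite bE b1 scale1r.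
by have := pb j; rewrite b1 ler0N1.
Qed.

Lemma isroot_neq0 b : isroot b -> b != 0.
Proof.
move=> rb; apply/eqP => b0; have := isroot_norm rb.
rewrite b0 mulmx0 => /matrixP/(_ 0 0); rewrite !mxE eqxx => /eqP.
by rewrite eq_sym oner_eq0.
Qed.

Lemma nonneg_anti b : nonneg b -> nonneg (- b) -> b = 0.
Proof.
move=> pb nb; apply/matrixP=> k c; rewrite mxE !ord1; apply: le_anti.
by have := nb k; rewrite pb mxE oppr_ge0 andbT.
Qed.

Lemma mul_Mref_col i (b : 'cV[R]_N) k : k != i -> (Mref i *m b) k 0 = b k 0.
Proof.
move=> /negPf ki; rewrite mxE (eq_bigr (fun l => (l == k)%:R * b l 0)).
  by rewrite sum_delta.
by move=> l _; rewrite mxE ki [k == l]eq_sym /=; ring.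
Qed.

(** [Mref j] changes coordinate [j] only, so a positive root that it makes negative has all its
    other coordinates zero. *)
Lemma simple_flip b j : isroot b -> nonneg b -> nonneg (- (Mref j *m b)) ->
  b = simple j.
Proof.
move=> rb pb nb; apply: isroot_simple => // k kj.
apply: le_anti; rewrite pb andbT.
by have := nb k; rewrite mxE mul_Mref_col // oppr_ge0.
Qed.

Lemma MrefKv j (b : 'cV[R]_N) : Mref j *m (Mref j *m b) = b.
Proof. by rewrite mulmxA MrefK mul1mx. Qed.

Lemma Mref_simple j : Mref j *m simple j = - simple j.
Proof.
apply/matrixP=> k c; rewrite -colE !mxE !ord1 Bform_refl eqxx andbT.
by case: (k == j) => /=; ring.
Qed.

Lemma isroot_Mref j b : isroot b -> isroot (Mref j *m b).
Proof. by move=> rb; rewrite -rho_gen; apply: isroot_mul. Qed.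

Lemma isroot_simple_gen j : isroot (simple j).
Proof. by exists 1%g, j; rewrite rho1 colE mul1mx. Qed.

Lemma nonneg_simple j : nonneg (simple j).
Proof. by move=> k; rewrite mxE ler0n. Qed.

(* Reflecting in a simple root on which [F] is negative removes that root from
   the list and permutes the other positive roots. *)
Lemma Tits_cone (F : 'rV[R]_N) (L : seq 'cV[R]_N) :
  (forall b, isroot b -> nonneg b -> (F *m b) 0 0 < 0 -> b \in L) ->
  exists w, chamber (F *m rho w).
Proof.
have [n] := ubnP (size L); elim: n => // n IHn in F L *.
rewrite ltnS => Ln FL.
have [DF|] := pselect (chamber F); first by exists 1%g; rewrite rho1 mulmx1.
move=> /existsNP[j] /negP; rewrite -ltNge => Fj.
have Fj' : (F *m simple j) 0 0 < 0 by rewrite -colE mxE.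
have jL : simple j \in L.
  by apply: FL => //; [exact: isroot_simple_gen | exact: nonneg_simple].
have [||w Dw] := IHn (F *m Mref j) (map (mulmx (Mref j)) (rem (simple j) L)).
- rewrite size_map size_rem //; apply: leq_trans Ln.
  by rewrite prednK //; case: L jL {FL}.
- move=> b rb pb; rewrite -mulmxA => Fb.
  rewrite -[b](MrefKv j); apply: map_f.
  have rb' := isroot_Mref j rb.
  have bj : b != simple j.
    apply: contraTneq Fb => ->; rewrite Mref_simple mulmxN mxE -leNgt.
    by rewrite oppr_ge0 ltW.
  have pb' : nonneg (Mref j *m b).
    have [//|nb] := isroot_sign rb'.
    by rewrite (simple_flip rb pb nb) eqxx in bj.
  have b'j : Mref j *m b != simple j.
    apply/eqP => E.
    have bE : b = - simple j by rewrite -Mref_simple -E MrefKv.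
    have /eqP := isroot_neq0 (isroot_simple_gen j); apply.
    by apply: nonneg_anti; rewrite -?bE //; apply: nonneg_simple.
  have := FL _ rb' pb' Fb.
  by rewrite (perm_mem (perm_to_rem jL)) inE (negPf b'j).
- by exists (a j * w)%g; rewrite rhoM rho_gen mulmxA.
Qed.

(** A positive root made negative by [w * a j] is either [simple j] or the image under [Mref j] of a
    positive root made negative by [w]. *)
Lemma finite_inversions w : exists L : seq 'cV[R]_N,
  forall b, isroot b -> nonneg b -> ~ nonneg (rho w *m b) -> b \in L.
Proof.
have [s <-] := a_gen w; elim/last_ind: s => [|s j [L HL]].
  by exists [::] => b _ pb; rewrite /= rho1 mul1mx.
exists (simple j :: map (mulmx (Mref j)) L) => b rb pb.
rewrite -cats1 ev_cat /= mulg1 rhoM rho_gen -mulmxA => nb.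
rewrite inE; have [//|bj] := eqVneq b (simple j).
rewrite -[b](MrefKv j) map_f //; apply: HL => //; first exact: isroot_Mref.
have [//|nb'] := isroot_sign (isroot_Mref j rb).
by rewrite (simple_flip rb pb nb') eqxx in bj.
Qed.

Lemma pairing_ge0 (f : 'rV[R]_N) b : chamber f -> nonneg b -> 0 <= (f *m b) 0 0.
Proof. by move=> Df pb; rewrite mxE; apply: sumr_ge0 => k _; apply: mulr_ge0. Qed.

Lemma rho_unit w : rho w \in unitmx.
Proof.
have /mulmx1_unit[] // : rho w *m rho w^-1%g = 1%:M by rewrite -rhoM mulgV.
Qed.

(* If the orbit of an interior point under [g] has a nonzero sum, that sum lies
   in the Tits cone.  If the sum vanishes then every positive root is negative
   somewhere on the orbit, so the root system is finite and any invariant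
   functional will do. *)
Lemma torsion_fixes g n : (0 < n)%N -> (g ^+ n = 1)%g ->
  (exists2 v : 'rV[R]_N, v != 0 & v *m rho g = v) ->
  exists w f, [/\ chamber f, f != 0 & f *m rho (g ^ w)%g = f].
Proof.
move=> n0 gn [v v0 vg].
pose f0 : 'rV[R]_N := const_mx 1.
have f0_chamber : chamber f0 by move=> i; rewrite mxE.
have f0_pos b : isroot b -> nonneg b -> 0 < (f0 *m b) 0 0.
  move=> rb pb; rewrite lt0r pairing_ge0 // andbT.
  apply: contraNneq (isroot_neq0 rb) => E; apply/eqP/matrixP=> k c.
  rewrite mxE ord1; move: E; rewrite mxE.
  rewrite (eq_bigr (fun k => b k 0)) => [|l _]; last by rewrite mxE mul1r.
  by move=> /psumr_eq0P ->.
pose F := \sum_(i < n) f0 *m rho (g ^+ i)%g.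
have [L HL] : exists L : seq 'cV[R]_N, forall b i, (i < n)%N ->
    isroot b -> nonneg b -> (f0 *m rho (g ^+ i)%g *m b) 0 0 < 0 -> b \in L.
  elim: (n) => [|m [L HL]]; first by exists [::].
  have [L' HL'] := finite_inversions (g ^+ m)%g.
  exists (L' ++ L) => b i; rewrite ltnS leq_eqVlt mem_cat => /orP[/eqP ->|im].
    move=> rb pb neg; rewrite HL' // => /(pairing_ge0 f0_chamber).
    by rewrite mulmxA leNgt neg.
  by move=> rb pb neg; rewrite (HL b i) ?orbT.
have FE b : (F *m b) 0 0 = \sum_(i < n) (f0 *m rho (g ^+ i)%g *m b) 0 0.
  by rewrite mulmx_suml summxE.
have negF b : (F *m b) 0 0 <= 0 -> isroot b -> nonneg b -> b \in L.
  move=> Fb rb pb; have [[i neg]|/forallNP pos] := pselect (exists i : 'I_n,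
      (f0 *m rho (g ^+ i)%g *m b) 0 0 < 0).
    exact: HL neg.
  suff : 0 < (F *m b) 0 0 by rewrite ltNge Fb.
  rewrite FE (bigD1 (Ordinal n0)) //= rho1 mulmx1 ltr_pwDl ?f0_pos //.
  by apply: sumr_ge0 => i _; rewrite leNgt; apply/negP/pos.
have Fg : F *m rho g = F.
  rewrite mulmx_suml; under eq_bigr => i _ do rewrite -mulmxA -rhoM -expgSr.
  case: (n) n0 gn @F {HL FE negF} => // m _ gn F.
  rewrite /F big_ord_recr big_ord_recl /= gn addrC; congr (_ + _).
have finish (v' : 'rV[R]_N) w : v' != 0 -> v' *m rho g = v' ->
    chamber (v' *m rho w) ->
    exists w f, [/\ chamber f, f != 0 & f *m rho (g ^ w)%g = f].
  move=> v'0 v'g Dw; exists w, (v' *m rho w); split=> //.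
    apply: contraNneq v'0 => /(congr1 (mulmx^~ (invmx (rho w)))).
    by rewrite mulmxK ?rho_unit // mul0mx => ->.
  by rewrite -mulmxA -rhoM conjgE mulVKg rhoM mulmxA v'g.
have [F0|F0] := eqVneq F 0; last first.
  have [w Dw] := Tits_cone (fun b rb pb Fb => negF b (ltW Fb) rb pb).
  exact: finish F0 Fg Dw.
have [b rb pb _|w Dw] := @Tits_cone v L.
  by apply: negF; rewrite // F0 mul0mx mxE.
exact: finish v0 vg Dw.
Qed.

Lemma sinn_nonunit m e : (0 < e < m)%N -> cos (e.*2%:R * angle R m) != 1.
Proof.
move=> em; have := sinn_gt0 R em; rewrite -muln2 natrM mulrAC mulr_natr.
rewrite cos_mulr2n cos2sin2 -/(sinn R m e) => s0.
by apply/eqP => E; have := exprn_gt0 2 s0; lra.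
Qed.

Lemma rotation_fix_small i j e (f : 'rV[R]_N) : i != j -> (0 < e < mm i j)%N ->
  f *m rho ((a i * a j) ^+ e)%g = f -> f 0 i = 0 /\ f 0 j = 0.
Proof.
move=> ij em fE; set m := mm i j; set x := angle R m.
have ji : j != i by rewrite eq_sym.
have e0 : (0 < e)%N by case/andP: em.
have col_i : sinn R m e.*2.+1 * f 0 i + sinn R m e.*2 * f 0 j =
    sinn R m 1 * f 0 i.
  have : (f *m rho ((a i * a j) ^+ e)%g) 0 i = f 0 i by rewrite fE.
  rewrite -alt_double // mxE => E; rewrite -[in RHS]E mulr_sumr {E}.
  rewrite (eq_bigr (fun l => (l == i)%:R * (sinn R m e.*2.+1 * f 0 l) +
     (l == j)%:R * (sinn R m e.*2 * f 0 l))) => [|l _].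
    by rewrite big_split /= !sum_delta.
  by rewrite mulrCA rho_alt // odd_double -/m; ring.
have col_j : - (sinn R m e.*2 * f 0 i + sinn R m e.*2.-1 * f 0 j) =
    sinn R m 1 * f 0 j.
  have : (f *m rho ((a i * a j) ^+ e)%g) 0 j = f 0 j by rewrite fE.
  rewrite -alt_double // mxE => E; rewrite -[in RHS]E mulr_sumr {E}.
  have altE : alt e.*2 i j = (alt e.*2.-1 j i * a j)%g.
    by rewrite -{1}(@prednK e.*2) ?double_gt0.
  rewrite (eq_bigr (fun l => - ((l == i)%:R * (sinn R m e.*2 * f 0 l) +
     (l == j)%:R * (sinn R m e.*2.-1 * f 0 l)))) => [|l _].
    by rewrite sumrN big_split /= !sum_delta.
  have odd2 : odd e.*2.-1 by rewrite -[odd _]negbK -oddS prednK ?odd_double ?double_gt0.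
  have := rho_alt e.*2.-1 l ji; rewrite -mm_sym -/m odd2 prednK ?double_gt0 //.
  by move=> Rl; rewrite mulrCA altE rho_mula mulrN Rl; ring.
have sx : sinn R m 1 = sin x by rewrite /sinn mul1r.
have s0 : 0 < sin x by rewrite -sx sinn_gt0 // mm_ge2.
have c1 := sinn_nonunit em; rewrite -/m -/x in c1.
move: col_i col_j; rewrite sx /sinn -/x.
have -> : e.*2.+1%:R * x = e.*2%:R * x + x by rewrite -natr1; ring.
have -> : e.*2.-1%:R * x = e.*2%:R * x - x.
  by rewrite -[in RHS](@prednK e.*2) ?double_gt0 // -natr1; ring.
move: c1; move: (e.*2%:R * x) => y c1; rewrite sinB sinD => E1 E2.
have := cos2Dsin2 y; have := cos2Dsin2 x.
set S := sin y in E1 E2 *; set C := cos y in c1 E1 E2 *.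
set s := sin x in s0 E1 E2 *; set c := cos x in E1 E2 *; move=> Ex Ey.
(* The linear system [Ha], [Hb] below has determinant [- 2 * (s ^+ 2 * (1 - C))]; the proof ends by
   Cramer's rule. *)
have d0 : s ^+ 2 * (1 - C) != 0.
  by rewrite mulf_eq0 negb_or expf_neq0 ?(gt_eqF s0) //= subr_eq0 eq_sym.
have Ha : (S * c + C * s - s) * f 0 i + S * f 0 j = 0 by rewrite mulrBl; lra.
have Hb : S * f 0 i + (S * c - C * s + s) * f 0 j = 0 by rewrite !mulrDl; lra.
have ES : S ^+ 2 = 1 - C ^+ 2 by rewrite -Ey; ring.
have Ec : c ^+ 2 = 1 - s ^+ 2 by rewrite -Ex; ring.
split; apply: (mulfI d0); rewrite mulr0; apply: (mulfI (_ : - 2%:R != 0 :> R)).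
- by rewrite oppr_eq0 pnatr_eq0.
- transitivity ((S * c - C * s + s) * ((S * c + C * s - s) * f 0 i + S * f 0 j)
    - S * (S * f 0 i + (S * c - C * s + s) * f 0 j)); last by rewrite Ha Hb; ring.
  transitivity ((S ^+ 2 * c ^+ 2 - s ^+ 2 * (C - 1) ^+ 2 - S ^+ 2) * f 0 i).
    by rewrite Ec ES; ring.
  by ring.
- by rewrite oppr_eq0 pnatr_eq0.
- transitivity ((S * c + C * s - s) * (S * f 0 i + (S * c - C * s + s) * f 0 j)
    - S * ((S * c + C * s - s) * f 0 i + S * f 0 j)); last by rewrite Ha Hb; ring.
  transitivity ((S ^+ 2 * c ^+ 2 - s ^+ 2 * (C - 1) ^+ 2 - S ^+ 2) * f 0 j).
    by rewrite Ec ES; ring.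
  by ring.
Qed.

Lemma rotation_fix i j e (f : 'rV[R]_N) : i != j ->
  ((a i * a j) ^+ e != 1)%g ->
  f *m rho ((a i * a j) ^+ e)%g = f -> f 0 i = 0 /\ f 0 j = 0.
Proof.
move=> ij; rewrite {1 2}(divn_eq e (mm i j)) expgnDr mulnC expgnA a_braid //.
rewrite expg1n mul1g => e1; apply: rotation_fix_small => //.
rewrite ltn_mod (ltn_trans _ (mm_ge2 ij)) // andbT lt0n.
by apply: contraNneq e1 => ->.
Qed.

Lemma rotation_order i j e : i != j ->
  ((a i * a j) ^+ e == 1)%g = (mm i j %| e)%N.
Proof.
move=> ij; apply/eqP/idP => [|/dvdnP[k ->]]; last first.
  by rewrite mulnC expgnA a_braid // expg1n.
rewrite {1}(divn_eq e (mm i j)) expgnDr mulnC expgnA a_braid //.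
rewrite expg1n mul1g => e1; rewrite /dvdn; apply: contraT => e0.
(* A trivial power would fix every row, in particular one whose coordinate [i] is 1. *)
have [||/= + _] := @rotation_fix_small i j (e %% mm i j) (delta_mx 0 i) ij.
- by rewrite lt0n e0 ltn_mod (ltn_trans _ (mm_ge2 ij)).
- by rewrite e1 rho1 mulmx1.
by rewrite mxE !eqxx => /eqP; rewrite oner_eq0.
Qed.

End Representation.
End Reflections.

(** * Rank three: rotations about the vertices of a triangle *)

Definition third (i j : 'I_3) : 'I_3 := inord (3 - (i + j)).

Lemma third_sym i j : third i j = third j i.
Proof. by rewrite /third addnC. Qed.

Lemma third_nx i : third (nx i) (nx (nx i)) = i.
Proof. by apply/val_inj; rewrite /= inordK; case: i => [[|[|[|]]]]. Qed.

Lemma nx3 i : nx (nx (nx i)) = i.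
Proof. by apply/val_inj; case: i => [[|[|[|]]]]. Qed.

Lemma nx_neq i : nx i != i.
Proof. by case: i => [[|[|[|]]]]. Qed.

Lemma nx2_neq i : nx (nx i) != i.
Proof. by case: i => [[|[|[|]]]]. Qed.

Lemma nx_cases (i j : 'I_3) : [\/ j = i, j = nx i | j = nx (nx i)].
Proof.
have : [|| j == i, j == nx i | j == nx (nx i)].
  by move: i j => [[|[|[|?]]] hi] // [[|[|[|?]]] hj].
move=> /or3P[] /eqP ->; [exact: Or31 | exact: Or32 | exact: Or33].
Qed.

Section Rank3.
Variables (R : realType) (p : 'I_3 -> nat).
Hypothesis p_ge2 : forall i, (1 < p i)%N.

(** The three indices sum to 3, so for distinct [i] and [j] the mirrors [i] and [j] meet at the
    remaining vertex [third i j]. *)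
Definition mm (i j : 'I_3) := p (third i j).

Lemma mm_sym i j : mm i j = mm j i.
Proof. by rewrite /mm third_sym. Qed.

Lemma mm_ge2 i j : i != j -> (1 < mm i j)%N.
Proof. by move=> _; apply: p_ge2. Qed.

Local Notation Mref := (Mref R mm).

Lemma det_Mref i : \det (Mref i) = -1.
Proof.
rewrite (expand_det_row _ ord0) !big_ord_recl big_ord0.
rewrite /cofactor !(expand_det_row _ ord0) !big_ord_recl !big_ord0 /cofactor !det_mx11.
rewrite !mxE /Bform.
case: i => [[|[|[|?]]] hi] //=; ring.
Qed.

Variables (W : groupType) (a : 'I_3 -> W) (par : W -> bool) (rho : W -> 'M[R]_3).
Hypothesis a_inv : forall i, (a i * a i = 1)%g.
Hypothesis par_gen : forall i, par (a i) = true.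
Hypothesis parM : forall x y, par (x * y)%g = par x (+) par y.
Hypothesis a_gen : forall w, exists s, ev a s = w.
Hypothesis rho1 : rho 1%g = 1%:M.
Hypothesis rhoM : forall x y, rho (x * y)%g = rho x *m rho y.
Hypothesis rho_gen : forall i, rho (a i) = Mref i.
Hypothesis a_braid : forall i j, i != j -> ((a i * a j) ^+ mm i j = 1)%g.

Definition rotation i := (a (nx i) * a (nx (nx i)))%g.
(** The vertex [i] of the chamber, fixed by the two reflections whose product is [rotation i]. *)
Definition omega i : 'rV[R]_3 := delta_mx 0 i.

Lemma mm_nx i : mm (nx i) (nx (nx i)) = p i.
Proof. by rewrite /mm third_nx. Qed.

Lemma rot_order i e : (rotation i ^+ e == 1)%g = (p i %| e)%N.
Proof.
rewrite -[p i]mm_nx; apply: (rotation_order mm_sym mm_ge2 rho1 rhoM rho_gen a_braid) => //.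
by rewrite eq_sym nx_neq.
Qed.

Lemma chamber_omega i : chamber (omega i).
Proof. by move=> j; rewrite mxE ler0n. Qed.

(** The full stabiliser of the vertex is the dihedral group of the two reflections through it;
    parity leaves only the rotations. *)
Lemma omega_stab i g : par g = false -> omega i *m rho g = omega i ->
  exists e, g = (rotation i ^+ e)%g.
Proof.
move=> pg gi; have Dg := chamber_omega i; rewrite -gi in Dg.
have [_ [s sg si]] := chamber_stab mm_sym mm_ge2 a_inv par_gen parM a_gen
  rho1 rhoM rho_gen a_braid (chamber_omega i) Dg.
have si' : all (fun j => (j == nx i) || (j == nx (nx i))) s.
  apply: sub_all si => j; rewrite mxE eqxx /= pnatr_eq0 eqb0.
  by case: (nx_cases i j) => ->; rewrite eqxx ?orbT.
have ij : nx i != nx (nx i) by rewrite eq_sym nx_neq.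
have [e] := dihedral_word a_inv (ltnW (mm_ge2 ij)) (a_braid ij) si'.
rewrite sg => [[Eg|Eg]]; exists e => //.
have par_rot : par (rotation i) = false by rewrite parM !par_gen.
have : par (rotation i ^+ e)%g = false.
  by elim: (e) => [|k IHk]; rewrite ?(par1 parM) // expgS parM par_rot IHk.
by move=> pe; move: pg; rewrite Eg parM par_gen -/(rotation i) pe.
Qed.

Lemma rot_fix i e (f : 'rV[R]_3) : (rotation i ^+ e != 1)%g ->
  f *m rho (rotation i ^+ e)%g = f -> f = f 0 i *: omega i.
Proof.
move=> e1 fe; have ij : nx i != nx (nx i) by rewrite eq_sym nx_neq.
have [f1 f2] := rotation_fix mm_sym mm_ge2 rho1 rhoM rho_gen a_braid ij e1 fe.
apply/matrixP=> r k; rewrite !mxE !ord1 eqxx.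
by case: (nx_cases i k) => ->; rewrite ?f1 ?f2 ?eqxx ?mulr1 //
  ?(negPf (nx_neq _)) ?(negPf (nx2_neq _)) mulr0.
Qed.

Lemma det_rho w : \det (rho w) = (-1) ^+ par w.
Proof.
have [s <-] := a_gen w; elim: s => [|i s IHs]; first by rewrite (par1 parM) rho1 det1.
by rewrite /= rhoM det_mulmx rho_gen det_Mref IHs parM par_gen addTb signrN mulN1r.
Qed.

Lemma rotation_fixed_vector g n : (0 < n)%N -> (g ^+ n = 1)%g -> par g = false ->
  exists2 v : 'rV[R]_3, v != 0 & v *m rho g = v.
Proof.
move=> n0 gn pg; pose A := rho g.
have dA : \det A = 1 by rewrite det_rho pg.
(* Averaging over the powers of [g] gives a positive definite form preserved by [A]. *)
pose P := \sum_(i < n) rho (g ^+ i)%g *m (rho (g ^+ i)%g)^T.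
have AP : A *m P *m A^T = P.
  rewrite mulmx_sumr mulmx_suml.
  under eq_bigr => i _ do
    rewrite !mulmxA -mulmxA -trmx_mul -rhoM -expgS.
  case: (n) n0 gn @P => // m _ gn P.
  by rewrite /P big_ord_recr big_ord_recl /= gn addrC; congr (_ + _).
have dP : \det P != 0.
  apply/det0P => -[v v0 vP]; case/eqP: v0.
  have : v *m P *m v^T = 0 by rewrite vP mul0mx.
  have -> : v *m P *m v^T = \sum_(i < n) (v *m rho (g ^+ i)%g) *m (v *m rho (g ^+ i)%g)^T.
    by rewrite mulmx_sumr mulmx_suml; apply: eq_bigr => i _; rewrite trmx_mul !mulmxA.
  move=> /matrixP/(_ 0 0); rewrite summxE mxE.
  have E (u : 'rV[R]_3) : (u *m u^T) 0 0 = \sum_k u 0 k ^+ 2.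
    by rewrite mxE; apply: eq_bigr => k _; rewrite mxE.
  have E' (u : 'rV[R]_3) : 0 <= (u *m u^T) 0 0 :> R.
    by rewrite E sumr_ge0 // => k _; rewrite sqr_ge0.
  move=> /psumr_eq0P S0; have := S0 (fun i _ => E' _) (Ordinal n0) isT.
  rewrite /= rho1 mulmx1 E => S1.
  move/psumr_eq0P: S1 => /(_ (fun k _ => sqr_ge0 (v 0 k))) H.
  apply/matrixP=> r k; rewrite ord1 mxE; apply/eqP.
  by rewrite -sqrf_eq0 H.
have : \det (A - 1%:M) = 0.
  (* Since [P] and [A] are invertible with [\det A = 1], the matrices [A - 1] and [1 - A^T] have the
     same determinant. In dimension 3 these determinants are also opposite, so they vanish. *)
  have : (A - 1%:M) *m P *m A^T = P *m (1%:M - A^T).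
    by rewrite mulmxBl mulmxBl AP mul1mx mulmxBr mulmx1.
  move=> /(congr1 determinant); rewrite !det_mulmx det_tr dA mulr1 mulrC => /(mulfI dP).
  have -> : 1%:M - A^T = (- 1) *: (A - 1%:M)^T.
    by rewrite linearB /= trmx1 scaleN1r opprB.
  by rewrite detZ det_tr => E; lra.
move=> /eqP/det0P[v v0]; rewrite mulmxBr mulmx1 => /subr0_eq vg.
by exists v.
Qed.

Lemma flip_conj_rot i e :
  exists e', ((rotation i ^+ e) ^ a (nx i) = rotation i ^+ (e' : nat))%g.
Proof.
exists ((p i).-1 * e)%N; rewrite conjgE a_V // mulgA.
have p0 : (0 < p i)%N by apply: ltnW.
have xp : (rotation i ^+ p i = 1)%g by apply/eqP; rewrite rot_order.
by rewrite (flip_rot a_inv e p0 xp) (mulaK a_inv).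
Qed.

Lemma omega_neq0 i : omega i != 0.
Proof.
by apply/eqP => /matrixP/(_ 0 i); rewrite !mxE !eqxx => /eqP; rewrite oner_eq0.
Qed.

Lemma rho_act_neq0 w (f : 'rV[R]_3) : f != 0 -> f *m rho w != 0.
Proof.
apply: contraNneq => /(congr1 (mulmx^~ (rho w^-1%g))).
by rewrite mul0mx -mulmxA -rhoM mulgV rho1 mulmx1 => ->.
Qed.

Lemma torsion_conj g n : (0 < n)%N -> (g ^+ n = 1)%g -> par g = false ->
  exists i e h, par h = false /\ g = ((rotation i ^+ e) ^ h)%g.
Proof.
move=> n0 gn pg.
have [w [f [Df f0 fE]]] := torsion_fixes mm_sym mm_ge2 a_inv par_gen parM a_gen
  rho1 rhoM rho_gen a_braid n0 gn (rotation_fixed_vector n0 gn pg).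
have pgw : par (g ^ w)%g = false.
  have := parM w (g ^ w)%g; rewrite -conjgC parM pg /=.
  by case: (par w); case: (par _).
have [i fi] : exists i, f 0 i != 0.
  apply: contrapT => /forallNP f_eq0; case/eqP: f0; apply/matrixP => r k.
  by rewrite ord1 mxE; apply/eqP; apply: contra_notT (f_eq0 k).
have Dfg : chamber (f *m rho (g ^ w)%g) by rewrite fE.
have [_ [s sg si]] := chamber_stab mm_sym mm_ge2 a_inv par_gen parM a_gen
  rho1 rhoM rho_gen a_braid Df Dfg.
(* All letters of [s] differ from [i] because [f 0 i] is nonzero, so the word fixes the vertex
   [omega i]. *)
have [e Ee] : exists e, (g ^ w = rotation i ^+ e)%g.
  apply: omega_stab => //; rewrite -{}sg.
  elim: s si => [|j s IHs] /=; first by rewrite rho1 mulmx1.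
  case/andP=> fj /IHs sE; rewrite rhoM rho_gen mulmxA.
  suff -> : omega i *m Mref j = omega i by [].
  apply/matrixP=> r k; rewrite Mref_mul !mxE !ord1 eqxx /=.
  have -> : (j == i) = false by apply: contraNF fi => /eqP <-.
  by rewrite mulr0 mul0r subr0.
have gE : (g = (rotation i ^+ e) ^ w^-1)%g by rewrite -Ee conjgK.
(* An odd conjugator is corrected by [a (nx i)], which normalises the rotations about the vertex
   [i]. *)
case pw : (par w); last first.
  exists i, e, (w^-1)%g; split=> //.
  by have := parM w w^-1%g; rewrite mulgV (par1 parM) pw.
have [e' Ee'] := flip_conj_rot i e.
exists i, e', ((a (nx i))^-1 * w^-1)%g; split.
  rewrite a_V // parM par_gen.
  by have := parM w w^-1%g; rewrite mulgV (par1 parM) pw; case: (par _).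
by rewrite -Ee' conjgM conjgK.
Qed.

Lemma rot_fix_conj i e h (f : 'rV[R]_3) : (rotation i ^+ e != 1)%g ->
  f *m rho ((rotation i ^+ e) ^ h)%g = f ->
  exists c, f = c *: (omega i *m rho h).
Proof.
move=> e1 fE; exists ((f *m rho h^-1%g) 0 i).
have : f *m rho h^-1%g = (f *m rho h^-1%g) 0 i *: omega i.
  apply: rot_fix e1 _; rewrite -[in RHS]fE -!mulmxA -!rhoM; congr (_ *m rho _).
  by rewrite conjgE -!mulgA mulgV mulg1.
move=> E; rewrite scalemxAl -E -mulmxA -rhoM mulVg rho1 mulmx1 //.
Qed.

Lemma omega_rot i e h :
  omega i *m rho h *m rho ((rotation i ^+ e) ^ h)%g = omega i *m rho h.
Proof.
rewrite -mulmxA -rhoM -conjgC rhoM mulmxA; congr (_ *m _).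
elim: e => [|e IHe]; first by rewrite rho1 mulmx1.
rewrite expgSr rhoM mulmxA IHe rhoM !rho_gen mulmxA.
apply/matrixP=> r k; rewrite !Mref_mul !mxE !ord1 eqxx /=.
by rewrite (negPf (nx_neq i)) (negPf (nx2_neq i)) /=; ring.
Qed.

Lemma rot_neq1 i : (rotation i ^+ 1 != 1)%g.
Proof. by rewrite rot_order dvdn1 gtn_eqF. Qed.

Lemma par_conj g h : par (g ^ h)%g = par g.
Proof.
have := parM h (g ^ h)%g; rewrite -conjgC parM.
by case: (par g); case: (par h); case: (par _).
Qed.

Lemma par_rotX i e : par (rotation i ^+ e)%g = false.
Proof.
elim: e => [|e IHe]; first exact: par1 parM.
by rewrite expgS parM IHe parM !par_gen.
Qed.

(* [x_i] and its conjugate have the same axis, hence generate the stabiliser of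
   the same line. *)
Lemma conj_rot_order i j e h : rotation i = ((rotation j ^+ e) ^ h)%g -> p i = p j.
Proof.
move=> E.
have e1 : (rotation j ^+ e != 1)%g.
  by have := rot_neq1 i; rewrite expg1 E conjg_eq1.
have [c oc] : exists c, omega j *m rho h = c *: omega i.
  exists ((omega j *m rho h) 0 i).
  apply: (@rot_fix i 1); rewrite ?rot_neq1 // expg1 E; exact: omega_rot.
have c0 : c != 0.
  apply: contraNneq (rho_act_neq0 h (omega_neq0 j)) => c0.
  by rewrite oc c0 scale0r.
have oc' : omega i *m rho h^-1%g = c^-1 *: omega j.
  apply: (scalerI c0); rewrite scalerA mulfV // scale1r scalemxAl -oc.
  by rewrite -mulmxA -rhoM mulgV rho1 mulmx1.
have [l El] : exists l, (rotation j ^ h = rotation i ^+ l)%g.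
  apply: omega_stab; first by rewrite par_conj; apply: (par_rotX j 1).
  apply: (scalerI c0); rewrite scalemxAl -oc.
  by have := omega_rot j 1 h; rewrite expg1.
have [l' El'] : exists l', (rotation i ^ h^-1 = rotation j ^+ l')%g.
  apply: omega_stab; first by rewrite par_conj; apply: (par_rotX i 1).
  apply: (scalerI (invr_neq0 c0)); rewrite scalemxAl -oc'.
  by have := omega_rot i 1 h^-1%g; rewrite expg1.
apply/eqP; rewrite eqn_dvd -!rot_order; apply/andP; split.
  rewrite -(conjg_eq1 _ h^-1%g) conjXg El' -expgnA mulnC expgnA.
  by have := rot_order j (p j); rewrite dvdnn => /eqP ->; rewrite expg1n.
rewrite -(conjg_eq1 _ h) conjXg El -expgnA mulnC expgnA.
by have := rot_order i (p i); rewrite dvdnn => /eqP ->; rewrite expg1n.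
Qed.

(** A nontrivial rotation fixes a single line. The line fixed by [y] is also fixed by its power, so
    it is the axis of the given rotation, and [y] lies in the stabiliser of that axis. *)
Lemma root_of_rot y N n i e h : (0 < N)%N -> (y ^+ N = 1)%g -> par y = false ->
  (y ^+ n = (rotation i ^+ e) ^ h)%g -> (rotation i ^+ e != 1)%g ->
  exists l, (y = (rotation i ^+ l) ^ h)%g.
Proof.
move=> N0 yN py yn e1.
have [j [l [h' [_ yE]]]] := torsion_conj N0 yN py.
have fixy := omega_rot j l h'; rewrite -yE in fixy.
have fixyn : omega j *m rho h' *m rho (y ^+ n)%g = omega j *m rho h'.
  elim: (n) => [|m IHm]; first by rewrite rho1 mulmx1.
  by rewrite expgS rhoM mulmxA fixy.
rewrite yn in fixyn; have [c oc] := rot_fix_conj e1 fixyn.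
have c0 : c != 0.
  apply: contraNneq (rho_act_neq0 h' (omega_neq0 j)) => c0.
  by rewrite oc c0 scale0r.
have fixh : omega i *m rho h *m rho y = omega i *m rho h.
  by apply: (scalerI c0); rewrite scalemxAl -oc fixy.
have [m Em] : exists m, (y ^ h^-1 = rotation i ^+ m)%g.
  apply: omega_stab; first by rewrite par_conj.
  rewrite conjgE invgK !rhoM !mulmxA fixh -mulmxA -rhoM mulgV rho1 mulmx1 //.
by exists m; rewrite -Em conjgKV.
Qed.

(** This entry is [sin (2 x) / sin x] with [x = pi / p i], which is positive as soon as
    [p i > 2]. *)
Lemma rho_rot_offdiag i : rho (rotation i) (nx (nx i)) (nx i) = 0 -> p i = 2%N.
Proof.
move=> r0; have ij : nx i != nx (nx i) by rewrite eq_sym nx_neq.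
have := rho_alt mm_sym rho1 rhoM rho_gen 2 (nx (nx i)) ij.
have -> : alt a 2 (nx i) (nx (nx i)) = rotation i by rewrite /= mul1g.
rewrite r0 mulr0 /= eqxx [_ == nx i]eq_sym (negPf ij) mulr0 add0r mulr1 mm_nx => s2.
apply/eqP; rewrite eqn_leq p_ge2 andbT leqNgt; apply/negP => p2.
by have := @sinn_gt0 R (p i) 2; rewrite p2 -s2 ltxx => /(_ isT).
Qed.

(** Such a [g] preserves the three axes, so it acts diagonally, with entries 1 or -1 of product 1.
    If all are 1 it fixes an interior point of the chamber and is trivial. Otherwise commutation
    with a rotation kills its off-diagonal entry between opposite signs, which forces order 2. *)
Lemma rot_centralizer g : par g = false -> (forall i, commute g (rotation i)) ->
  g = 1%g \/ exists l e, (g = rotation l ^+ (e : nat))%g /\ forall i, i != l -> p i = 2%N.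
Proof.
move=> pg cg; pose c i := (omega i *m rho g) 0 i.
have ocE i : omega i *m rho g = c i *: omega i.
  apply: (@rot_fix i 1); first exact: rot_neq1.
  rewrite expg1 -mulmxA -rhoM cg rhoM mulmxA; congr (_ *m _).
  by have := omega_rot i 1 1%g; rewrite conjg1 expg1 rho1 mulmx1.
have rhogE : rho g = diag_mx (\row_i c i).
  apply/row_matrixP => i; rewrite rowE -/(omega i) ocE rowE.
  apply/matrixP=> r k; rewrite ord1 mul_mx_diag !mxE eqxx /=.
  by have [->|] := eqVneq k i; rewrite ?mulr1 ?mul1r // mulr0 mul0r.
have c2 i : (c i == 1) || (c i == -1).
  rewrite -sqrf_eq1.
  have E : omega i *m rho (g * g)%g = (c i ^+ 2) *: omega i.
    by rewrite rhoM mulmxA ocE -scalemxAl ocE scalerA.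
  (* A chamber point that stays in the chamber is fixed, so the square of the eigenvalue is 1. *)
  have D : chamber (omega i *m rho (g * g)%g).
    by rewrite E => k; rewrite !mxE mulr_ge0 ?sqr_ge0 ?ler0n.
  have [] := chamber_stab mm_sym mm_ge2 a_inv par_gen parM a_gen
    rho1 rhoM rho_gen a_braid (chamber_omega i) D.
  rewrite E => /matrixP/(_ 0 i); rewrite !mxE !eqxx mulr1 => -> //.
have prod_c i : c i * c (nx i) * c (nx (nx i)) = 1.
  have : \det (rho g) = 1 by rewrite det_rho pg.
  rewrite rhogE det_diag; under eq_bigr do rewrite mxE.
  move=> <-; rewrite (bigD1 i) //= (bigD1 (nx i)) ?nx_neq //=.
  rewrite (big_pred1 (nx (nx i))) ?mulrA // => k; case: (nx_cases i k) => ->;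
    rewrite ?eqxx ?nx_neq ?nx2_neq ?andbT ?andbF //=.
  - by rewrite eq_sym (negPf (nx2_neq _)).
  - by rewrite eq_sym (negPf (nx_neq _)).
  - by rewrite eqxx.
have p2 i : c (nx i) != c (nx (nx i)) -> p i = 2%N.
  move=> ci; apply: rho_rot_offdiag.
  have := cg i; move=> /(congr1 rho); rewrite !rhoM rhogE => /matrixP.
  move=> /(_ (nx (nx i)) (nx i)); rewrite mul_diag_mx mul_mx_diag !mxE.
  move=> /eqP; rewrite mulrC -subr_eq0 -mulrBr mulf_eq0 subr_eq0.
  by rewrite [X in _ || X]eq_sym (negPf ci) orbF => /eqP.
have fin l : c l = 1 -> c (nx l) = -1 -> c (nx (nx l)) = -1 ->
    exists l e, (g = rotation l ^+ (e : nat))%g /\ forall i, i != l -> p i = 2%N.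
  move=> c0 c1 c2'; exists l.
  have [|e ge] := @omega_stab l g pg; first by rewrite ocE c0 scale1r.
  exists e; split=> // i; case: (nx_cases l i) => ->; rewrite ?eqxx // => _.
    by apply: p2; rewrite nx3 c0 c2' -subr_eq0; apply/eqP; lra.
  by apply: p2; rewrite nx3 c0 c1 -subr_eq0; apply/eqP; lra.
have [allc|/existsNP[i /eqP ci]] := pselect (forall i, c i = 1); last first.
  right; have := c2 i; rewrite (negPf ci) => /eqP ci'.
  have := prod_c i; have /orP[/eqP E1|/eqP E1] := c2 (nx i);
    have /orP[/eqP E2|/eqP E2] := c2 (nx (nx i)); rewrite ci' E1 E2; try lra.
    by move=> _; apply: (fin (nx i)); rewrite ?nx3.
  by move=> _; apply: (fin (nx (nx i))); rewrite ?nx3.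
left; pose f : 'rV[R]_3 := const_mx 1.
have fE : f *m rho g = f.
  apply/matrixP=> r k; rewrite rhogE mul_mx_diag !mxE allc mulr1 //.
have Df : chamber f by move=> i; rewrite mxE ler01.
have Dfg : chamber (f *m rho g) by rewrite fE.
have [_ [[|i0 s] <- //]] := chamber_stab mm_sym mm_ge2 a_inv par_gen parM a_gen
    rho1 rhoM rho_gen a_braid Df Dfg.
by rewrite /= mxE oner_eq0.
Qed.

End Rank3.

Section UnitGroup.
Variable R : unitRingType.

Definition unit_group := {x : R | x \is a GRing.unit}.
HB.instance Definition _ := Choice.on unit_group.

Definition ug_one : unit_group := exist _ 1 (unitr1 R).
Lemma ug_mul_subproof (x y : unit_group) : val x * val y \is a GRing.unit.
Proof. by apply: rpredM; exact: valP. Qed.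
Lemma ug_inv_subproof (x : unit_group) : (val x)^-1 \is a GRing.unit.
Proof. by rewrite unitrV; exact: valP. Qed.
Definition ug_mul (x y : unit_group) : unit_group :=
  exist (fun x : R => x \is a GRing.unit) _ (ug_mul_subproof x y).
Definition ug_inv (x : unit_group) : unit_group :=
  exist (fun x : R => x \is a GRing.unit) _ (ug_inv_subproof x).

Lemma ug_mulA : associative ug_mul.
Proof. by move=> x y z; apply/val_inj; rewrite /= mulrA. Qed.
Lemma ug_mul1 : left_id ug_one ug_mul.
Proof. by move=> x; apply/val_inj; rewrite /= mul1r. Qed.
Lemma ug_mulr1 : right_id ug_one ug_mul.
Proof. by move=> x; apply/val_inj; rewrite /= mulr1. Qed.
Lemma ug_mulV : left_inverse ug_one ug_inv ug_mul.
Proof. by move=> x; apply/val_inj; rewrite /= mulVr //; exact: valP. Qed.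
Lemma ug_mulrV : right_inverse ug_one ug_inv ug_mul.
Proof. by move=> x; apply/val_inj; rewrite /= mulrV //; exact: valP. Qed.

HB.instance Definition _ := isGroup.Build unit_group
  ug_mulA ug_mul1 ug_mulr1 ug_mulV ug_mulrV.

Lemma val_ugM (x y : unit_group) : val (x * y)%g = val x * val y.
Proof. by []. Qed.
Lemma val_ug1 : val (1%g : unit_group) = 1.
Proof. by []. Qed.
Lemma val_ugX (x : unit_group) n : val (x ^+ n)%g = val x ^+ n.
Proof. by elim: n => [|n IHn] //; rewrite expgS exprS val_ugM IHn. Qed.
End UnitGroup.

(** * Braid relations between the reflection matrices *)

Section Braid.
Variables (R : realType) (n : nat) (mm : 'I_n.+1 -> 'I_n.+1 -> nat).
Hypothesis mm_sym : forall i j, mm i j = mm j i.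
Hypothesis mm_ge2 : forall i j, i != j -> (1 < mm i j)%N.

Local Notation Mref := (Mref R mm).
Local Notation Bform := (Bform R mm).
Definition brow i : 'rV[R]_n.+1 := \row_l Bform i l.

Lemma row_Mref f i : f *m Mref i = f - (2 * f 0 i) *: brow i.
Proof. by apply/matrixP=> r k; rewrite Mref_mul !mxE !ord1. Qed.

(** The relations must hold for the matrices before any group can act through them. This is the sine
    recurrence of [rho_alt] again, on rows and for powers of a product of two reflections. *)
Lemma brow_rotX i j e : i != j ->
  sinn R (mm i j) 1 *: (brow j *m (Mref i * Mref j) ^+ e) =
  sinn R (mm i j) e.*2.+1 *: brow j + sinn R (mm i j) e.*2 *: brow i.
Proof.
move=> ij; set m := mm i j.
have Bij : Bform i j = - cos (angle R m) by rewrite /Bform (negPf ij).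
have Bji : Bform j i = - cos (angle R m) by rewrite Bform_sym.
elim: e => [|e IHe]; first by rewrite expr0 mulmx1 sinn0 scale0r addr0.
rewrite exprSr -!mulmxE mulmxA scalemxAl IHe mulmxA.
apply/matrixP=> r k; rewrite !row_Mref !mxE Bij Bji !Bform_refl.
by rewrite doubleS -(sinn_rec R m e.*2.+1) -(sinn_rec R m e.*2); ring.
Qed.

Lemma brow_rot_id i j : i != j ->
  brow j *m (Mref i * Mref j) ^+ mm i j = brow j.
Proof.
move=> ij; have m0 := ltnW (mm_ge2 ij).
have s0 : sinn R (mm i j) 1 != 0 by rewrite gt_eqF // sinn_gt0 // mm_ge2.
apply: (scalerI s0); rewrite brow_rotX // -addnn sinnDm // sinnm // oppr0 scale0r.
by rewrite addr0 -addSn sinnDm // -[(mm i j).+1]add1n sinnDm // opprK.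
Qed.

Lemma Mref_braid i j : i != j -> (Mref i * Mref j) ^+ mm i j = 1.
Proof.
move=> ij; have ji : j != i by rewrite eq_sym.
have b_j := brow_rot_id ij.
have b_i : brow i *m (Mref i * Mref j) ^+ mm i j = brow i.
  rewrite -{1}(brow_rot_id ji) (mm_sym j i) -mulmxA.
  have -> : (Mref j * Mref i) ^+ mm i j *m (Mref i * Mref j) ^+ mm i j = 1%:M.
    have M2 k : Mref k * Mref k = 1 by apply: MrefK.
    have E k l : Mref k * Mref l * (Mref l * Mref k) = 1.
      by rewrite -mulrA (mulrA (Mref l)) M2 mul1r M2.
    by rewrite mulmxE -exprMn_comm ?E ?expr1n // /GRing.comm !E.
  by rewrite mulmx1.
(* The determinant of the form on the plane of the two roots, equal to the square of [sin (pi / m)];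
   it allows the splitting below. *)
have det_neq0 : 1 - Bform i j ^+ 2 != 0.
  rewrite /Bform (negPf ij) sqrrN -sin2cos2 expf_neq0 // gt_eqF //.
  by have := @sinn_gt0 R (mm i j) 1; rewrite mm_ge2 // /sinn mul1r; apply.
apply/row_matrixP => r; rewrite rowE row1; move: (delta_mx 0 r) => f.
(* Split [f] into a part killed by both coroots and a combination of the two
   rows of the form, on which the rotation has order [mm i j]. *)
pose d := 1 - Bform i j ^+ 2.
pose x := (f 0 i - Bform i j * f 0 j) / d; pose y := (f 0 j - Bform i j * f 0 i) / d.
pose g := f - (x *: brow i + y *: brow j).
have gi : g 0 i = 0.
  by rewrite !mxE Bform_refl (Bform_sym _ mm_sym j i) /x /y /d; field.
have gj : g 0 j = 0.
  by rewrite !mxE Bform_refl /x /y /d; field.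
have gfix e : g *m (Mref i * Mref j) ^+ e = g.
  elim: e => [|e IHe]; first by rewrite expr0 mulmx1.
  rewrite exprSr -mulmxE mulmxA IHe mulmxA.
  have -> : g *m Mref i = g by rewrite row_Mref gi mulr0 scale0r subr0.
  by rewrite row_Mref gj mulr0 scale0r subr0.
have -> : f = g + (x *: brow i + y *: brow j) by rewrite subrK.
by clearbody g; rewrite !mulmxDl gfix -!scalemxAl b_i b_j.
Qed.

End Braid.

(** * Presented groups and the triangle group *)

Local Close Scope ring_scope.
Local Open Scope classical_set_scope.
Local Open Scope group_scope.

Section Morphisms.
Variables (G H : groupType) (f : G -> H).
Hypothesis fM : {morph f : x y / x * y}.

Lemma morph_1 : f 1 = 1.
Proof. by apply: (@mulgI _ (f 1)); rewrite -fM !mulg1. Qed.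

Lemma morph_V : {morph f : x / x^-1}.
Proof. by move=> x; symmetry; apply: mulg1_eq; rewrite -fM mulgV morph_1. Qed.

Lemma morph_X n : {morph f : x / x ^+ n}.
Proof.
by move=> x; elim: n => [|n IHn]; [exact: morph_1 | rewrite !expgS fM IHn].
Qed.

Lemma morph_J : {morph f : x y / x ^ y}.
Proof. by move=> x y; rewrite !conjgE !fM morph_V. Qed.
End Morphisms.

Section UniversalProperty.
Variables (X : choiceType) (rels : set (word (X:=X) * word (X:=X))).
Local Notation P := (presented rels).

Definition pres_gen (x : X) : P := pres_class rels [:: (x, true)].

Section Lift.
Variables (G : groupType) (h : X -> G).

Definition word_val (w : word) : G :=
  foldr (fun a g => (if a.2 then h a.1 else (h a.1)^-1) * g) 1 w.

Lemma word_val_cat v w : word_val (v ++ w) = word_val v * word_val w.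
Proof. by elim: v => [|a v IHv] /=; rewrite ?mul1g // IHv mulgA. Qed.

Lemma word_val_nseq n x : word_val (nseq n (x, true)) = h x ^+ n.
Proof. by elim: n => [|n IHn] //=; rewrite IHn expgS. Qed.

Hypothesis relsP : forall v w, rels (v, w) -> word_val v = word_val w.

Lemma word_eq_val v w : word_eq rels v w -> word_val v = word_val w.
Proof.
elim=> // [u v' w' _ -> _ -> //|v' v'' w' w'' _ E1 _ E2|[x []]] /=.
- by rewrite !word_val_cat E1 E2.
- by rewrite mulg1 mulgV.
- by rewrite mulg1 mulVg.
Qed.

Definition pres_lift (x : P) : G := word_val (repr x).

Lemma pres_lift_class w : pres_lift (pres_class rels w) = word_val w.
Proof. exact/word_eq_val/repr_word_eq. Qed.

Lemma pres_liftM : {morph pres_lift : x y / x * y}.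
Proof.
move=> x y; rewrite -[in LHS](pres_classK x) -[in LHS](pres_classK y).
by rewrite [_ * _]pres_mulE pres_lift_class word_val_cat.
Qed.

Lemma pres_lift_gen x : pres_lift (pres_gen x) = h x.
Proof. by rewrite pres_lift_class /= mulg1. Qed.
End Lift.

Lemma pres_class_cat v w :
  pres_class rels (v ++ w) = pres_class rels v * pres_class rels w.
Proof. by rewrite [RHS]pres_mulE. Qed.

Lemma pres_class_val w : pres_class rels w = word_val pres_gen w.
Proof.
elim: w => [//|[x b] w IHw]; rewrite -cat1s pres_class_cat IHw /=.
congr (_ * _); case: b => //.
by rewrite [RHS]pres_invE.
Qed.

Lemma pres_ind (Q : P -> Prop) :
  Q 1 -> (forall x g, Q g -> Q (pres_gen x * g)) ->
  (forall x g, Q g -> Q ((pres_gen x)^-1 * g)) -> forall g, Q g.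
Proof.
move=> Q1 QM QV g; rewrite -[g]pres_classK pres_class_val.
by elim: (repr g) => [|[x []] w IHw] //=; [exact: QM | exact: QV].
Qed.

Lemma eq_pres_morph (G : groupType) (f1 f2 : P -> G) :
  {morph f1 : x y / x * y} -> {morph f2 : x y / x * y} ->
  (forall x, f1 (pres_gen x) = f2 (pres_gen x)) -> f1 =1 f2.
Proof.
move=> f1M f2M E; apply: pres_ind => [|x g IHg|x g IHg].
- by rewrite !morph_1.
- by rewrite f1M f2M E IHg.
- by rewrite f1M f2M !morph_V // E IHg.
Qed.

Lemma pres_rel v w : rels (v, w) -> pres_class rels v = pres_class rels w.
Proof. by move=> vw; apply/pres_classP/word_eq_rel. Qed.

End UniversalProperty.

Definition central (G : groupType) (c : G) := forall g, commute c g.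

Lemma central1 (G : groupType) : central (1 : G).
Proof. by move=> g; rewrite /commute mul1g mulg1. Qed.

Lemma centralM (G : groupType) (c d : G) : central c -> central d -> central (c * d).
Proof.
by move=> cc cd g; apply/commute_sym/commuteM; apply/commute_sym; [exact: cc | exact: cd].
Qed.

Lemma centralV (G : groupType) (c : G) : central c -> central c^-1.
Proof. by move=> cc g; apply/commute_sym/commuteV/commute_sym/cc. Qed.

(** * The map from J to the triangle group, and the flip extension *)

Section JT.
Variables k n m : nat.

Definition ord_gen (i : 'I_3) : nat := nth 0 [:: k; n; m] i.

Definition Trels : set (word * word) :=
  Jrels k n m `|` [set ([:: Jletter 0; Jletter 1; Jletter 2], [::])].
Definition T : groupType := presented Trels.

Definition Jgen (i : 'I_3) : J k n m := pres_gen (Jrels k n m) i.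
Definition Tgen (i : 'I_3) : T := pres_gen Trels i.

Lemma ord3P (Q : 'I_3 -> Prop) : Q i0 -> Q i1 -> Q i2 -> forall i, Q i.
Proof.
by move=> Q0 Q1 Q2 i; rewrite -(inord_val i); case: i => [[|[|[|]]]].
Qed.

Lemma ord_gen0 : ord_gen i0 = k. Proof. by rewrite /ord_gen inordK. Qed.
Lemma ord_gen1 : ord_gen i1 = n. Proof. by rewrite /ord_gen inordK. Qed.
Lemma ord_gen2 : ord_gen i2 = m. Proof. by rewrite /ord_gen inordK. Qed.

Section JLift.
Variables (G : groupType) (y : 'I_3 -> G).
Hypothesis yX : forall i, y i ^+ ord_gen i = 1.
Hypothesis y01 : y i0 * (y i1 * y i2) = y i1 * (y i2 * y i0).
Hypothesis y12 : y i1 * (y i2 * y i0) = y i2 * (y i0 * y i1).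

Lemma Jrels_val v w : Jrels k n m (v, w) -> word_val y v = word_val y w.
Proof.
rewrite /Jrels /=.
case=> [[[[[-> ->]|[-> ->]]|[-> ->]]|[-> ->]]|[-> ->]];
  rewrite ?word_val_nseq /= ?mulg1.
- by rewrite -[k]ord_gen0 yX.
- by rewrite -[n]ord_gen1 yX.
- by rewrite -[m]ord_gen2 yX.
- exact: y01.
- exact: y12.
Qed.

Definition J_lift : J k n m -> G := pres_lift y.

Lemma J_liftM : {morph J_lift : x z / x * z}.
Proof. exact/pres_liftM/Jrels_val. Qed.

Lemma J_lift_gen i : J_lift (Jgen i) = y i.
Proof. exact/pres_lift_gen/Jrels_val. Qed.
End JLift.

Section TLift.
Variables (G : groupType) (y : 'I_3 -> G).
Hypothesis yX : forall i, y i ^+ ord_gen i = 1.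
Hypothesis y012 : y i0 * y i1 * y i2 = 1.

Lemma Trels_val v w : Trels (v, w) -> word_val y v = word_val y w.
Proof.
have E1 : y i0 * (y i1 * y i2) = 1 by rewrite mulgA.
have E2 : y i1 * (y i2 * y i0) = 1.
  by rewrite mulgA -(mulg1_eq E1) mulVg.
have E3 : y i2 * (y i0 * y i1) = 1.
  by apply: (@mulIg _ (y i2)); rewrite -mulgA y012 mulg1 mul1g.
case=> [|/= [-> ->]]; last by rewrite /= mulg1.
by apply: Jrels_val; rewrite ?E1 ?E2.
Qed.

Definition T_lift : T -> G := pres_lift y.

Lemma T_liftM : {morph T_lift : x z / x * z}.
Proof. exact/pres_liftM/Trels_val. Qed.

Lemma T_lift_gen i : T_lift (Tgen i) = y i.
Proof. exact/pres_lift_gen/Trels_val. Qed.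
End TLift.

Lemma JgenX i : Jgen i ^+ ord_gen i = 1.
Proof.
have E : Jgen i ^+ ord_gen i = pres_class (Jrels k n m) (nseq (ord_gen i) (i, true)).
  by rewrite pres_class_val word_val_nseq.
rewrite E; apply: (@pres_rel _ (Jrels k n m) _ [::]); rewrite /Jrels /=.
move: i {E}; apply: ord3P; rewrite ?ord_gen0 ?ord_gen1 ?ord_gen2.
- by do 4 left.
- by do 3 left; right.
- by do 2 left; right.
Qed.

Lemma Jgen_comm1 : Jgen i0 * (Jgen i1 * Jgen i2) = Jgen i1 * (Jgen i2 * Jgen i0).
Proof.
have E a b c : Jgen a * (Jgen b * Jgen c) =
    pres_class (Jrels k n m) [:: (a, true); (b, true); (c, true)].
  by rewrite pres_class_val /= mulg1.
by rewrite !E; apply: pres_rel; rewrite /Jrels /=; left; right.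
Qed.

Lemma Jgen_comm2 : Jgen i1 * (Jgen i2 * Jgen i0) = Jgen i2 * (Jgen i0 * Jgen i1).
Proof.
have E a b c : Jgen a * (Jgen b * Jgen c) =
    pres_class (Jrels k n m) [:: (a, true); (b, true); (c, true)].
  by rewrite pres_class_val /= mulg1.
by rewrite !E; apply: pres_rel; rewrite /Jrels /=; right.
Qed.

Lemma TgenX i : Tgen i ^+ ord_gen i = 1.
Proof.
have E : Tgen i ^+ ord_gen i = pres_class Trels (nseq (ord_gen i) (i, true)).
  by rewrite pres_class_val word_val_nseq.
rewrite E; apply: (@pres_rel _ Trels _ [::]); left; rewrite /Jrels /=.
move: i {E}; apply: ord3P; rewrite ?ord_gen0 ?ord_gen1 ?ord_gen2.
- by do 4 left.
- by do 3 left; right.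
- by do 2 left; right.
Qed.

Lemma Tgen_prod : Tgen i0 * Tgen i1 * Tgen i2 = 1.
Proof.
have -> : Tgen i0 * Tgen i1 * Tgen i2 =
    pres_class Trels [:: (i0, true); (i1, true); (i2, true)].
  by rewrite pres_class_val /= mulg1 mulgA.
by apply: (@pres_rel _ Trels _ [::]); right.
Qed.

Definition JT : J k n m -> T := J_lift Tgen.

Lemma Tgen_comm1 : Tgen i0 * (Tgen i1 * Tgen i2) = Tgen i1 * (Tgen i2 * Tgen i0).
Proof.
by apply: (@mulIg _ (Tgen i0)^-1); rewrite !mulgA mulgK Tgen_prod mul1g;
  apply: mulg1_eq; rewrite mulgA Tgen_prod.
Qed.

Lemma Tgen_comm2 : Tgen i1 * (Tgen i2 * Tgen i0) = Tgen i2 * (Tgen i0 * Tgen i1).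
Proof.
rewrite -Tgen_comm1 mulgA Tgen_prod; apply: (@mulIg _ (Tgen i2)).
by rewrite -[RHS]mulgA Tgen_prod mulg1 mul1g.
Qed.

Lemma JTM : {morph JT : x z / x * z}.
Proof. exact: J_liftM TgenX Tgen_comm1 Tgen_comm2. Qed.

Lemma JT_gen i : JT (Jgen i) = Tgen i.
Proof. exact: J_lift_gen TgenX Tgen_comm1 Tgen_comm2 i. Qed.

Lemma JT_class w : JT (pres_class (Jrels k n m) w) = pres_class Trels w.
Proof.
by rewrite /JT /J_lift pres_lift_class ?pres_class_val //;
  apply: Jrels_val TgenX Tgen_comm1 Tgen_comm2.
Qed.

Lemma JT_surj x : exists g, JT g = x.
Proof. by exists (pres_class _ (repr x)); rewrite JT_class pres_classK. Qed.

Lemma central_gens (c : J k n m) : (forall i, commute c (Jgen i)) -> central c.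
Proof.
move=> cc; apply: pres_ind => [|i g IHg|i g IHg]; first exact: commute1.
  exact: commuteM (cc i) IHg.
by apply: commuteM IHg; apply/commuteV/cc.
Qed.

Definition Jz : J k n m := Jgen i0 * (Jgen i1 * Jgen i2).

Lemma central_Jz : central Jz.
Proof.
have z1 : Jz = Jgen i1 * (Jgen i2 * Jgen i0) by exact: Jgen_comm1.
have z2 : Jz = Jgen i2 * (Jgen i0 * Jgen i1) by rewrite z1 Jgen_comm2.
apply: central_gens; apply: ord3P; rewrite /commute.
- by rewrite [in RHS]z1 /Jz !mulgA.
- by rewrite [in RHS]z2 z1 !mulgA.
- by rewrite [in LHS]z2 /Jz !mulgA.
Qed.

(** Along a derivation in T, each use of the additional relation [stu = 1] costs a factor [Jz], so
    words equal in T differ in J by a central element. *)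
Lemma JT_ker g : JT g = 1 -> central g.
Proof.
have H v w : word_eq Trels v w -> exists2 c, central c &
    pres_class (Jrels k n m) v = pres_class (Jrels k n m) w * c.
  elim=> {v w} [w|v w _ [c cc E]|u v w _ [c cc E] _ [d dc E']
    |v v' w w' _ [c cc E] _ [d dc E']|a|v w [vw|/= [-> ->]]].
  - by exists 1; rewrite ?mulg1 //; exact: central1.
  - by exists c^-1; [exact: centralV | rewrite E mulgK].
  - by exists (d * c); [exact: centralM | rewrite E E' mulgA].
  - exists (c * d); first exact: centralM.
    by rewrite !pres_class_cat E E' -!mulgA (mulgA c) (cc (pres_class _ w')) -!mulgA.
  - exists 1; first exact: central1.
    by rewrite mulg1; apply/pres_classP/word_eq_cancel.
  - exists 1; first exact: central1.
    by rewrite mulg1; exact: pres_rel.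
  - exists Jz; first exact: central_Jz.
    by rewrite !pres_class_val /= !mulg1 mul1g.
rewrite -[g]pres_classK JT_class => /pres_classP/H[c cc ->].
by rewrite [pres_class _ [::]](_ : _ = 1) // mul1g.
Qed.

Definition Tflip_gen (i : 'I_3) : T :=
  if i == i0 then Tgen i2 * Tgen i1 else (Tgen i)^-1.

Lemma Tflip_gen0 : Tflip_gen i0 = Tgen i2 * Tgen i1.
Proof. by rewrite /Tflip_gen eqxx. Qed.
Lemma Tflip_gen1 : Tflip_gen i1 = (Tgen i1)^-1.
Proof. by rewrite /Tflip_gen -val_eqE /= !inordK. Qed.
Lemma Tflip_gen2 : Tflip_gen i2 = (Tgen i2)^-1.
Proof. by rewrite /Tflip_gen -val_eqE /= !inordK. Qed.

Lemma Tgen12 : Tgen i1 * Tgen i2 = (Tgen i0)^-1.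
Proof. by symmetry; apply: mulg1_eq; rewrite mulgA Tgen_prod. Qed.

Lemma Tflip_genX i : Tflip_gen i ^+ ord_gen i = 1.
Proof.
move: i; apply: ord3P; rewrite ?Tflip_gen0 ?Tflip_gen1 ?Tflip_gen2.
- have -> : Tgen i2 * Tgen i1 = (Tgen i0)^-1 ^ (Tgen i2)^-1.
    by rewrite -Tgen12 conjgE invgK -!mulgA mulgV mulg1.
  by rewrite -conjXg expVgn TgenX invg1 conj1g.
- by rewrite expVgn TgenX invg1.
- by rewrite expVgn TgenX invg1.
Qed.

Lemma Tflip_gen_prod : Tflip_gen i0 * Tflip_gen i1 * Tflip_gen i2 = 1.
Proof. by rewrite Tflip_gen0 Tflip_gen1 Tflip_gen2 mulgK mulgV. Qed.

(** The effect of the reflection [a i0]: it inverts [t] and [u], the rotations about the two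
    vertices on its mirror, so [s = (tu)^-1] must become [ut]. *)
Definition Tflip : T -> T := T_lift Tflip_gen.

Lemma TflipM : {morph Tflip : x y / x * y}.
Proof. exact: T_liftM Tflip_genX Tflip_gen_prod. Qed.

Lemma Tflip_on_gen i : Tflip (Tgen i) = Tflip_gen i.
Proof. exact: T_lift_gen Tflip_genX Tflip_gen_prod i. Qed.

Lemma TflipK : involutive Tflip.
Proof.
apply: (@eq_pres_morph _ _ _ (Tflip \o Tflip) id) => // [x y /=|].
  by rewrite !TflipM.
apply: ord3P; rewrite /= -/(Tgen _) Tflip_on_gen
  ?Tflip_gen0 ?Tflip_gen1 ?Tflip_gen2 ?TflipM ?(morph_V TflipM) !Tflip_on_gen
  ?Tflip_gen1 ?Tflip_gen2 ?invgK //.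
by rewrite -invgM Tgen12 invgK.
Qed.

(* The extension of the triangle group by the flip [s, t, u |-> ut, t^-1, u^-1];
   it is the Coxeter group of the triangle. *)
Definition coxeter : Type := (T * bool)%type.
HB.instance Definition _ := Choice.on coxeter.

Definition flip_if (b : bool) (x : T) := if b then Tflip x else x.

Lemma flip_ifM b : {morph flip_if b : x y / x * y}.
Proof. by case: b => // x y; apply: TflipM. Qed.

Lemma flip_if_add b c x : flip_if b (flip_if c x) = flip_if (b (+) c) x.
Proof. by case: b; case: c => //=; rewrite TflipK. Qed.

Definition cox_one : coxeter := (1, false).
Definition cox_mul (x y : coxeter) : coxeter :=
  (x.1 * flip_if x.2 y.1, x.2 (+) y.2).
Definition cox_inv (x : coxeter) : coxeter := (flip_if x.2 x.1^-1, x.2).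

Lemma cox_mulA : associative cox_mul.
Proof.
case=> [x b] [y c] [z d]; congr (_, _) => /=; last by rewrite addbA.
by rewrite flip_ifM flip_if_add mulgA.
Qed.

Lemma cox_mul1 : left_id cox_one cox_mul.
Proof. by case=> [x b]; congr (_, _); rewrite /= mul1g. Qed.

Lemma cox_mulr1 : right_id cox_one cox_mul.
Proof.
case=> [x b]; congr (_, _); rewrite /= ?addbF //.
by rewrite (morph_1 (flip_ifM b)) mulg1.
Qed.

Lemma cox_mulV : left_inverse cox_one cox_inv cox_mul.
Proof.
case=> [x b]; congr (_, _); rewrite /= ?addbb //.
by rewrite -flip_ifM mulVg (morph_1 (flip_ifM b)).
Qed.

Lemma cox_mulrV : right_inverse cox_one cox_inv cox_mul.
Proof.
case=> [x b]; congr (_, _); rewrite /= ?addbb //.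
by rewrite flip_if_add addbb mulgV.
Qed.

HB.instance Definition _ := isGroup.Build coxeter
  cox_mulA cox_mul1 cox_mulr1 cox_mulV cox_mulrV.

Definition cox_even (x : T) : coxeter := (x, false).

Lemma cox_evenM : {morph cox_even : x y / x * y}.
Proof. by []. Qed.

(** With [F] the flip, the reflections are [F], [u^-1 F] and [t F]: a choice for which the products
    of consecutive reflections are [s], [t] and [u], as [cox_rot] checks. *)
Definition cox_gen (i : 'I_3) : coxeter :=
  (if i == i0 then 1 else if i == i1 then (Tgen i2)^-1 else Tgen i1, true).

Lemma cox_gen0 : cox_gen i0 = (1, true).
Proof. by rewrite /cox_gen eqxx. Qed.
Lemma cox_gen1 : cox_gen i1 = ((Tgen i2)^-1, true).
Proof. by rewrite /cox_gen -val_eqE /= !inordK // eqxx. Qed.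
Lemma cox_gen2 : cox_gen i2 = (Tgen i1, true).
Proof. by rewrite /cox_gen -!val_eqE /= !inordK. Qed.

Lemma cox_gen_inv i : cox_gen i * cox_gen i = 1.
Proof.
move: i; apply: ord3P; rewrite ?cox_gen0 ?cox_gen1 ?cox_gen2;
  congr (_, _); rewrite /= ?(morph_V TflipM) ?(morph_1 TflipM) ?mul1g //.
- by rewrite Tflip_on_gen Tflip_gen2 invgK mulVg.
- by rewrite Tflip_on_gen Tflip_gen1 mulgV.
Qed.

Lemma cox_rot i : cox_gen (ordS i) * cox_gen (ordS (ordS i)) = cox_even (Tgen i).
Proof.
have S0 : ordS i0 = i1 by apply/val_inj; rewrite /= !inordK.
have S1 : ordS i1 = i2 by apply/val_inj; rewrite /= !inordK.
have S2 : ordS i2 = i0 by apply/val_inj; rewrite /= !inordK.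
move: i; apply: ord3P; rewrite ?(S0, S1, S2) ?cox_gen0 ?cox_gen1 ?cox_gen2;
  congr (_, _) => /=.
- by rewrite Tflip_on_gen Tflip_gen1 -invgM Tgen12 invgK.
- by rewrite (morph_1 TflipM) mulg1.
- by rewrite mul1g (morph_V TflipM) Tflip_on_gen Tflip_gen2 invgK.
Qed.

End JT.

(** * The geometric representation of the triangle's Coxeter group *)

Section TriangleRep.
Variables (k n m : nat).
Hypotheses (k2 : (1 < k)%N) (n2 : (1 < n)%N) (m2 : (1 < m)%N).

Local Notation R := Rdefinitions.R.
Local Notation p := (ord_gen k n m).
Local Notation T := (T k n m).
Local Notation W := (coxeter k n m).
Local Notation Tgen := (Tgen k n m).
Local Notation a := (cox_gen k n m).
Local Notation M := (Mref R (mm p)).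

Lemma ord_gen_ge2 i : (1 < p i)%N.
Proof. by move: i; apply: ord3P; rewrite ?ord_gen0 ?ord_gen1 ?ord_gen2. Qed.

Lemma nx_0 : nx i0 = i1. Proof. by apply/val_inj; rewrite /= !inordK. Qed.
Lemma nx_1 : nx i1 = i2. Proof. by apply/val_inj; rewrite /= !inordK. Qed.
Lemma nx_2 : nx i2 = i0. Proof. by apply/val_inj; rewrite /= !inordK. Qed.

Lemma Mref_unit i : M i \is a GRing.unit.
Proof. by apply/unitrP; exists (M i); rewrite -!mulmxE MrefK. Qed.

Definition refl_unit i : unit_group 'M[R]_3 :=
  exist (fun x => x \is a GRing.unit) (M i) (Mref_unit i).

Lemma refl_unitK i : refl_unit i * refl_unit i = 1.
Proof. by apply/val_inj; rewrite val_ugM val_ug1 -mulmxE /= MrefK. Qed.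

Lemma refl_unitKV i (x : unit_group 'M[R]_3) : refl_unit i * (refl_unit i * x) = x.
Proof. by rewrite mulgA refl_unitK mul1g. Qed.

Lemma refl_unitV i : (refl_unit i)^-1 = refl_unit i.
Proof. exact/mulg1_eq/refl_unitK. Qed.

Definition rot_unit i := refl_unit (nx i) * refl_unit (nx (nx i)).

Lemma rot_unitX i : rot_unit i ^+ p i = 1.
Proof.
have -> : p i = mm p (nx i) (nx (nx i)) by rewrite /mm third_nx.
apply/val_inj; rewrite val_ugX val_ugM /=.
apply: Mref_braid => [i' j'|i' j' _|].
- by rewrite /mm third_sym.
- exact: ord_gen_ge2.
- by rewrite eq_sym nx_neq.
Qed.

Lemma rot_unit_prod : rot_unit i0 * rot_unit i1 * rot_unit i2 = 1.
Proof.
by rewrite /rot_unit !(nx_0, nx_1, nx_2) -!mulgA !refl_unitKV refl_unitK.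
Qed.

Definition rhoT : T -> unit_group 'M[R]_3 := T_lift rot_unit.

Lemma rhoTM : {morph rhoT : x y / x * y}.
Proof. exact: T_liftM rot_unitX rot_unit_prod. Qed.

Lemma rhoT_gen i : rhoT (Tgen i) = rot_unit i.
Proof. exact: T_lift_gen rot_unitX rot_unit_prod i. Qed.

Lemma rhoT_flip x : rhoT (Tflip x) = refl_unit i0 * rhoT x * refl_unit i0.
Proof.
apply: (@eq_pres_morph _ _ _ (rhoT \o @Tflip k n m)
  (fun x => refl_unit i0 * rhoT x * refl_unit i0)) => [y z|y z|] /=.
- by rewrite TflipM rhoTM.
- by rewrite rhoTM -!mulgA refl_unitKV.
apply: ord3P; rewrite -/(Tgen _) Tflip_on_gen ?Tflip_gen0 ?Tflip_gen1 ?Tflip_gen2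
  ?rhoTM ?(morph_V rhoTM) !rhoT_gen /rot_unit !(nx_0, nx_1, nx_2)
  ?invgM ?refl_unitV -!mulgA ?refl_unitKV ?refl_unitK ?mulg1 //.
Qed.

Definition cox_rho (w : W) : 'M[R]_3 :=
  val (rhoT w.1 * (if w.2 then refl_unit i0 else 1)).

Lemma cox_rho1 : cox_rho 1 = (1%:M)%R.
Proof.
rewrite -[RHS]/(val (1 : unit_group 'M[R]_3)) -(morph_1 rhoTM).
by rewrite -[in RHS](mulg1 (rhoT 1)).
Qed.

Lemma cox_rhoM x y : cox_rho (x * y) = (cox_rho x *m cox_rho y)%R.
Proof.
rewrite /cox_rho mulmxE -val_ugM; congr val; case: x y => [x []] [y c] /=.
  by case: c; rewrite rhoTM rhoT_flip -!mulgA /= ?mulg1 ?refl_unitK ?mulg1.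
by rewrite rhoTM mulg1 mulgA.
Qed.

Lemma cox_rho_gen i : cox_rho (a i) = M i.
Proof.
rewrite -[RHS]/(val (refl_unit i)); congr val.
move: i; apply: ord3P; rewrite ?cox_gen0 ?cox_gen1 ?cox_gen2.
- by rewrite [rhoT _](morph_1 rhoTM) mul1g.
- rewrite [rhoT _](morph_V rhoTM) rhoT_gen /rot_unit !(nx_0, nx_1, nx_2) invgM !refl_unitV.
  by rewrite -mulgA refl_unitK mulg1.
- rewrite [rhoT _]rhoT_gen /rot_unit !(nx_0, nx_1, nx_2).
  by rewrite -mulgA refl_unitK mulg1.
Qed.

Lemma cox_par_gen i : (a i).2 = true. Proof. by []. Qed.
Lemma cox_parM (x y : W) : (x * y).2 = x.2 (+) y.2. Proof. by []. Qed.

Lemma cox_ev_gen (w : W) : exists s, ev a s = w.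
Proof.
have H (g : T) : exists s, ev a s = cox_even g.
  move: g; apply: pres_ind => [|i g [s Es]|i g [s Es]].
  - by exists [::].
  - exists [:: nx i, nx (nx i) & s]; rewrite /= Es mulgA cox_rot.
    by rewrite -cox_evenM.
  - exists [:: nx (nx i), nx i & s]; rewrite /= Es mulgA.
    rewrite cox_evenM (morph_V (@cox_evenM k n m)) -[pres_gen _ i]/(Tgen i) -cox_rot.
    by rewrite invgM !(mulg1_eq (cox_gen_inv _ _ _ _)).
case: w => [g []]; last exact: H.
have [s Es] := H g; exists (s ++ [:: i0]).
rewrite ev_cat Es /= mulg1 cox_gen0; congr (_, _).
by rewrite /= mulg1.
Qed.

Lemma cox_braid i j : i != j -> (a i * a j) ^+ mm p i j = 1.
Proof.
have rotX l : (a (nx l) * a (nx (nx l))) ^+ p l = 1.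
  by rewrite cox_rot -(morph_X (@cox_evenM k n m)) TgenX.
case: (nx_cases i j) => -> ij; first by rewrite eqxx in ij.
  have := rotX (nx (nx i)); rewrite nx3 => E.
  by have := third_nx (nx (nx i)); rewrite /mm !nx3 => ->.
have -> : a i * a (nx (nx i)) = (a (nx (nx i)) * a i)^-1.
  by rewrite invgM !(mulg1_eq (cox_gen_inv _ _ _ _)).
have := rotX (nx i); rewrite nx3 expVgn => E.
by have := third_nx (nx i); rewrite /mm third_sym nx3 => ->; rewrite E invg1.
Qed.

End TriangleRep.

(** * Torsion, roots and centre of the triangle group *)

Section Triangle.
Variables (k n m : nat).
Hypotheses (k2 : (1 < k)%N) (n2 : (1 < n)%N) (m2 : (1 < m)%N).
Local Notation p := (ord_gen k n m).
Local Notation T := (T k n m).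
Local Notation Tgen := (Tgen k n m).
Local Notation a := (cox_gen k n m).

Let p2 := ord_gen_ge2 k2 n2 m2.
Let a_inv := @cox_gen_inv k n m.
Let rho1 := cox_rho1 k2 n2 m2.
Let rhoM := cox_rhoM k2 n2 m2.
Let rho_gen := cox_rho_gen k2 n2 m2.
Let a_braid := @cox_braid k n m.
Let ev_gen := @cox_ev_gen k n m.
Let par_gen := @cox_par_gen k n m.
Let par_M := @cox_parM k n m.

Lemma rotE i : rotation a i = cox_even (Tgen i).
Proof. exact: cox_rot. Qed.

Lemma rotXE i e : rotation a i ^+ e = cox_even (Tgen i ^+ e).
Proof. by rewrite rotE -(morph_X (@cox_evenM k n m)). Qed.

Lemma cox_even_inj : injective (@cox_even k n m).
Proof. by move=> x y []. Qed.

Lemma par_evenP (w : coxeter k n m) : w.2 = false -> w = cox_even w.1.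
Proof. by case: w => x b /= ->. Qed.

Lemma Tgen_order i e : (Tgen i ^+ e == 1) = (p i %| e)%N.
Proof.
have := rot_order p2 rho1 rhoM rho_gen a_braid i e.
by rewrite rotXE -(inj_eq cox_even_inj).
Qed.

Lemma T_torsion g N : (0 < N)%N -> g ^+ N = 1 ->
  exists i e h, g = (Tgen i ^+ e) ^ h.
Proof.
move=> N0 gN; have gN' : cox_even g ^+ N = 1.
  by rewrite -(morph_X (@cox_evenM k n m)) gN.
have [i [e [h [/par_evenP hE gE]]]] :=
  torsion_conj p2 a_inv par_gen par_M ev_gen rho1 rhoM rho_gen a_braid N0 gN' erefl.
exists i, e, h.1; apply: cox_even_inj.
by rewrite gE rotXE hE -(morph_J (@cox_evenM k n m)).
Qed.

Lemma Tgen_conj_order i j e h : Tgen i = (Tgen j ^+ e) ^ h -> p i = p j.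
Proof.
move=> E; apply: (@conj_rot_order _ p p2 _ a snd _ a_inv par_gen par_M ev_gen rho1
  rhoM rho_gen a_braid i j e (cox_even h)).
by rewrite rotE rotXE -(morph_J (@cox_evenM k n m)) E.
Qed.

Lemma T_root y N l i e h : (0 < N)%N -> y ^+ N = 1 ->
  y ^+ l = (Tgen i ^+ e) ^ h -> Tgen i ^+ e != 1 ->
  exists l', y = (Tgen i ^+ l') ^ h.
Proof.
move=> N0 yN yl e1.
have [|||l' E] := @root_of_rot _ p p2 _ a snd _ a_inv par_gen par_M ev_gen rho1
  rhoM rho_gen a_braid (cox_even y) N l i e (cox_even h) N0 _ erefl.
- by rewrite -(morph_X (@cox_evenM k n m)) yN.
- by rewrite rotXE -(morph_J (@cox_evenM k n m)) -yl (morph_X (@cox_evenM k n m)).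
- by rewrite rotXE (inj_eq cox_even_inj).
exists l'; apply: cox_even_inj.
by rewrite E rotXE (morph_J (@cox_evenM k n m)).
Qed.

Lemma T_center g : (forall i, commute g (Tgen i)) ->
  g = 1 \/ exists l e, g = Tgen l ^+ e /\ forall i, i != l -> p i = 2.
Proof.
move=> cg; have := @rot_centralizer _ p p2 _ a snd _ a_inv par_gen par_M ev_gen rho1
  rhoM rho_gen a_braid (cox_even g) erefl.
case=> [i|/cox_even_inj|[l [e [E H]]]].
- by rewrite rotE /commute -!cox_evenM cg.
- by left.
- by right; exists l, e; split=> //; apply: cox_even_inj; rewrite E rotXE.
Qed.

End Triangle.

(** * A monomial representation of J when two orders are 2 *)

Section Monomial.
Variable r : nat.
Hypothesis r2 : (1 < r)%N.
Local Notation Z := 'Z_(r.*2).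
Local Open Scope ring_scope.

(** The pair [(x, b)] stands for [zeta^x e_b] with [zeta] of order [2 r]. Then [s] and [t] are
    antidiagonal, [u] is diagonal with entries 1 and [zeta^-2], and their product is the scalar
    [zeta^-1]; this square root is why the modulus is [2 r]. *)
Definition mono_s (x : Z * bool) : Z * bool := (x.1, ~~ x.2).
Definition mono_t (x : Z * bool) : Z * bool :=
  (if x.2 then x.1 - 1 else x.1 + 1, ~~ x.2).
Definition mono_u (x : Z * bool) : Z * bool := (if x.2 then x.1 - 2 else x.1, x.2).
Definition mono_uV (x : Z * bool) : Z * bool := (if x.2 then x.1 + 2 else x.1, x.2).

Lemma mono_sK : involutive mono_s.
Proof. by case=> x []. Qed.
Lemma mono_tK : involutive mono_t.
Proof. by case=> x []; rewrite /mono_t /= ?subrK ?addrK. Qed.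
Lemma mono_uK : cancel mono_u mono_uV.
Proof. by case=> x []; rewrite /mono_u /mono_uV /= ?subrK. Qed.

Definition perm_s := perm (can_inj mono_sK).
Definition perm_t := perm (can_inj mono_tK).
Definition perm_u := perm (can_inj mono_uK).

Lemma perm_s2 : (perm_s ^+ 2 = 1)%g.
Proof. by apply/perm.permP => x; rewrite expg2 permM !permE mono_sK. Qed.
Lemma perm_t2 : (perm_t ^+ 2 = 1)%g.
Proof. by apply/perm.permP => x; rewrite expg2 permM !permE mono_tK. Qed.

Lemma perm_uX e (x : Z) : (perm_u ^+ e)%g (x, true) = (x - (e.*2)%:R, true).
Proof.
elim: e x => [|e IHe] x; first by rewrite perm1 subr0.
rewrite expgS permM permE /mono_u /= IHe; congr (_, _).
by rewrite -addrA -opprD -[e.+1.*2]/(2 + e.*2)%N natrD.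
Qed.

Lemma perm_uX0 e (x : Z) : (perm_u ^+ e)%g (x, false) = (x, false).
Proof.
by elim: e => [|e IHe]; [rewrite perm1 | rewrite expgS permM permE /mono_u /= IHe].
Qed.

Lemma natrZ_eq0 e : ((e%:R : Z) == 0) = (r.*2 %| e)%N.
Proof.
by rewrite -val_eqE /= val_Zp_nat // (leq_trans r2) // -addnn leq_addl.
Qed.

Lemma perm_ur : (perm_u ^+ r = 1)%g.
Proof.
apply/perm.permP => [[x []]]; rewrite ?perm_uX0 perm1 // perm_uX.
have /eqP -> : ((r.*2)%:R : Z) == 0 by rewrite natrZ_eq0.
by rewrite subr0.
Qed.

Lemma perm_ust : (perm_u * (perm_s * perm_t) = perm_s * (perm_t * perm_u))%g.
Proof.
apply/perm.permP => [[x []]]; rewrite !permM !permE /mono_u /mono_s /mono_t /= //.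
by congr (_, _); rewrite addrAC.
Qed.

Lemma perm_stu : (perm_s * (perm_t * perm_u) = perm_t * (perm_u * perm_s))%g.
Proof.
have E (x : Z) : x + 1 - 2 = x - 1.
  by rewrite -addrA -opprB; congr (_ - _); rewrite -[2]/(1 + 1)%:R natrD addrK.
by apply/perm.permP => [[x []]]; rewrite !permM !permE /mono_u /mono_s /mono_t /= ?E.
Qed.

End Monomial.

Section Center.
Variables (k n m : nat).
Hypotheses (k2 : (1 < k)%N) (n2 : (1 < n)%N) (m2 : (1 < m)%N).
Local Notation p := (ord_gen k n m).

(* If all generators but [x_l] have order 2 then [x_l] acts in a monomial
   representation as diag(1, zeta), which commutes with the antidiagonal
   generators only when it is trivial. *)
Lemma Jgen_centralX l e : (forall i, i != l -> p i = 2) ->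
  central (Jgen k n m l ^+ e) -> (p l %| e)%N.
Proof.
move=> p2 ce; have r2 := ord_gen_ge2 k2 n2 m2 l; set r := p l in r2 *.
pose y i := if i == l then perm_u r else if i == nx l then perm_s r else perm_t r.
have yl : y l = perm_u r by rewrite /y eqxx.
have ys : y (nx l) = perm_s r by rewrite /y (negPf (nx_neq l)) eqxx.
have yt : y (nx (nx l)) = perm_t r.
  by rewrite /y (negPf (nx2_neq l)) (negPf (nx_neq (nx l))).
have yX i : y i ^+ p i = 1.
  case: (nx_cases l i) => ->.
  - by rewrite yl perm_ur.
  - by rewrite ys p2 ?nx_neq // perm_s2.
  - by rewrite yt p2 ?nx2_neq // perm_t2.
have E1 := perm_ust r; have E2 := perm_stu r.
rewrite -{1 2}yl -{1 2}ys -{1 2}yt in E1; rewrite -{1 2}yl -{1 2}ys -{1 2}yt in E2.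
have [y01 y12] : y i0 * (y i1 * y i2) = y i1 * (y i2 * y i0) /\
    y i1 * (y i2 * y i0) = y i2 * (y i0 * y i1).
  have lE : [\/ l = i0, l = i1 | l = i2].
    by move: (l); apply: ord3P; [exact: Or31 | exact: Or32 | exact: Or33].
  by case: lE E1 E2 => ->; rewrite !(nx_0, nx_1, nx_2) => -> ->.
have := ce (Jgen k n m (nx l)); rewrite /commute.
move=> /(congr1 (J_lift y)); have fM := J_liftM yX y01 y12.
have fg := J_lift_gen yX y01 y12.
rewrite !fM !(morph_X fM) !fg yl ys => /perm.permP/(_ (0%R, false)).
rewrite !permM perm_uX0 !permE /mono_s /= perm_uX => /(congr1 fst) /= /eqP.
rewrite eq_sym sub0r oppr_eq0 natrZ_eq0 //.
by rewrite -!muln2 dvdn_pmul2r.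
Qed.

(** A central [g] might map to a nontrivial central element of T. That image is a power of some
    [x_l]; the same power of [x_l] in J differs from [g] by a central factor, so it is central too,
    and [Jgen_centralX] makes it trivial. *)
Lemma JT_kerP g : JT g = 1 <-> central (g : J k n m).
Proof.
split=> [|cg]; first exact: JT_ker.
have cTg i : commute (JT g) (Tgen k n m i).
  by rewrite /commute -JT_gen -!JTM cg.
have [//|[l [e [gE p2]]]] := T_center k2 n2 m2 cTg.
rewrite gE; apply/eqP; rewrite Tgen_order //; apply: Jgen_centralX p2 _.
have : central (Jgen k n m l ^+ e / g).
  by apply: JT_ker; rewrite JTM (morph_X (@JTM k n m)) JT_gen (morph_V (@JTM k n m)) gE mulgV.
by move=> /centralM/(_ cg); rewrite mulgVK.
Qed.

End Center.

(** * Normal closures and reflections *)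

Section NormalClosure.
Variables (G : groupType) (A : set G).
Local Notation N := (normal_closure A).

Lemma normal_closure_gen x : A x -> N x.
Proof. by move=> Ax S [_ AS]; exact: AS. Qed.

Lemma normal_closure_subgroup : normal_subgroup N.
Proof.
split=> [S [[S1 _ _] _]|x y Nx Ny S SA|x g Nx S SA] //.
  by have [[_ SF _] _] := SA; apply: SF; [exact: Nx | exact: Ny].
by have [[_ _ SJ] _] := SA; apply: SJ; exact: Nx.
Qed.

Lemma normal_closure1 : N 1. Proof. by have [] := normal_closure_subgroup. Qed.
Lemma normal_closureJ x g : N x -> N (x ^ g).
Proof. by have [_ _ H] := normal_closure_subgroup; exact: H. Qed.
Lemma normal_closureV x : N x -> N x^-1.
Proof.
have [N1 NF _] := normal_closure_subgroup.
by move=> Nx; rewrite -[_^-1]mul1g; exact: NF.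
Qed.
Lemma normal_closureM x y : N x -> N y -> N (x * y).
Proof.
have [_ NF _] := normal_closure_subgroup.
by move=> Nx Ny; rewrite -[y]invgK; apply: NF => //; apply: normal_closureV.
Qed.
Lemma normal_closureX x n : N x -> N (x ^+ n).
Proof.
move=> Nx; elim: n => [|n IHn]; first exact: normal_closure1.
by rewrite expgS; exact: normal_closureM.
Qed.
Lemma normal_closure_min (S : set G) : normal_subgroup S -> A `<=` S -> N `<=` S.
Proof. by move=> nS AS x /(_ S (conj nS AS)). Qed.
End NormalClosure.

Lemma Zp1_expg_eq1 r e : (1 < r)%N -> ((Zp1 : 'Z_r) ^+ e == 1) = (r %| e)%N.
Proof. by move=> r2; rewrite -order_dvdn order_Zp1 Zp_cast. Qed.

Section Side.
Variables (k b n c m : nat).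
Local Notation p := (ord_gen k (b * n) (c * m)).
Local Notation J := (J k (b * n) (c * m)).
Local Notation x_ := (Jgen k (b * n) (c * m)).
Local Notation z := (Jz k (b * n) (c * m)).
Local Notation W := (W k b n c m).

(** The columns of the theorem are the pairs [(p i, q i)]. *)
Definition refl_exp (i : 'I_3) : nat := nth 0 [:: 1%N; n; m] i.
Local Notation q := refl_exp.

Lemma refl_exp0 : q i0 = 1%N. Proof. by rewrite /q inordK. Qed.
Lemma refl_exp1 : q i1 = n. Proof. by rewrite /q inordK. Qed.
Lemma refl_exp2 : q i2 = m. Proof. by rewrite /q inordK. Qed.

Definition refl_gen (i : 'I_3) : J := x_ i ^+ q i.

Lemma WgensP x : Wgens k b n c m x <-> exists i, x = refl_gen i.
Proof.
split=> [[[->|->]|->]|[i ->]].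
- by exists i0; rewrite /refl_gen refl_exp0.
- by exists i1; rewrite /refl_gen refl_exp1.
- by exists i2; rewrite /refl_gen refl_exp2.
move: i; apply: ord3P; rewrite /refl_gen ?refl_exp0 ?refl_exp1 ?refl_exp2.
- by left; left.
- by left; right.
- by right.
Qed.

Lemma W_refl_gen i : W (refl_gen i).
Proof. by apply: normal_closure_gen; apply/WgensP; exists i. Qed.

Lemma W_refl_genXV i e : W (refl_gen i ^+ e)^-1.
Proof. by apply: normal_closureV; apply: normal_closureX; exact: W_refl_gen. Qed.

(** Modulo [W] the generator [s] is trivial and [tu] becomes the central [z]. *)
Lemma W_pow_tu j : exists2 w, W w & x_ i1 ^+ j * x_ i2 ^+ j = w * z ^+ j.
Proof.
elim: j => [|j [w Ww IHj]]; first by exists 1; [exact: normal_closure1 | rewrite !mulg1].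
have W0 : W (x_ i0) by have := W_refl_gen i0; rewrite /refl_gen refl_exp0.
have zj g : z ^+ j * g = g * z ^+ j.
  by apply/commute_sym/commuteX/commute_sym/central_Jz.
exists (w ^ (x_ i1)^-1 * (x_ i0)^-1).
  by apply: normal_closureM; [exact: normal_closureJ | exact: normal_closureV].
have -> : x_ i1 ^+ j.+1 * x_ i2 ^+ j.+1 = x_ i1 * (x_ i1 ^+ j * x_ i2 ^+ j) * x_ i2.
  by rewrite expgS expgSr !mulgA.
rewrite IHj conjgE invgK (expgS z).
have -> : z * z ^+ j = x_ i0 * (x_ i1 * x_ i2) * z ^+ j by [].
by rewrite -!mulgA mulKg mulKg zj.
Qed.

Hypothesis n_gt0 : (0 < n)%N.
Hypothesis m_gt0 : (0 < m)%N.
Hypothesis co_nm : coprime n m.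

Lemma crt_exponent (u v : nat) : (0 < u)%N -> (0 < v)%N -> coprime u v ->
  exists e f : nat, (1 + e * u = f * v)%N.
Proof.
(* Adding [u * v] keeps both residues and ensures that [j] is at least 1, so that [j - 1] can be
   formed. *)
move=> u0 v0 co; pose j := (chinese u v 1 0 + u * v)%N.
have ju : j = 1 %[mod u].
  by rewrite /j -modnDmr modnMr addn0 chinese_modl.
have jv : j = 0 %[mod v].
  by rewrite /j -modnDmr modnMl addn0 chinese_modr.
have j1 : (1 <= j)%N by rewrite /j ltn_addl // muln_gt0 u0.
move/eqP: ju; rewrite eqn_mod_dvd // => /dvdnP[e eE].
move/eqP: jv; rewrite mod0n => /dvdnP[f fE].
by exists e, f; rewrite -eE -fE subnKC.
Qed.

(** For [j] congruent to 1 modulo [n] and to 0 modulo [m], modulo [W] the power [t^j] is [t] and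
    [u^j] is trivial, so [W_pow_tu] makes [t] congruent to [z^j]. Exchanging [n] and [m] treats
    [u]. *)
Lemma W_mod_center g : exists h d, [/\ W h, central d & g = h * d].
Proof.
have W1 : W 1 by exact: normal_closure1.
have cz j : central (z ^+ j).
  by move=> g'; apply/commute_sym/commuteX/commute_sym/central_Jz.
have gen i : exists h d, [/\ W h, central d & x_ i = h * d].
  move: i; apply: ord3P.
  - exists (x_ i0), 1; split; [|exact: central1|by rewrite mulg1].
    by have := W_refl_gen i0; rewrite /refl_gen refl_exp0.
  - have [e [f ef]] := crt_exponent n_gt0 m_gt0 co_nm.
    have Et : x_ i1 ^+ (1 + e * n) = x_ i1 * refl_gen i1 ^+ e.
      by rewrite expgnDr expg1 /refl_gen refl_exp1 (mulnC e n) expgnA.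
    have Eu : x_ i2 ^+ (1 + e * n) = refl_gen i2 ^+ f.
      by rewrite ef /refl_gen refl_exp2 (mulnC f m) expgnA.
    have [w Ww] := W_pow_tu (1 + e * n); rewrite Et Eu => E.
    exists (w * (refl_gen i2 ^+ f)^-1 * (refl_gen i1 ^+ e)^-1), (z ^+ (1 + e * n)).
    split=> //.
      apply: normal_closureM; last exact: W_refl_genXV.
      by apply: normal_closureM => //; exact: W_refl_genXV.
    rewrite -!mulgA -cz !mulgA -[w * _ * _]mulgA -[(refl_gen i2 ^+ f)^-1 * _]cz.
    by rewrite mulgA -E !mulgK.
  - have [e [f ef]] := crt_exponent m_gt0 n_gt0 (etrans (coprime_sym _ _) co_nm).
    have Eu : x_ i2 ^+ (1 + e * m) = x_ i2 * refl_gen i2 ^+ e.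
      by rewrite expgnDr expg1 /refl_gen refl_exp2 (mulnC e m) expgnA.
    have Et : x_ i1 ^+ (1 + e * m) = refl_gen i1 ^+ f.
      by rewrite ef /refl_gen refl_exp1 (mulnC f n) expgnA.
    have [w Ww] := W_pow_tu (1 + e * m); rewrite Et Eu => E.
    exists ((refl_gen i1 ^+ f)^-1 * w * (refl_gen i2 ^+ e)^-1), (z ^+ (1 + e * m)).
    split=> //.
      apply: normal_closureM; last exact: W_refl_genXV.
      by apply: normal_closureM => //; exact: W_refl_genXV.
    rewrite -!mulgA -cz !mulgA -[_ * w * _]mulgA -E.
    by rewrite mulKg mulgK.
move: g; apply: pres_ind => [|i g [h [d [Wh cd ->]]]|i g [h [d [Wh cd ->]]]].
- by exists 1, 1; split; rewrite ?mulg1 //; exact: central1.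
- have [h' [d' [Wh' cd' E]]] := gen i.
  exists (h' * h), (d' * d); split; [exact: normal_closureM | exact: centralM |].
  by rewrite [pres_gen _ _]E -!mulgA (mulgA d' h) (cd' h) -!mulgA.
- have [h' [d' [Wh' cd' E]]] := gen i.
  exists (h'^-1 * h), (d'^-1 * d); split.
  + by apply: normal_closureM => //; exact: normal_closureV.
  + by apply: centralM => //; exact: centralV.
  rewrite [pres_gen _ _]E invgM (centralV cd' h'^-1) -!mulgA (mulgA d'^-1 h).
  by rewrite (centralV cd' h) -!mulgA.
Qed.

Hypotheses (k2 : (1 < k)%N) (bn2 : (1 < b * n)%N) (cm2 : (1 < c * m)%N).

Local Notation JT := (@JT k (b * n) (c * m)).

(** This describes the kernel of [JT] on [W] inside [W] alone, so that an isomorphism known only on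
    [W] can transport it. *)
Lemma W_centerP h : W h -> (forall x, W x -> commute h x) <-> JT h = 1.
Proof.
move=> Wh; rewrite (JT_kerP k2 bn2 cm2); split=> [ch g|ch x _]; last exact: ch.
have [x [d [Wx cd ->]]] := W_mod_center g.
by apply: commuteM (ch _ Wx) _; exact/commute_sym/cd.
Qed.

Lemma W_JT_surj y : exists2 h, W h & JT h = y.
Proof.
have [g <-] := JT_surj y; have [h [d [Wh cd ->]]] := W_mod_center g.
exists h => //; rewrite JTM.
by have /(JT_kerP k2 bn2 cm2) -> := cd; rewrite mulg1.
Qed.

Lemma Jgen_order i e : (x_ i ^+ e == 1) = (p i %| e)%N.
Proof.
apply/eqP/idP => [|/dvdnP[f ->]].
  move=> /(congr1 JT); rewrite (morph_X (@JTM _ _ _)) JT_gen (morph_1 (@JTM _ _ _)).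
  by move/eqP; rewrite Tgen_order.
by rewrite (mulnC f (p i)) expgnA JgenX expg1n.
Qed.

Lemma refl_gen_order i e : (refl_gen i ^+ e == 1) = (p i %| q i * e)%N.
Proof. by rewrite /refl_gen -expgnA Jgen_order. Qed.

Lemma JT_refl_genX i e : JT (refl_gen i ^+ e) = Tgen k (b * n) (c * m) i ^+ (q i * e).
Proof. by rewrite /refl_gen -expgnA (morph_X (@JTM _ _ _)) JT_gen. Qed.

(** A central factor does not affect conjugation, so the conjugator can be taken in [W], where the
    isomorphism is a morphism. *)
Lemma reflectionsP x : reflections k b n c m x <->
  exists i j g, [/\ W g, refl_gen i ^+ j <> 1 & x = (refl_gen i ^+ j) ^ g].
Proof.
split=> [[r [j [g [/WgensP[i ->] rj ->]]]]|[i [j [g [_ rj ->]]]]]; last first.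
  by exists (refl_gen i), j, g; split=> //; apply/WgensP; exists i.
have [h [d [Wh cd ->]]] := W_mod_center g.
exists i, j, h; split=> //; rewrite conjgM.
by apply/conjg_fixP/commgP/commute_sym/cd.
Qed.

Lemma W_reflection x : reflections k b n c m x -> W x.
Proof.
move/reflectionsP => [i [j [g [_ _ ->]]]].
by apply: normal_closureJ; apply: normal_closureX; apply: W_refl_gen.
Qed.

Lemma refl_gen_axis i j e f g h : refl_gen i ^+ e <> 1 ->
  (refl_gen i ^+ e) ^ g = (refl_gen j ^+ f) ^ h -> i = j.
Proof.
move=> e1 E; apply: contrapT => /eqP ij; apply: e1; apply/eqP.
rewrite refl_gen_order.
have pi2 := ord_gen_ge2 k2 bn2 cm2 i.
(* In an abelian group the cyclic relation of J holds for any images, so [x_i] alone can be sent to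
   a generator. *)
pose y l : 'Z_(p i) := if l == i then Zp1 else 1.
have yX l : y l ^+ p l = 1.
  rewrite /y; case: eqP => [->|_]; last by rewrite expg1n.
  by apply/eqP; rewrite Zp1_expg_eq1.
have cA (u v w : 'Z_(p i)) : u * (v * w) = v * (w * u).
  by rewrite [LHS]Zp_mulgC mulgA.
pose chi : J -> 'Z_(p i) := @J_lift k (b * n) (c * m) _ y.
have chiM : {morph chi : x z / x * z} by exact: J_liftM yX (cA _ _ _) (cA _ _ _).
have chi_gen l : chi (x_ l) = y l by exact: J_lift_gen yX (cA _ _ _) (cA _ _ _) l.
have chiJ u v : chi (u ^ v) = chi u.
  by rewrite (morph_J chiM) conjgE [chi u * _]Zp_mulgC mulKg.
have chiX l f' : chi (refl_gen l ^+ f') = y l ^+ (q l * f').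
  by rewrite /refl_gen -expgnA (morph_X chiM) chi_gen.
move/(congr1 chi): E; rewrite !chiJ !chiX /y eqxx eq_sym (negPf ij) expg1n => /eqP.
by rewrite Zp1_expg_eq1.
Qed.

End Side.

(** * From a reflection isomorphism to an isomorphism of triangle groups *)

Section Transfer.
Variables (k b n c m k' b' n' c' m' : nat).
Local Notation p' := (ord_gen k' (b' * n') (c' * m')).
Local Notation q' := (refl_exp n' m').
Local Notation J' := (J k' (b' * n') (c' * m')).
Local Notation W' := (W k' b' n' c' m').
Local Notation JT' := (@JT k' (b' * n') (c' * m')).
Local Notation T' := (T k' (b' * n') (c' * m')).
Local Notation Tgen' := (Tgen k' (b' * n') (c' * m')).
Local Notation rho' := (refl_gen k' b' n' c' m').
Local Notation refl' := (reflections k' b' n' c' m').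
Local Notation p := (ord_gen k (b * n) (c * m)).
Local Notation q := (refl_exp n m).
Local Notation J := (J k (b * n) (c * m)).
Local Notation W := (W k b n c m).
Local Notation JT := (@JT k (b * n) (c * m)).
Local Notation T := (T k (b * n) (c * m)).
Local Notation Tgen := (Tgen k (b * n) (c * m)).
Local Notation rho := (refl_gen k b n c m).
Local Notation refl := (reflections k b n c m).

Hypotheses (n_gt0 : (0 < n)%N) (m_gt0 : (0 < m)%N) (co_nm : coprime n m).
Hypotheses (k2 : (1 < k)%N) (bn2 : (1 < b * n)%N) (cm2 : (1 < c * m)%N).
Hypotheses (n'_gt0 : (0 < n')%N) (m'_gt0 : (0 < m')%N) (co_nm' : coprime n' m').
Hypotheses (k'2 : (1 < k')%N) (bn'2 : (1 < b' * n')%N) (cm'2 : (1 < c' * m')%N).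

Variables (f : J -> J') (e : J' -> J).

(** Carrying the inverse [e] along makes the notion symmetric, so that each result applies in both
    directions. *)
Definition refl_iso : Prop :=
  [/\ forall x, W x -> W' (f x), forall y, W' y -> W (e y),
      forall x y, W x -> W y -> f (x * y) = f x * f y,
      (forall x, refl x -> refl' (f x)) /\ (forall y, refl' y -> refl (e y))
    & (forall x, W x -> e (f x) = x) /\ (forall y, W' y -> f (e y) = y)].

Hypothesis iso : refl_iso.

Let fW x : W x -> W' (f x). Proof. by have [H _ _ _ _] := iso; exact: H. Qed.
Let eW y : W' y -> W (e y). Proof. by have [_ H _ _ _] := iso; exact: H. Qed.
Let fM x y : W x -> W y -> f (x * y) = f x * f y.
Proof. by have [_ _ H _ _] := iso; exact: H. Qed.
Let fR x : refl x -> refl' (f x). Proof. by have [_ _ _ [H _] _] := iso; exact: H. Qed.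
Let ef x : W x -> e (f x) = x. Proof. by have [_ _ _ _ [H _]] := iso; exact: H. Qed.
Let fe y : W' y -> f (e y) = y. Proof. by have [_ _ _ _ [_ H]] := iso; exact: H. Qed.

Let W1 : W 1. Proof. exact: normal_closure1. Qed.

Lemma refl_iso1 : f 1 = 1.
Proof. by apply: (@mulgI _ (f 1)); rewrite -fM // !mulg1. Qed.

Lemma refl_isoV x : W x -> f x^-1 = (f x)^-1.
Proof.
move=> Wx; symmetry; apply: mulg1_eq.
by rewrite -fM ?mulgV ?refl_iso1 //; exact: normal_closureV.
Qed.

Lemma refl_isoX x i : W x -> f (x ^+ i) = f x ^+ i.
Proof.
move=> Wx; elim: i => [|i IHi]; first exact: refl_iso1.
by rewrite !expgS fM ?IHi //; exact: normal_closureX.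
Qed.

Lemma refl_isoJ x g : W x -> W g -> f (x ^ g) = f x ^ f g.
Proof.
move=> Wx Wg; rewrite !conjgE fM ?fM ?refl_isoV //.
  exact: normal_closureV.
exact: normal_closureM.
Qed.

Definition T_iso (x : T) : T' :=
  JT' (f (s2val (cid2 (W_JT_surj n_gt0 m_gt0 co_nm k2 bn2 cm2 x)))).

(** Two lifts to [W] of the same element differ by a central element of [W], whose image is central
    in [W'] and is therefore killed by [JT']. *)
Lemma T_iso_JT h : W h -> T_iso (JT h) = JT' (f h).
Proof.
move=> Wh; rewrite /T_iso; case: cid2 => g Wg /= gh.
have WhV : W h^-1 by exact: normal_closureV.
have Wd : W (h^-1 * g) by exact: normal_closureM.
have d1 : JT (h^-1 * g) = 1 by rewrite JTM (morph_V (@JTM _ _ _)) gh mulVg.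
have := W_centerP n_gt0 m_gt0 co_nm k2 bn2 cm2 Wd; case=> _ /(_ d1) cd.
have := W_centerP n'_gt0 m'_gt0 co_nm' k'2 bn'2 cm'2 (fW Wd); case=> fd _.
have {}fd : JT' (f (h^-1 * g)) = 1.
  apply: fd => y Wy; rewrite /commute -(fe Wy) -!fM ?cd //; exact: eW.
by rewrite -[g](mulVKg h) fM // JTM fd mulg1.
Qed.

Lemma T_isoM : {morph T_iso : x y / x * y}.
Proof.
move=> x y.
have [g Wg <-] := W_JT_surj n_gt0 m_gt0 co_nm k2 bn2 cm2 x.
have [h Wh <-] := W_JT_surj n_gt0 m_gt0 co_nm k2 bn2 cm2 y.
rewrite -JTM !T_iso_JT ?fM ?JTM //; exact: normal_closureM.
Qed.

Definition same_axis (i i' : 'I_3) : Prop :=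
  [/\ rho i <> 1, rho' i' <> 1 &
      exists j g, W' g /\ f (rho i) = (rho' i' ^+ j) ^ g].

Let Wrho i : W (rho i). Proof. exact: W_refl_gen. Qed.

Lemma same_axis_total i : rho i <> 1 -> exists i', same_axis i i'.
Proof.
move=> ri.
have : refl (rho i).
  apply/(@reflectionsP k b n c m n_gt0 m_gt0 co_nm); exists i, 1%N, 1; split=> //.
  by rewrite expg1 conjg1.
move/fR/(@reflectionsP k' b' n' c' m' n'_gt0 m'_gt0 co_nm') => [i' [j [g [Wg rj E]]]].
exists i'; split=> // [r1|]; last by exists j, g.
by apply: rj; rewrite r1 expg1n.
Qed.

Lemma same_axis_order i i' d : same_axis i i' -> (p' i' %| q' i' * d)%N ->
  (p i %| q i * d)%N.
Proof.
case=> _ _ [j [g [Wg E]]]; rewrite -!refl_gen_order // => /eqP rd.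
have Wd : W (rho i ^+ d) by apply: normal_closureX; apply: Wrho.
rewrite -(ef Wd) refl_isoX // E -conjXg -expgnA (mulnC j d) expgnA rd expg1n conj1g.
by apply/eqP; rewrite -[in LHS]refl_iso1 ef.
Qed.

(** The hypothesis concerns the power [q i] of [x_i] only; [T_root] extends it to [x_i], since that
    power has a nontrivial image. *)
Lemma same_axis_T_iso i i' : same_axis i i' ->
  exists l h, T_iso (Tgen i) = (Tgen' i' ^+ l) ^ h.
Proof.
case=> ri _ [j [g [Wg E]]].
have FX x l : T_iso (x ^+ l) = T_iso x ^+ l by exact: morph_X T_isoM l x.
have F1 : T_iso 1 = 1 by exact: morph_1 T_isoM.
have E1 : T_iso (Tgen i) ^+ q i = (Tgen' i' ^+ (q' i' * j)) ^ JT' g.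
  have := T_iso_JT (Wrho i); rewrite -[rho i]expg1 JT_refl_genX muln1 FX expg1 => ->.
  by rewrite E (morph_J (@JTM _ _ _)) JT_refl_genX.
have nz : Tgen' i' ^+ (q' i' * j) != 1.
  rewrite Tgen_order // -refl_gen_order //; apply/eqP => r1; apply: ri.
  by rewrite -(ef (Wrho i)) E r1 conj1g -refl_iso1 ef.
have p0 : (0 < p i)%N by apply: ltnW; apply: ord_gen_ge2.
have Fp : T_iso (Tgen i) ^+ p i = 1 by rewrite -FX TgenX F1.
have [l El] := T_root k'2 bn'2 cm'2 p0 Fp E1 nz.
by exists l, (JT' g).
Qed.

End Transfer.

Section Columns.
Variables (k b n c m k' b' n' c' m' : nat).
Local Notation p' := (ord_gen k' (b' * n') (c' * m')).
Local Notation p := (ord_gen k (b * n) (c * m)).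
Local Notation q' := (refl_exp n' m').
Local Notation q := (refl_exp n m).
Local Notation J' := (J k' (b' * n') (c' * m')).
Local Notation J := (J k (b * n) (c * m)).

Hypotheses (n_gt0 : (0 < n)%N) (m_gt0 : (0 < m)%N) (co_nm : coprime n m).
Hypotheses (k2 : (1 < k)%N) (bn2 : (1 < b * n)%N) (cm2 : (1 < c * m)%N).
Hypotheses (n'_gt0 : (0 < n')%N) (m'_gt0 : (0 < m')%N) (co_nm' : coprime n' m').
Hypotheses (k'2 : (1 < k')%N) (bn'2 : (1 < b' * n')%N) (cm'2 : (1 < c' * m')%N).

Variables (f : J -> J') (e : J' -> J).
Hypothesis iso : @refl_iso k b n c m k' b' n' c' m' f e.

Lemma refl_iso_sym : @refl_iso k' b' n' c' m' k b n c m e f.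
Proof.
have [fW eW fM [fR eR] [ef fe]] := iso; split=> // x y Wx Wy.
have WM := normal_closureM (eW _ Wx) (eW _ Wy).
by rewrite -(ef _ WM) fM ?fe //; exact: eW.
Qed.

Lemma T_isoK x :
  T_iso n'_gt0 m'_gt0 co_nm' k'2 bn'2 cm'2 e
    (T_iso n_gt0 m_gt0 co_nm k2 bn2 cm2 f x) = x.
Proof.
have [fW _ _ _ [ef _]] := iso.
have [h Wh <-] := W_JT_surj n_gt0 m_gt0 co_nm k2 bn2 cm2 x.
rewrite (T_iso_JT n_gt0 m_gt0 co_nm k2 bn2 cm2 n'_gt0 m'_gt0 co_nm' k'2 bn'2 cm'2 iso) //.
by rewrite (T_iso_JT n'_gt0 m'_gt0 co_nm' k'2 bn'2 cm'2 n_gt0 m_gt0 co_nm k2 bn2 cm2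
  refl_iso_sym) ?ef //; exact: fW.
Qed.

(** Composing the two isomorphisms makes the reflection generator [i] conjugate to a power of the
    generator [l]; [refl_gen_axis] then identifies the axes. *)
Lemma same_axis_inv i i' l :
  @same_axis k b n c m k' b' n' c' m' f i i' ->
  @same_axis k' b' n' c' m' k b n c m e i' l -> i = l.
Proof.
case=> ri ri' [j [g [Wg E]]] [_ rl [j' [g' [Wg' E']]]].
have [fW eW fM _ [ef fe]] := iso.
have Wi : W k b n c m (refl_gen k b n c m i) by exact: W_refl_gen.
have Wi' : W k' b' n' c' m' (refl_gen k' b' n' c' m' i') by exact: W_refl_gen.
have := ef _ Wi; rewrite E (refl_isoJ refl_iso_sym) //; last exact: normal_closureX.
rewrite (refl_isoX refl_iso_sym) // E' -conjXg -expgnA -conjgM => Ei.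
apply: (@refl_gen_axis k b n c m k2 bn2 cm2 i l 1 (j' * j) 1 (g' * e g)).
  by rewrite expg1.
by rewrite expg1 conjg1.
Qed.

End Columns.

(** * Matching the columns *)

Section Axis.
Variables (k n m : nat).
Hypotheses (k2 : (1 < k)%N) (n2 : (1 < n)%N) (m2 : (1 < m)%N).
Local Notation p := (ord_gen k n m).
Local Notation T := (T k n m).
Local Notation Tgen := (Tgen k n m).

Definition in_axis (y : T) (i : 'I_3) := exists l h, y = (Tgen i ^+ l) ^ h.

Lemma in_axis_order l i : in_axis (Tgen l) i -> p l = p i.
Proof. by case=> e [h E]; apply: Tgen_conj_order E. Qed.

Lemma in_axisX y i : in_axis y i -> y ^+ p i = 1.
Proof.
by case=> l [h ->]; rewrite -conjXg -expgnA mulnC expgnA TgenX expg1n conj1g.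
Qed.

(** The relation [stu = 1] forces the images to cancel, hence inverse values at [u] and [v]. *)
Lemma T_to_Zp (d : nat) (u v : 'I_3) : (1 < d)%N -> u != v ->
  (d %| p u)%N -> (d %| p v)%N ->
  exists psi : T -> 'Z_d, [/\ {morph psi : x y / x * y},
    psi (Tgen u) = Zp1, psi (Tgen v) = Zp1^-1 &
    forall w, w != u -> w != v -> psi (Tgen w) = 1].
Proof.
move=> d2 uv du dv.
pose y w : 'Z_d := if w == u then Zp1 else if w == v then Zp1^-1 else 1.
have yX w : y w ^+ p w = 1.
  rewrite /y; case: eqP => [->|_]; first by apply/eqP; rewrite Zp1_expg_eq1.
  case: eqP => [->|_]; last by rewrite expg1n.
  by rewrite expVgn; apply/eqP; rewrite invg_eq1 Zp1_expg_eq1.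
have y1 : y i0 * y i1 * y i2 = 1.
  have yu : y u = Zp1 by rewrite /y eqxx.
  have yv : y v = Zp1^-1 by rewrite /y eq_sym (negPf uv) eqxx.
  have yw w : w != u -> w != v -> y w = 1 by rewrite /y => /negPf -> /negPf ->.
  have n01 : (i0 == i1) = false by rewrite -val_eqE /= !inordK.
  have n02 : (i0 == i2) = false by rewrite -val_eqE /= !inordK.
  have n12 : (i1 == i2) = false by rewrite -val_eqE /= !inordK.
  have n10 : (i1 == i0) = false by rewrite eq_sym.
  have n20 : (i2 == i0) = false by rewrite eq_sym.
  have n21 : (i2 == i1) = false by rewrite eq_sym.
  move: (u) (v) uv yu yv yw; do 2 (apply: ord3P); rewrite ?eqxx // => _ yu yv yw.
  - by rewrite yu yv yw ?n20 ?n21 // mulg1 mulgV.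
  - by rewrite yu yv yw ?n10 ?n12 // mulg1 mulgV.
  - by rewrite yu yv yw ?n20 ?n21 // mulg1 mulVg.
  - by rewrite yu yv yw ?n01 ?n02 // mul1g mulgV.
  - by rewrite yu yv yw ?n10 ?n12 // mulg1 mulVg.
  - by rewrite yu yv yw ?n01 ?n02 // mul1g mulVg.
exists (T_lift y); split.
- exact: T_liftM yX y1.
- by rewrite (T_lift_gen yX y1) /y eqxx.
- by rewrite (T_lift_gen yX y1) /y eq_sym (negPf uv) eqxx.
- by move=> w /negPf wu /negPf wv; rewrite (T_lift_gen yX y1) /y wu wv.
Qed.

(** A common factor [d] of [p l] and [p j] would give a map to Z/d that is nontrivial on [x_l] and
    trivial on [x_i], although [x_l] is conjugate to a power of [x_i]. *)
Lemma in_axis_coprime l i j : in_axis (Tgen l) i -> i != l -> j != l -> j != i ->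
  coprime (p l) (p j).
Proof.
case=> e [h E] il jl ji; apply: contraT => ncop.
have p0 : (0 < p l)%N by apply: ltnW; apply: ord_gen_ge2.
have g2 : (1 < gcdn (p l) (p j))%N by rewrite ltn_neqAle eq_sym ncop gcdn_gt0 p0.
have lj : l != j by rewrite eq_sym.
have [psi [psiM pl _ pw]] := T_to_Zp g2 lj (dvdn_gcdl _ _) (dvdn_gcdr _ _).
have := congr1 psi E; rewrite (morph_J psiM) (morph_X psiM) pl pw //; last by rewrite eq_sym.
rewrite expg1n conj1g => E1.
have : ((Zp1 : 'Z_(gcdn (p l) (p j))) ^+ 1 == 1) by rewrite expg1 E1.
by rewrite Zp1_expg_eq1 // dvdn1 gtn_eqF.
Qed.

End Axis.

Section IsomorphicTriangles.
Variables (k n m k' n' m' : nat).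
Hypotheses (k2 : (1 < k)%N) (n2 : (1 < n)%N) (m2 : (1 < m)%N).
Hypotheses (k'2 : (1 < k')%N) (n'2 : (1 < n')%N) (m'2 : (1 < m')%N).
Local Notation p' := (ord_gen k' n' m').
Local Notation p := (ord_gen k n m).
Local Notation T' := (T k' n' m').
Local Notation T := (T k n m).
Local Notation Tgen' := (Tgen k' n' m').
Local Notation Tgen := (Tgen k n m).
Variables (F : T -> T') (E : T' -> T).
Hypothesis FM : {morph F : x y / x * y}.
Hypothesis EF : cancel F E.

Lemma F_in_axis y i i' : in_axis (F (Tgen i)) i' -> in_axis y i -> in_axis (F y) i'.
Proof.
case=> l [h El] [l' [h' ->]]; exists (l * l')%N, (h * F h').
by rewrite (morph_J FM) (morph_X FM) El -conjXg -expgnA conjgM.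
Qed.

Lemma F_in_some_axis l : exists i', in_axis (F (Tgen l)) i'.
Proof.
have p0 : (0 < p l)%N by apply: ltnW; apply: ord_gen_ge2.
have Fp : F (Tgen l) ^+ p l = 1 by rewrite -(morph_X FM) TgenX (morph_1 FM).
by have [i' [e [h ->]]] := T_torsion k'2 n'2 m'2 p0 Fp; exists i', e, h.
Qed.

Lemma F_axis_dvd l l' : in_axis (F (Tgen l)) l' -> (p l %| p' l')%N.
Proof.
move/in_axisX; rewrite -(morph_X FM) => /(congr1 E); rewrite EF.
rewrite -(morph_1 FM) EF => /eqP; by rewrite Tgen_order.
Qed.

(* The abelianisations differ: only the first triangle group maps onto Z/P. *)
Lemma F_orders_swap_absurd (i l j i' : 'I_3) : {morph E : x y / x * y} ->
  i != l -> p i = p l -> coprime (p l) (p j) ->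
  (forall w, w != i' -> p' w = p j) -> False.
Proof.
move=> EM il pil co pw.
have P2 := ord_gen_ge2 k2 n2 m2 l.
have dpi : (p l %| p i)%N by rewrite pil.
have [psi [psiM pi _ _]] := T_to_Zp P2 il dpi (dvdnn _).
pose chi x := psi (E x).
have chiM : {morph chi : x y / x * y} by move=> x y; rewrite /chi EM psiM.
(* The order of this value divides both [p l] and [p j], which are coprime. The product relation
   then kills the last generator as well. *)
have chi1 w : w != i' -> chi (Tgen' w) = 1.
  move=> wi; apply/eqP; rewrite -[_ == 1]/(chi (Tgen' w) ^+ 1 == 1) -order_dvdn.
  have <- : gcdn (p l) (p j) = 1%N by apply/eqP.
  have X1 : chi (Tgen' w) ^+ p j = 1.
    by rewrite -(pw w wi) -(morph_X chiM) TgenX (morph_1 chiM).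
  rewrite dvdn_gcd !order_dvdn; apply/andP; split; last exact/eqP.
  rewrite -[chi _]Zp1_expgz -expgnA Zp1_expg_eq1 //.
  by rewrite dvdn_mull.
have chi_i' : chi (Tgen' i') = 1.
  have n01 : inord 0 != inord 1 :> 'I_3 by rewrite -val_eqE /= !inordK.
  have n02 : inord 0 != inord 2 :> 'I_3 by rewrite -val_eqE /= !inordK.
  have n12 : inord 1 != inord 2 :> 'I_3 by rewrite -val_eqE /= !inordK.
  have := congr1 chi (Tgen_prod k' n' m'); rewrite !chiM (morph_1 chiM).
  move: i' chi1 {pw}; apply: ord3P => chi1.
  - by rewrite (chi1 (inord 1)) ?(chi1 (inord 2)) 1?eq_sym // !mulg1.
  - by rewrite (chi1 (inord 0)) ?(chi1 (inord 2)) // 1?eq_sym // mul1g mulg1.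
  - by rewrite (chi1 (inord 0)) ?(chi1 (inord 1)) // !mul1g.
have chi_triv : chi =1 (fun=> 1).
  apply: eq_pres_morph => // [x y|w]; first by rewrite mulg1.
  by have [->|/chi1] := eqVneq w i'.
have : ((Zp1 : 'Z_(p l)) ^+ 1 == 1).
  by rewrite expg1 -pi; have := chi_triv (F (Tgen i)); rewrite /chi EF => ->.
by rewrite Zp1_expg_eq1 // dvdn1 gtn_eqF.
Qed.

End IsomorphicTriangles.

Lemma in_axis_trans k n m (y : T k n m) i j :
  in_axis y i -> in_axis (Tgen k n m i) j -> in_axis y j.
Proof.
case=> e [h ->] [l [g ->]]; exists (l * e)%N, (g * h).
by rewrite -conjXg -expgnA conjgM.
Qed.

Lemma ord3_third (i j l w : 'I_3) :
  i != j -> j != l -> i != l -> w != i -> w != j -> w = l.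
Proof.
by case: (nx_cases i j) => ->; case: (nx_cases i l) => ->; case: (nx_cases i w) => ->;
  rewrite ?eqxx.
Qed.

Section Correspondence.
Variables (k n m k' n' m' : nat).
Local Notation p' := (ord_gen k' n' m').
Local Notation p := (ord_gen k n m).
Local Notation T' := (T k' n' m').
Local Notation T := (T k n m).
Local Notation Tgen' := (Tgen k' n' m').
Local Notation Tgen := (Tgen k n m).

(* [act] marks the axes carrying reflections; the isomorphism matches them, with
   their orders, through [sigma]. *)
Record axis_map (F : T -> T') (E : T' -> T) (act act' : pred 'I_3)
    (q q' : 'I_3 -> nat) (sigma sigma' : 'I_3 -> 'I_3) : Prop := AxisMap {
  am_mul : {morph F : x y / x * y};
  am_can : cancel F E;
  am_act : forall i, act i -> act' (sigma i);
  am_inv : forall i, act i -> sigma' (sigma i) = i;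
  am_ord : forall i, act i -> p i = p' (sigma i);
  am_exp : forall i, act i -> q i = q' (sigma i);
  am_axis : forall i, act i -> in_axis (F (Tgen i)) (sigma i);
  am_inact : forall i, ~~ act i -> q i = p i }.
End Correspondence.

Section Back.
Variables (k n m k' n' m' : nat).
Hypotheses (k2 : (1 < k)%N) (n2 : (1 < n)%N) (m2 : (1 < m)%N).
Hypotheses (k'2 : (1 < k')%N) (n'2 : (1 < n')%N) (m'2 : (1 < m')%N).
Local Notation p' := (ord_gen k' n' m').
Local Notation p := (ord_gen k n m).
Local Notation T' := (T k' n' m').
Local Notation T := (T k n m).
Local Notation Tgen' := (Tgen k' n' m').
Local Notation Tgen := (Tgen k n m).
Variables (F : T -> T') (E : T' -> T) (act act' : pred 'I_3).
Variables (q q' : 'I_3 -> nat) (sigma sigma' : 'I_3 -> 'I_3).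
Hypothesis FA : axis_map F E act act' q q' sigma sigma'.
Hypothesis EA : axis_map E F act' act q' q sigma' sigma.

Lemma axis_back l i' : in_axis (F (Tgen l)) i' -> act' i' ->
  in_axis (Tgen l) (sigma' i').
Proof.
move=> Fl ai'; have := F_in_axis (am_mul EA) (am_axis EA ai') Fl.
by rewrite (am_can FA).
Qed.

(** Conjugacy into the axis of [s] is pulled back by [axis_back], so [F] sends a generator outside
    that axis to an axis with the same property. *)
Lemma free_axis_step l : act i0 -> (forall i, i != i0 -> ~~ act i) ->
  (forall i, i != i0 -> ~~ act' i) -> ~ in_axis (Tgen l) i0 ->
  exists l', [/\ l' != i0, ~ in_axis (Tgen' l') i0 & (p l %| p' l')%N].
Proof.
move=> a0 noact noact' Dl.
have s0 : sigma i0 = i0.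
  apply/eqP; apply: contraT => /noact'; by rewrite (am_act FA a0).
have a0' : act' i0 by rewrite -s0 (am_act FA a0).
have s0' : sigma' i0 = i0 by rewrite -[in LHS]s0 (am_inv FA a0).
have noF0 : ~ in_axis (F (Tgen l)) i0.
  by move=> H; apply: Dl; have := axis_back H a0'; rewrite s0'.
have [i' Hi'] := F_in_some_axis k2 n2 m2 k'2 n'2 m'2 (am_mul FA) l.
exists i'; split.
- by apply/eqP => E0; rewrite E0 in Hi'.
- by move=> H; apply/noF0/(in_axis_trans Hi' H).
- exact: (F_axis_dvd k2 n2 m2 (am_mul FA) (am_can FA) Hi').
Qed.
End Back.

(** * Orders of the axes that carry no reflection *)

Section Match.
Variables (k n m k' n' m' : nat).
Hypotheses (k2 : (1 < k)%N) (n2 : (1 < n)%N) (m2 : (1 < m)%N).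
Hypotheses (k'2 : (1 < k')%N) (n'2 : (1 < n')%N) (m'2 : (1 < m')%N).
Local Notation p' := (ord_gen k' n' m').
Local Notation p := (ord_gen k n m).
Local Notation T' := (T k' n' m').
Local Notation T := (T k n m).
Local Notation Tgen' := (Tgen k' n' m').
Local Notation Tgen := (Tgen k n m).
Variables (F : T -> T') (E : T' -> T) (act act' : pred 'I_3).
Variables (q q' : 'I_3 -> nat) (sigma sigma' : 'I_3 -> 'I_3).
Hypothesis FA : axis_map F E act act' q q' sigma sigma'.
Hypothesis EA : axis_map E F act' act q' q sigma' sigma.

(** If [F] and [E] exchange the inactive axes, the orders divide each other. Otherwise an inactive
    generator is conjugate into an active axis and inherits its order; the matching of active axes
    concludes unless two different active axes are involved. *)
Lemma single_inactive_order l l' : ~~ act l -> (forall w, w != l -> act w) ->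
  ~~ act' l' -> (forall w, w != l' -> act' w) -> p l = p' l'.
Proof.
move=> al act_l al' act_l'.
have back := axis_back FA EA; have fwd := axis_back EA FA.
have [i' Hi'] := F_in_some_axis k2 n2 m2 k'2 n'2 m'2 (am_mul FA) l.
have [j Hj] := F_in_some_axis k'2 n'2 m'2 k2 n2 m2 (am_mul EA) l'.
have [El'|il'] := eqVneq i' l'; have [El|jl] := eqVneq j l.
- rewrite El' in Hi'; rewrite El in Hj.
  apply/eqP; rewrite eqn_dvd (F_axis_dvd k2 n2 m2 (am_mul FA) (am_can FA) Hi').
  exact: (F_axis_dvd k'2 n'2 m'2 (am_mul EA) (am_can EA) Hj).
- rewrite El' in Hi'; have aj := act_l _ jl.
  have Hlj := fwd _ _ Hj aj.
  have := back _ _ (in_axis_trans Hi' Hlj) (am_act FA aj).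
  rewrite (am_inv FA aj) => Hl.
  rewrite (in_axis_order k2 n2 m2 Hl) (in_axis_order k'2 n'2 m'2 Hlj).
  exact: (am_ord FA aj).
- rewrite El in Hj; have ai' := act_l' _ il'.
  have Hli := back _ _ Hi' ai'.
  have := fwd _ _ (in_axis_trans Hj Hli) (am_act EA ai').
  rewrite (am_inv EA ai') => Hl'.
  rewrite (in_axis_order k2 n2 m2 Hli) (in_axis_order k'2 n'2 m'2 Hl').
  by rewrite (am_ord EA ai').
have ai' := act_l' _ il'; have aj := act_l _ jl.
have Hli := back _ _ Hi' ai'; have Hlj := fwd _ _ Hj aj.
have pli := in_axis_order k2 n2 m2 Hli; have plj := in_axis_order k'2 n'2 m'2 Hlj.
rewrite -(am_ord FA aj) in plj.
have [ij|ij] := eqVneq (sigma' i') j; first by rewrite pli ij plj.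
have ai := am_act EA ai'; set i := sigma' i' in ai pli ij Hli.
have il : i != l by apply: contraNneq al => <-.
have ji : j != i by rewrite eq_sym.
(* The ambiguous case: the orders are P, P, Q on one side and P, Q, Q on the other, with P and Q
   coprime. *)
have co := in_axis_coprime k2 n2 m2 Hli il jl ji.
exfalso; apply: (F_orders_swap_absurd k2 n2 m2 (am_can FA) (i' := i') (am_mul EA) il
  (esym pli) co) => w wi'.
have [->|wl'] := eqVneq w l'; first exact: plj.
have aw := act_l' _ wl'; have sw := am_act EA aw.
have -> : j = sigma' w.
  symmetry; apply: (@ord3_third i l) => //; first by rewrite eq_sym.
    apply: contra_neq wi' => sE.
    by rewrite -(am_inv EA aw) sE (am_inv EA ai').
  by apply: contraNneq al => <-.
by rewrite (am_ord EA aw).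
Qed.

(** Going forth and back, [p l] divides [p' l'], which divides some [p l''] with [l''] not [i0];
    coprimality forces [l'' = l]. *)
Lemma free_axis_match l : act i0 -> act' i0 -> (forall i, i != i0 -> ~~ act i) ->
  (forall i, i != i0 -> ~~ act' i) ->
  (forall i j, i != i0 -> j != i0 -> i != j -> coprime (p i) (p j)) ->
  l != i0 -> ~ in_axis (Tgen l) i0 ->
  exists l', [/\ l' != i0, ~ in_axis (Tgen' l') i0 & p l = p' l'].
Proof.
move=> a0 a0' na na' co l0 Dl.
have [l' [l'0 Dl' ll']] := free_axis_step k2 n2 m2 k'2 n'2 m'2 FA EA a0 na na' Dl.
have [l'' [l''0 _ l'l]] := free_axis_step k'2 n'2 m'2 k2 n2 m2 EA FA a0' na' na Dl'.
exists l'; split=> //; have [E0|ne] := eqVneq l l''.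
  by apply/eqP; rewrite eqn_dvd ll' E0.
have p2 := ord_gen_ge2 k2 n2 m2 l.
have : (p l %| gcdn (p l) (p l''))%N by rewrite dvdn_gcd dvdnn (dvdn_trans ll' l'l).
by have /eqP -> := co _ _ l0 l''0 ne; rewrite dvdn1 gtn_eqF.
Qed.

End Match.

Lemma perm_eq_inj3 (A : eqType) (col col' : 'I_3 -> A) (tau : 'I_3 -> 'I_3) :
  injective tau -> (forall i, col i = col' (tau i)) ->
  perm_eq [:: col i0; col i1; col i2] [:: col' i0; col' i1; col' i2].
Proof.
move=> tau_inj colE; rewrite -/(map col [:: i0; i1; i2]) -/(map col' [:: i0; i1; i2]).
rewrite (eq_map colE) map_comp; apply: perm_map.
have mem3 i : i \in [:: i0; i1; i2].
  by move: i; apply: ord3P; rewrite !inE eqxx ?orbT.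
have u3 : uniq [:: i0; i1; i2] by rewrite /= !inE -!val_eqE /= !inordK.
apply: uniq_perm; rewrite ?map_inj_uniq // => i; rewrite mem3.
by rewrite -[i](f_invF tau_inj) map_f.
Qed.

Lemma neq_i01 : i1 != i0. Proof. by rewrite -val_eqE /= !inordK. Qed.
Lemma neq_i02 : i2 != i0. Proof. by rewrite -val_eqE /= !inordK. Qed.
Lemma neq_i12 : i1 != i2. Proof. by rewrite -val_eqE /= !inordK. Qed.

Lemma ord3_cases (i : 'I_3) : [\/ i = i0, i = i1 | i = i2].
Proof. by move: i; apply: ord3P; [exact: Or31 | exact: Or32 | exact: Or33]. Qed.

Section ActiveAxes.
Variables (k n m k' n' m' : nat).
Local Notation T' := (T k' n' m').
Local Notation T := (T k n m).
Variables (F : T -> T') (E : T' -> T) (act act' : pred 'I_3).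
Variables (q q' : 'I_3 -> nat) (sigma sigma' : 'I_3 -> 'I_3).
Hypothesis FA : axis_map F E act act' q q' sigma sigma'.

Lemma sigma_inj i j : act i -> act j -> sigma i = sigma j -> i = j.
Proof. by move=> ai aj E0; rewrite -(am_inv FA ai) E0 (am_inv FA aj). Qed.

Lemma all_active : (forall i, act i) -> forall i, act' i.
Proof.
move=> alla; have inj : injective sigma by move=> i j; exact: sigma_inj.
by move=> i; rewrite -[i](f_invF inj) (am_act FA).
Qed.

Lemma none_active : act i0 -> (forall i, i != i0 -> ~~ act' i) ->
  forall i, i != i0 -> ~~ act i.
Proof.
move=> a0 na' i ii0; apply/negP => ai.
have s0 j : act j -> sigma j = i0.
  by move=> aj; apply/eqP; apply: contraT => /na'; rewrite (am_act FA aj).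
by move/eqP: ii0; apply; apply: sigma_inj => //; rewrite !s0.
Qed.
End ActiveAxes.

Section ColumnMatching.
Variables (k n m k' n' m' : nat).
Hypotheses (k2 : (1 < k)%N) (n2 : (1 < n)%N) (m2 : (1 < m)%N).
Hypotheses (k'2 : (1 < k')%N) (n'2 : (1 < n')%N) (m'2 : (1 < m')%N).
Local Notation p' := (ord_gen k' n' m').
Local Notation p := (ord_gen k n m).
Local Notation T' := (T k' n' m').
Local Notation T := (T k n m).
Local Notation Tgen' := (Tgen k' n' m').
Local Notation Tgen := (Tgen k n m).
Variables (F : T -> T') (E : T' -> T) (act act' : pred 'I_3).
Variables (q q' : 'I_3 -> nat) (sigma sigma' : 'I_3 -> 'I_3).
Hypothesis FA : axis_map F E act act' q q' sigma sigma'.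
Hypothesis EA : axis_map E F act' act q' q sigma' sigma.
Hypotheses (a0 : act i0) (a0' : act' i0).

(** If [u] is not conjugate into the axis of [s] either, both orders are matched directly. If it is,
    its order is that of [s], and so is the order of the index left on the other side: outside the
    axis of [s], that index would have the order of [v], against coprimality. *)
Lemma inactive_pair (u v : 'I_3) : u != i0 -> v != i0 -> u != v ->
  (forall i, i != i0 -> ~~ act i) -> (forall i, i != i0 -> ~~ act' i) ->
  coprime (p u) (p v) ->
  (forall i j, i != i0 -> j != i0 -> i != j -> coprime (p' i) (p' j)) ->
  ~ in_axis (Tgen v) i0 ->
  exists u' v', [/\ u' != i0, v' != i0, u' != v', p u = p' u' & p v = p' v'].
Proof.
move=> u0 v0 uv na na' co co' Dv.
have co2 i j : i != i0 -> j != i0 -> i != j -> coprime (p i) (p j).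
  have uvE w : w != i0 -> w = u \/ w = v.
    move=> w0; have [->|wu] := eqVneq w u; [by left | right].
    by apply: (@ord3_third i0 u); rewrite // eq_sym.
  by move=> /uvE[->|->] /uvE[->|->]; rewrite ?eqxx // coprime_sym.
have s0 : sigma i0 = i0.
  by apply/eqP; apply: contraT => /na'; rewrite (am_act FA a0).
have p00 : p i0 = p' i0 by rewrite (am_ord FA a0) s0.
have fwd := free_axis_match k2 n2 m2 k'2 n'2 m'2 FA EA a0 a0' na na' co2.
have bwd := free_axis_match k'2 n'2 m'2 k2 n2 m2 EA FA a0' a0 na' na co'.
have [v' [v'0 Dv' pv]] := fwd v v0 Dv.
have p'v2 := ord_gen_ge2 k'2 n'2 m'2 v'.
have coE x y : (1 < x)%N -> coprime x y -> x <> y.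
  by move=> x2 cxy exy; move: cxy; rewrite -exy /coprime gcdnn gtn_eqF.
have [Du|Du] := pselect (in_axis (Tgen u) i0); last first.
  have [u' [u'0 _ pu]] := fwd u u0 Du; exists u', v'; split=> //.
  apply/eqP => uv'; apply: (coE _ _ _ co); first exact: ord_gen_ge2.
  by rewrite pu pv uv'.
have [u' [u'0 u'v']] : exists u', u' != i0 /\ u' != v'.
  have [E0|E0|E0] := ord3_cases v'; first by rewrite E0 eqxx in v'0.
    by exists i2; rewrite E0; split; [exact: neq_i02 | rewrite eq_sym; exact: neq_i12].
  by exists i1; rewrite E0; split; [exact: neq_i01 | exact: neq_i12].
exists u', v'; split=> //.
have pu := in_axis_order k2 n2 m2 Du.
have [Du'|Du'] := pselect (in_axis (Tgen' u') i0).
  by rewrite pu p00 (in_axis_order k'2 n'2 m'2 Du').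
have [w [w0 Dw pw]] := bwd u' u'0 Du'.
have wv : w = v.
  apply: (@ord3_third i0 u) => //; first by rewrite eq_sym.
    by rewrite eq_sym.
  by apply/eqP => wu; apply: Dw; rewrite wu.
exfalso; apply: (coE (p' v') (p' u')) => //; first by apply: co'; rewrite // eq_sym.
by rewrite pw wv pv.
Qed.

Lemma columns_match : q i0 = q' i0 ->
  (forall i j, i != i0 -> j != i0 -> i != j -> coprime (q i) (q j)) ->
  (forall i j, i != i0 -> j != i0 -> i != j -> coprime (q' i) (q' j)) ->
  exists2 tau, injective tau & forall i, (p i, q i) = (p' (tau i), q' (tau i)).
Proof.
move=> q0 co co'.
have colE i : act i -> (p i, q i) = (p' (sigma i), q' (sigma i)).
  by move=> ai; rewrite -(am_ord FA ai) -(am_exp FA ai).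
have inactE i i' : ~~ act i -> ~~ act' i' -> p i = p' i' ->
    (p i, q i) = (p' i', q' i').
  by move=> ai ai' pi; rewrite (am_inact FA ai) (am_inact EA ai') pi.
have [alla|nalla] := pselect (forall i, act i).
  exists sigma => [i j|i]; first exact: (sigma_inj FA (alla i) (alla j)).
  exact: colE.
have [na|nna] := pselect (forall i, i != i0 -> ~~ act i).
  have na' := none_active EA a0' na.
  have copt i j : i != i0 -> j != i0 -> i != j -> coprime (p i) (p j).
    by move=> i_0 j_0 ij; rewrite -(am_inact FA (na i i_0)) -(am_inact FA (na j j_0)) co.
  have copt' i j : i != i0 -> j != i0 -> i != j -> coprime (p' i) (p' j).
    by move=> i_0 j_0 ij; rewrite -(am_inact EA (na' i i_0)) -(am_inact EA (na' j j_0)) co'.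
  have s0 : sigma i0 = i0.
    by apply/eqP; apply: contraT => /na'; rewrite (am_act FA a0).
  have build u v u' v' : u != i0 -> v != i0 -> u != v ->
      [/\ u' != i0, v' != i0, u' != v', p u = p' u' & p v = p' v'] ->
      exists2 tau, injective tau & forall i, (p i, q i) = (p' (tau i), q' (tau i)).
    move=> u0 v0 uv [u'0 v'0 uv' pu pv].
    pose tau i := if i == i0 then i0 else if i == u then u' else v'.
    have uvE w : w != i0 -> w != u -> w = v.
      by move=> w0 wu; apply: (@ord3_third i0 u); rewrite // eq_sym.
    exists tau => [i j|i]; rewrite /tau.
      have [->|i_0] := eqVneq i i0; have [->|j_0] := eqVneq j i0 => //.
      - by case: eqP => _ /esym/eqP; rewrite ?(negPf u'0) ?(negPf v'0).
      - by case: eqP => _ /eqP; rewrite ?(negPf u'0) ?(negPf v'0).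
      have [->|iu] := eqVneq i u; have [->|ju] := eqVneq j u => //.
      - by move/eqP; rewrite (negPf uv').
      - by move/eqP; rewrite eq_sym (negPf uv').
      by move=> _; rewrite (uvE i) // (uvE j).
    have [->|i_0] := eqVneq i i0; first by rewrite (colE _ a0) s0.
    have [->|iu] := eqVneq i u; first by apply: inactE; rewrite ?na ?na'.
    by rewrite (uvE i) //; apply: inactE; rewrite ?na ?na'.
  (* [t] and [u] cannot both be conjugate into the axis of [s], as their orders would be equal,
     coprime and greater than 1. *)
  have [D2|D2] := pselect (in_axis (Tgen i2) i0).
    have D1 : ~ in_axis (Tgen i1) i0.
      move=> D1; have := copt i1 i2 neq_i01 neq_i02 neq_i12.
      rewrite (in_axis_order k2 n2 m2 D1) (in_axis_order k2 n2 m2 D2) /coprime gcdnn.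
      by rewrite gtn_eqF // ord_gen_ge2.
    have n21 : i2 != i1 by rewrite eq_sym neq_i12.
    have [u' [v' H]] := inactive_pair neq_i02 neq_i01 n21 na na'
      (copt _ _ neq_i02 neq_i01 n21) copt' D1.
    exact: build neq_i02 neq_i01 n21 H.
  have [u' [v' H]] := inactive_pair neq_i01 neq_i02 neq_i12 na na'
    (copt _ _ neq_i01 neq_i02 neq_i12) copt' D2.
  exact: build neq_i01 neq_i02 neq_i12 H.
(* Since [s] is active, exactly one axis is inactive in the remaining case. *)
have single (b : pred 'I_3) : b i0 -> ~ (forall i, b i) -> ~ (forall i, i != i0 -> ~~ b i) ->
    exists l, ~~ b l /\ forall w, w != l -> b w.
  move=> b0 nb1 nb2; case b1 : (b i1); case b2 : (b i2).
  - by case: nb1; apply: ord3P; rewrite ?b0 ?b1 ?b2.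
  - by exists i2; rewrite b2; split=> //; apply: ord3P; rewrite ?eqxx.
  - by exists i1; rewrite b1; split=> //; apply: ord3P; rewrite ?eqxx.
  - by case: nb2; apply: ord3P; rewrite ?eqxx ?b1 ?b2.
have [l [al act_l]] := single act a0 nalla nna.
have nalla' : ~ (forall i, act' i) by move=> H; apply/nalla/(all_active EA H).
have nna' : ~ (forall i, i != i0 -> ~~ act' i).
  by move=> H; apply: nna; exact: (none_active FA a0 H).
have [l' [al' act_l']] := single act' a0' nalla' nna'.
have pl := single_inactive_order k2 n2 m2 k'2 n'2 m'2 FA EA al act_l al' act_l'.
exists (fun i => if i == l then l' else sigma i) => [i j|i].
  have [->|il] := eqVneq i l; have [->|jl] := eqVneq j l => // E0.
  - by move: al'; rewrite E0 (am_act FA (act_l _ jl)).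
  - by move: al'; rewrite -E0 (am_act FA (act_l _ il)).
  - by apply: (sigma_inj FA) E0; apply: act_l.
have [->|il] := eqVneq i l; first exact: inactE.
exact/colE/act_l.
Qed.

End ColumnMatching.

(** * Isomorphisms of J permuting the columns *)

Section Symmetry.
Implicit Types A B C : nat * nat.

(** A column [A] consists of an order [A.1] and an exponent [A.2]. All three exponents are free,
    since permutations pass through triples whose first exponent is not 1. *)
Definition col_gen A B C (i : 'I_3) : J A.1 B.1 C.1 :=
  Jgen A.1 B.1 C.1 i ^+ nth 0 [:: A.2; B.2; C.2] i.

Definition col_iso A B C A' B' C' : Prop :=
  exists (f : J A.1 B.1 C.1 -> J A'.1 B'.1 C'.1) (g : J A'.1 B'.1 C'.1 -> J A.1 B.1 C.1),
  [/\ {morph f : x y / x * y} /\ {morph g : x y / x * y}, cancel f g, cancel g f,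
      forall i, exists j e, f (col_gen A B C i) = col_gen A' B' C' j ^+ (e : nat)
    & forall i, exists j e, g (col_gen A' B' C' i) = col_gen A B C j ^+ (e : nat)].

Lemma col_iso_refl A B C : col_iso A B C A B C.
Proof.
by exists id, id; split=> // i; exists i, 1%N; rewrite expg1.
Qed.

Lemma col_iso_trans A B C A' B' C' A2 B2 C2 :
  col_iso A B C A' B' C' -> col_iso A' B' C' A2 B2 C2 -> col_iso A B C A2 B2 C2.
Proof.
case=> f [g [[fM gM] fg gf fr gr]] [f' [g' [[fM' gM'] fg' gf' fr' gr']]].
exists (f' \o f), (g \o g'); split.
- by split=> x y /=; rewrite ?fM ?fM' ?gM' ?gM.
- by move=> x /=; rewrite fg'.
- by move=> x /=; rewrite gf.
- move=> i /=; have [j [e ->]] := fr i; have [l [d E]] := fr' j.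
  by exists l, (d * e)%N; rewrite (morph_X fM') E expgnA.
- move=> i /=; have [j [e ->]] := gr' i; have [l [d E]] := gr j.
  by exists l, (d * e)%N; rewrite (morph_X gM) E expgnA.
Qed.

Lemma col_gen0 A B C : col_gen A B C i0 = Jgen A.1 B.1 C.1 i0 ^+ A.2.
Proof. by rewrite /col_gen inordK. Qed.
Lemma col_gen1 A B C : col_gen A B C i1 = Jgen A.1 B.1 C.1 i1 ^+ B.2.
Proof. by rewrite /col_gen inordK. Qed.
Lemma col_gen2 A B C : col_gen A B C i2 = Jgen A.1 B.1 C.1 i2 ^+ C.2.
Proof. by rewrite /col_gen inordK. Qed.

Definition by_index (G : Type) (x y z : G) (i : 'I_3) : G :=
  if i == i0 then x else if i == i1 then y else z.

Lemma by_index0 (G : Type) (x y z : G) : by_index x y z i0 = x.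
Proof. by rewrite /by_index eqxx. Qed.
Lemma by_index1 (G : Type) (x y z : G) : by_index x y z i1 = y.
Proof. by rewrite /by_index -!val_eqE /= !inordK. Qed.
Lemma by_index2 (G : Type) (x y z : G) : by_index x y z i2 = z.
Proof. by rewrite /by_index -!val_eqE /= !inordK. Qed.
Let by_indexE := (by_index0, by_index1, by_index2).

Lemma J_lift3 (k n m : nat) (G : groupType) (x y z : G) :
  x ^+ k = 1 -> y ^+ n = 1 -> z ^+ m = 1 ->
  x * (y * z) = y * (z * x) -> y * (z * x) = z * (x * y) ->
  exists f : J k n m -> G, [/\ {morph f : u v / u * v},
    f (Jgen k n m i0) = x, f (Jgen k n m i1) = y & f (Jgen k n m i2) = z].
Proof.
move=> xk yn zm E1 E2; have yX i : by_index x y z i ^+ ord_gen k n m i = 1.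
  by move: i; apply: ord3P; rewrite !(by_indexE, ord_gen0, ord_gen1, ord_gen2).
have E1' : by_index x y z i0 * (by_index x y z i1 * by_index x y z i2) =
    by_index x y z i1 * (by_index x y z i2 * by_index x y z i0) by rewrite !by_indexE.
have E2' : by_index x y z i1 * (by_index x y z i2 * by_index x y z i0) =
    by_index x y z i2 * (by_index x y z i0 * by_index x y z i1) by rewrite !by_indexE.
exists (J_lift (by_index x y z)); split; first exact: J_liftM yX E1' E2'.
- by rewrite (J_lift_gen yX E1' E2') by_index0.
- by rewrite (J_lift_gen yX E1' E2') by_index1.
- by rewrite (J_lift_gen yX E1' E2') by_index2.
Qed.

Lemma Jgen_ord k n m : [/\ Jgen k n m i0 ^+ k = 1, Jgen k n m i1 ^+ n = 1 &
  Jgen k n m i2 ^+ m = 1].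
Proof.
have := @JgenX k n m; move=> H; have := H i0; have := H i1; have := H i2.
by rewrite ord_gen0 ord_gen1 ord_gen2.
Qed.

Lemma eq_J_morph k n m (G : groupType) (f1 f2 : J k n m -> G) :
  {morph f1 : x y / x * y} -> {morph f2 : x y / x * y} ->
  (forall i, f1 (Jgen k n m i) = f2 (Jgen k n m i)) -> f1 =1 f2.
Proof. exact: eq_pres_morph. Qed.

Lemma comp_morph (G H K : groupType) (f : G -> H) (g : H -> K) :
  {morph f : x y / x * y} -> {morph g : x y / x * y} ->
  {morph g \o f : x y / x * y}.
Proof. by move=> fM gM x y /=; rewrite fM gM. Qed.

Lemma col_iso_cycle A B C : col_iso A B C B C A.
Proof.
case: A B C => [k q0] [n q1] [m q2].
have [X0 X1 X2] := Jgen_ord k n m; have [Y0 Y1 Y2] := Jgen_ord n m k.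
have C1 := Jgen_comm1 k n m; have C2 := Jgen_comm2 k n m.
have D1 := Jgen_comm1 n m k; have D2 := Jgen_comm2 n m k.
have [f [fM f0 f1 f2]] := J_lift3 Y2 Y0 Y1 (esym (etrans D1 D2)) D1.
have [g [gM g0 g1 g2]] := J_lift3 X1 X2 X0 C2 (esym (etrans C1 C2)).
exists f, g; split=> //.
- apply: (eq_J_morph (comp_morph fM gM)) => // /=.
  by apply: ord3P; rewrite ?f0 ?f1 ?f2.
- apply: (eq_J_morph (comp_morph gM fM)) => // /=.
  by apply: ord3P; rewrite ?g0 ?g1 ?g2.
- apply: ord3P; [exists i2, 1%N | exists i0, 1%N | exists i1, 1%N];
  by rewrite !(col_gen0, col_gen1, col_gen2) (morph_X fM) ?f0 ?f1 ?f2 expg1.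
- apply: ord3P; [exists i1, 1%N | exists i2, 1%N | exists i0, 1%N];
  by rewrite !(col_gen0, col_gen1, col_gen2) (morph_X gM) ?g0 ?g1 ?g2 expg1.
Qed.

Lemma expg_inv_nat (G : groupType) (x : G) o q : (0 < o)%N -> x ^+ o = 1 ->
  (x^-1) ^+ q = (x ^+ q) ^+ o.-1.
Proof.
move=> o0 xo; have -> : x^-1 = x ^+ o.-1.
  by apply: mulg1_eq; rewrite -expgS prednK.
by rewrite -!expgnA mulnC.
Qed.

(* Inverting the generators reverses the cyclic order of the relation. *)
Lemma col_iso_swap A B C : (0 < A.1)%N -> (0 < B.1)%N -> (0 < C.1)%N ->
  col_iso A B C A C B.
Proof.
case: A B C => [k q0] [n q1] [m q2] /= k0 n0 m0.
have aux n' m' : exists f : J k n' m' -> J k m' n',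
    [/\ {morph f : u v / u * v}, f (Jgen k n' m' i0) = (Jgen k m' n' i0)^-1,
        f (Jgen k n' m' i1) = (Jgen k m' n' i2)^-1 &
        f (Jgen k n' m' i2) = (Jgen k m' n' i1)^-1].
  have [X0 X1 X2] := Jgen_ord k m' n'.
  have C1 := Jgen_comm1 k m' n'; have C2 := Jgen_comm2 k m' n'.
  apply: J_lift3; rewrite ?expVgn ?X0 ?X1 ?X2 ?invg1 //; rewrite -!invgM -!mulgA.
    by rewrite -C1.
  by rewrite C1 C2.
have [f [fM f0 f1 f2]] := aux n m; have [g [gM g0 g1 g2]] := aux m n.
have [X0 X1 X2] := Jgen_ord k n m; have [Y0 Y1 Y2] := Jgen_ord k m n.
exists f, g; split=> //.
- apply: (eq_J_morph (comp_morph fM gM)) => // /=.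
  by apply: ord3P; rewrite ?f0 ?f1 ?f2 (morph_V gM) ?g0 ?g1 ?g2 invgK.
- apply: (eq_J_morph (comp_morph gM fM)) => // /=.
  by apply: ord3P; rewrite ?g0 ?g1 ?g2 (morph_V fM) ?f0 ?f1 ?f2 invgK.
- apply: ord3P; [exists i0, k.-1 | exists i2, n.-1 | exists i1, m.-1];
  by rewrite !(col_gen0, col_gen1, col_gen2) (morph_X fM) ?f0 ?f1 ?f2
    (expg_inv_nat _ _ Y0, expg_inv_nat _ _ Y1, expg_inv_nat _ _ Y2).
- apply: ord3P; [exists i0, k.-1 | exists i2, m.-1 | exists i1, n.-1];
  by rewrite !(col_gen0, col_gen1, col_gen2) (morph_X gM) ?g0 ?g1 ?g2
    (expg_inv_nat _ _ X0, expg_inv_nat _ _ X1, expg_inv_nat _ _ X2).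
Qed.
End Symmetry.

Lemma perm_eq3 (A : eqType) (x y z x' y' z' : A) :
  perm_eq [:: x; y; z] [:: x'; y'; z'] ->
  (x, y, z) \in [:: (x', y', z'); (x', z', y'); (y', x', z'); (y', z', x');
    (z', x', y'); (z', y', x')].
Proof.
have perm2 (u v u' v' : A) : perm_eq [:: u; v] [:: u'; v'] ->
    (u = u' /\ v = v') \/ (u = v' /\ v = u').
  have perm1 (s t : A) : perm_eq [:: s] [:: t] -> s = t.
    by move/perm_mem/(_ s); rewrite !inE eqxx => /esym/eqP.
  move=> H; have := perm_mem H u; rewrite !inE eqxx => /esym/orP[/eqP E|/eqP E].
    by left; rewrite E in H *; rewrite perm_cons in H; split=> //; exact: perm1.
  right; rewrite E in H *; split=> //; apply: perm1.
  by rewrite -(perm_cons v') (perm_trans H) // (perm_catC [:: u'] [:: v']).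
move=> H; have := perm_mem H x; rewrite !inE eqxx /= => /esym/or3P[] /eqP E; rewrite E in H *.
- by move: H; rewrite perm_cons => /perm2[[-> ->]|[-> ->]]; rewrite eqxx ?orbT.
- have : perm_eq [:: y; z] [:: x'; z'].
    by rewrite -(perm_cons y') (perm_trans H) // (perm_catCA [:: x'] [:: y']).
  by move=> /perm2[[-> ->]|[-> ->]]; rewrite eqxx ?orbT.
- have : perm_eq [:: y; z] [:: x'; y'].
    by rewrite -(perm_cons z') (perm_trans H) // (perm_catC [:: x'; y'] [:: z']).
  by move=> /perm2[[-> ->]|[-> ->]]; rewrite eqxx ?orbT.
Qed.

Lemma perm_col_iso (A B C A' B' C' : nat * nat) :
  (0 < A'.1)%N -> (0 < B'.1)%N -> (0 < C'.1)%N ->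
  perm_eq [:: A; B; C] [:: A'; B'; C'] -> col_iso A B C A' B' C'.
Proof.
move=> a b c /perm_eq3; rewrite !inE.
have tr := col_iso_trans; have cy := col_iso_cycle.
case/orP=> [/eqP[-> -> ->]|]; first exact: col_iso_refl.
case/orP=> [/eqP[-> -> ->]|]; first exact: col_iso_swap.
case/orP=> [/eqP[-> -> ->]|].
  by apply: tr (cy _ _ _) _; apply: col_iso_swap.
case/orP=> [/eqP[-> -> ->]|].
  by apply: tr (cy _ _ _) _; apply: cy.
case/orP=> [/eqP[-> -> ->]|/eqP[-> -> ->]]; first exact: cy.
apply: tr (cy _ _ _); exact: col_iso_swap.
Qed.

(** * Isomorphism in reflection and equality of columns *)

Section ReflectionMorphism.
Variables (k b n c m k' b' n' c' m' : nat).

Lemma morph_W (f : J k (b * n) (c * m) -> J k' (b' * n') (c' * m')) :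
  {morph f : x y / x * y} ->
  (forall i, exists j e, f (refl_gen k b n c m i) = refl_gen k' b' n' c' m' j ^+ (e : nat)) ->
  forall x, W k b n c m x -> W k' b' n' c' m' (f x).
Proof.
move=> fM fr; apply: normal_closure_min => [|x /WgensP[i ->]] /=; last first.
  have [j [e ->]] := fr i; apply: normal_closureX; exact: W_refl_gen.
split=> [|x y Wx Wy|x g Wx] /=.
- by rewrite (morph_1 fM); exact: normal_closure1.
- rewrite fM (morph_V fM); apply: normal_closureM => //; exact: normal_closureV.
- by rewrite (morph_J fM); exact: normal_closureJ.
Qed.

Lemma morph_reflections (f : J k (b * n) (c * m) -> J k' (b' * n') (c' * m')) :
  {morph f : x y / x * y} -> injective f ->
  (forall i, exists j e, f (refl_gen k b n c m i) = refl_gen k' b' n' c' m' j ^+ (e : nat)) ->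
  forall x, reflections k b n c m x -> reflections k' b' n' c' m' (f x).
Proof.
move=> fM fI fr x [r [i [g [/WgensP[l ->] rl ->]]]].
have [j [e E]] := fr l.
exists (refl_gen k' b' n' c' m' j), (e * i)%N, (f g); split.
- by apply/WgensP; exists j.
- rewrite expgnA -E -(morph_X fM) => r1; apply: rl; apply: fI.
  by rewrite r1 (morph_1 fM).
- by rewrite (morph_J fM) (morph_X fM) E expgnA.
Qed.
End ReflectionMorphism.

Lemma col_iso_reflection (k b n c m k' b' n' c' m' : nat) :
  col_iso (k, 1%N) (b * n, n)%N (c * m, m)%N (k', 1%N) (b' * n', n')%N (c' * m', m')%N ->
  isomorphic_in_reflection k b n c m k' b' n' c' m'.
Proof.
case=> f [g [[fM gM] fg gf fr gr]]; exists f; split.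
- split; first exact: (morph_W fM fr).
    by move=> x y _ _ /(can_inj fg).
  by move=> y Wy; exists (g y); [exact: (morph_W gM gr) | exact: gf].
- by move=> x y _ _; exact: fM.
- rewrite eqEsubset; split=> [_ [x Rx <-]|y Ry].
    exact: (morph_reflections fM (can_inj fg) fr).
  by exists (g y); [exact: (morph_reflections gM (can_inj gf) gr) | exact: gf].
Qed.

Lemma refl_exp_dvd k b n c m i : (refl_exp n m i %| ord_gen k (b * n) (c * m) i)%N.
Proof.
move: i; apply: ord3P; rewrite ?refl_exp0 ?refl_exp1 ?refl_exp2 ?ord_gen0 ?ord_gen1
  ?ord_gen2 ?dvd1n //; exact: dvdn_mull.
Qed.

Section ReflectionIso.
Variables (k b n c m k' b' n' c' m' : nat).
Local Notation p' := (ord_gen k' (b' * n') (c' * m')).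
Local Notation p := (ord_gen k (b * n) (c * m)).
Local Notation q' := (refl_exp n' m').
Local Notation q := (refl_exp n m).
Local Notation J' := (J k' (b' * n') (c' * m')).
Local Notation J := (J k (b * n) (c * m)).

Hypotheses (n_gt0 : (0 < n)%N) (m_gt0 : (0 < m)%N) (co_nm : coprime n m).
Hypotheses (k2 : (1 < k)%N) (bn2 : (1 < b * n)%N) (cm2 : (1 < c * m)%N).
Hypotheses (n'_gt0 : (0 < n')%N) (m'_gt0 : (0 < m')%N) (co_nm' : coprime n' m').
Hypotheses (k'2 : (1 < k')%N) (bn'2 : (1 < b' * n')%N) (cm'2 : (1 < c' * m')%N).

Lemma refl_isoP : isomorphic_in_reflection k b n c m k' b' n' c' m' ->
  exists f e, @refl_iso k b n c m k' b' n' c' m' f e.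
Proof.
case=> f [[fW fI fS] fM fR].
have ex y : exists x, W k' b' n' c' m' y -> W k b n c m x /\ f x = y.
  have [Wy|nWy] := pselect (W k' b' n' c' m' y); last by exists 1.
  by have [x Wx fx] := fS y Wy; exists x.
have [e eP] := choice ex; exists f, e.
have ef x : W k b n c m x -> e (f x) = x.
  move=> Wx; have [We E] := eP _ (fW _ Wx).
  by apply: fI; rewrite ?inE.
split=> //.
- by move=> y /eP[].
- by move=> x y Wx Wy; apply: fM; rewrite inE.
- split=> [x Rx|y]; first by rewrite -fR; exists x.
  rewrite -fR => -[x Rx <-]; rewrite ef //.
  exact: (W_reflection n_gt0 m_gt0 co_nm).
- by split=> // y /eP[].
Qed.

Variables (f : J -> J') (e : J' -> J).
Hypothesis iso : @refl_iso k b n c m k' b' n' c' m' f e.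

Let iso' := refl_iso_sym iso.
Local Notation same_ax := (@same_axis k b n c m k' b' n' c' m' f).
Local Notation same_ax' := (@same_axis k' b' n' c' m' k b n c m e).

Lemma same_axis_sym i i' : same_ax i i' -> same_ax' i' i.
Proof.
move=> H; have [_ r' _] := H.
have [l Hl] := same_axis_total n'_gt0 m'_gt0 co_nm' n_gt0 m_gt0 co_nm iso' r'.
by rewrite (same_axis_inv k2 bn2 cm2 iso H Hl).
Qed.

Lemma same_axis_ord_dvd i i' : same_ax i i' -> (p i %| p' i')%N.
Proof.
move=> H.
have EF := T_isoK n_gt0 m_gt0 co_nm k2 bn2 cm2 n'_gt0 m'_gt0 co_nm' k'2 bn'2 cm'2 iso.
have FM := T_isoM n_gt0 m_gt0 co_nm k2 bn2 cm2 n'_gt0 m'_gt0 co_nm' k'2 bn'2 cm'2 iso.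
apply: (F_axis_dvd k2 bn2 cm2 FM EF).
exact: (same_axis_T_iso n_gt0 m_gt0 co_nm k2 bn2 cm2 n'_gt0 m'_gt0 co_nm' k'2 bn'2 cm'2 iso H).
Qed.

End ReflectionIso.

Section ActiveColumns.
Variables (k b n c m k' b' n' c' m' : nat).
Local Notation p' := (ord_gen k' (b' * n') (c' * m')).
Local Notation p := (ord_gen k (b * n) (c * m)).
Local Notation q' := (refl_exp n' m').
Local Notation q := (refl_exp n m).
Local Notation J' := (J k' (b' * n') (c' * m')).
Local Notation J := (J k (b * n) (c * m)).

Hypotheses (n_gt0 : (0 < n)%N) (m_gt0 : (0 < m)%N) (co_nm : coprime n m).
Hypotheses (k2 : (1 < k)%N) (bn2 : (1 < b * n)%N) (cm2 : (1 < c * m)%N).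
Hypotheses (n'_gt0 : (0 < n')%N) (m'_gt0 : (0 < m')%N) (co_nm' : coprime n' m').
Hypotheses (k'2 : (1 < k')%N) (bn'2 : (1 < b' * n')%N) (cm'2 : (1 < c' * m')%N).

Variables (f : J -> J') (e : J' -> J).
Hypothesis iso : @refl_iso k b n c m k' b' n' c' m' f e.

Let iso' := refl_iso_sym iso.
Local Notation same_ax' := (@same_axis k' b' n' c' m' k b n c m e).
Local Notation same_ax := (@same_axis k b n c m k' b' n' c' m' f).

Lemma same_axis_column i i' : same_ax i i' -> p i = p' i' /\ q i = q' i'.
Proof.
move=> H; have H' := same_axis_sym n_gt0 m_gt0 co_nm k2 bn2 cm2 n'_gt0 m'_gt0 co_nm' iso H.
have pE : p i = p' i'.
  apply/eqP; rewrite eqn_dvd.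
  rewrite (same_axis_ord_dvd n_gt0 m_gt0 co_nm k2 bn2 cm2 n'_gt0 m'_gt0 co_nm' k'2 bn'2 cm'2 iso H).
  exact: (same_axis_ord_dvd n'_gt0 m'_gt0 co_nm' k'2 bn'2 cm'2 n_gt0 m_gt0 co_nm
    k2 bn2 cm2 iso' H').
split=> //.
have p0 : (0 < p i)%N by apply: ltnW; apply: ord_gen_ge2.
have /dvdnP[d Ed] := refl_exp_dvd k b n c m i.
have /dvdnP[d' Ed'] := refl_exp_dvd k' b' n' c' m' i'.
have q0 : (0 < q i)%N by move: p0; rewrite Ed muln_gt0 => /andP[].
have q'0 : (0 < q' i')%N by move: p0; rewrite pE Ed' muln_gt0 => /andP[].
have d0 : (0 < d)%N by move: p0; rewrite Ed muln_gt0 => /andP[].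
(* [d] and [d'] are the orders of the two reflection generators; [same_axis_order] shows that each
   divides the other. *)
have dd' : d = d'.
  apply/eqP; rewrite eqn_dvd; apply/andP; split.
    rewrite -(dvdn_pmul2l q0) (mulnC (q i) d) -Ed.
    by apply: (same_axis_order k2 bn2 cm2 k'2 bn'2 cm'2 iso H); rewrite Ed' mulnC.
  rewrite -(dvdn_pmul2l q'0) (mulnC (q' i') d') -Ed'.
  by apply: (same_axis_order k'2 bn'2 cm'2 k2 bn2 cm2 iso' H'); rewrite Ed mulnC.
apply/eqP; rewrite -(eqn_pmul2l d0) -Ed pE Ed' dd' //.
Qed.

Lemma refl_iso_axis_map (sigma sigma' : 'I_3 -> 'I_3) :
  (forall i, refl_gen k b n c m i <> 1 -> same_ax i (sigma i)) ->
  (forall i, refl_gen k' b' n' c' m' i <> 1 -> same_ax' i (sigma' i)) ->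
  axis_map (T_iso n_gt0 m_gt0 co_nm k2 bn2 cm2 f)
    (T_iso n'_gt0 m'_gt0 co_nm' k'2 bn'2 cm'2 e)
    (fun i => refl_gen k b n c m i != 1) (fun i => refl_gen k' b' n' c' m' i != 1)
    q q' sigma sigma'.
Proof.
move=> sP sP'; split.
- exact: (T_isoM n_gt0 m_gt0 co_nm k2 bn2 cm2 n'_gt0 m'_gt0 co_nm' k'2 bn'2 cm'2 iso).
- exact: (T_isoK n_gt0 m_gt0 co_nm k2 bn2 cm2 n'_gt0 m'_gt0 co_nm' k'2 bn'2 cm'2 iso).
- by move=> i /eqP/sP[_ /eqP].
- move=> i /eqP/sP H; have [_ r' _] := H.
  by rewrite -(same_axis_inv k2 bn2 cm2 iso H (sP' _ r')).
- by move=> i /eqP/sP/same_axis_column[].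
- by move=> i /eqP/sP/same_axis_column[].
- move=> i /eqP/sP H.
  exact: (same_axis_T_iso n_gt0 m_gt0 co_nm k2 bn2 cm2 n'_gt0 m'_gt0 co_nm' k'2 bn'2 cm'2 iso H).
- move=> i /negPn/eqP r1; apply/eqP; rewrite eqn_dvd refl_exp_dvd /=.
  by rewrite -[q i]muln1 -refl_gen_order // expg1 r1.
Qed.

End ActiveColumns.

Lemma isomorphic_columns (k b n c m k' b' n' c' m' : nat) :
  (0 < n)%N -> (0 < m)%N -> coprime n m ->
  (1 < k)%N -> (1 < b * n)%N -> (1 < c * m)%N ->
  (0 < n')%N -> (0 < m')%N -> coprime n' m' ->
  (1 < k')%N -> (1 < b' * n')%N -> (1 < c' * m')%N ->
  isomorphic_in_reflection k b n c m k' b' n' c' m' ->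
  perm_eq [:: (k, 1); (b * n, n); (c * m, m)]%N
          [:: (k', 1); (b' * n', n'); (c' * m', m')]%N.
Proof.
move=> n0 m0 co k2 bn2 cm2 n'0 m'0 co' k'2 bn'2 cm'2.
case/(refl_isoP n0 m0 co) => f [e iso]; have iso' := refl_iso_sym iso.
have ex i : exists i', refl_gen k b n c m i <> 1 ->
    @same_axis k b n c m k' b' n' c' m' f i i'.
  have [/eqP r1|r1] := boolP (refl_gen k b n c m i == 1); first by exists i.
  have [i' H] := same_axis_total n0 m0 co n'0 m'0 co' iso (elimN eqP r1).
  by exists i'.
have ex' i : exists i', refl_gen k' b' n' c' m' i <> 1 ->
    @same_axis k' b' n' c' m' k b n c m e i i'.
  have [/eqP r1|r1] := boolP (refl_gen k' b' n' c' m' i == 1); first by exists i.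
  have [i' H] := same_axis_total n'0 m'0 co' n0 m0 co iso' (elimN eqP r1).
  by exists i'.
have [sigma sP] := choice ex; have [sigma' sP'] := choice ex'.
have FA := refl_iso_axis_map n0 m0 co k2 bn2 cm2 n'0 m'0 co' k'2 bn'2 cm'2 iso sP sP'.
have EA := refl_iso_axis_map n'0 m'0 co' k'2 bn'2 cm'2 n0 m0 co k2 bn2 cm2 iso' sP' sP.
(* The exponent of [s] is 1 and its order exceeds 1, so its axis always carries reflections. *)
have act0 kk bb nn cc mm : (1 < kk)%N -> (1 < bb * nn)%N -> (1 < cc * mm)%N ->
    refl_gen kk bb nn cc mm i0 != 1.
  move=> K B C; rewrite -[refl_gen _ _ _ _ _ _]expg1 refl_gen_order // refl_exp0.
  by rewrite ord_gen0 dvdn1 gtn_eqF.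
have coq nn mm : coprime nn mm -> forall i j, i != i0 -> j != i0 -> i != j ->
    coprime (refl_exp nn mm i) (refl_exp nn mm j).
  move=> cnm i j; case: (ord3_cases i) => ->; case: (ord3_cases j) => ->;
    rewrite ?eqxx // ?refl_exp1 ?refl_exp2 // coprime_sym //.
have [|tau tau_inj colE] := columns_match k2 bn2 cm2 k'2 bn'2 cm'2 FA EA
  (act0 _ _ _ _ _ k2 bn2 cm2) (act0 _ _ _ _ _ k'2 bn'2 cm'2) _ (coq _ _ co) (coq _ _ co').
  by rewrite !refl_exp0.
have := perm_eq_inj3 (col' := fun i => (ord_gen k' (b' * n') (c' * m') i, refl_exp n' m' i))
  tau_inj colE.
by rewrite !(ord_gen0, ord_gen1, ord_gen2, refl_exp0, refl_exp1, refl_exp2).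
Qed.

Local Close Scope classical_set_scope.
Local Close Scope group_scope.

Theorem theorem1p6 (k b n c m k' b' n' c' m' : nat)
    (k_gt0 : 0 < k) (b_gt0 : 0 < b) (n_gt0 : 0 < n) (c_gt0 : 0 < c)
    (m_gt0 : 0 < m) (k_ge2 : 2 <= k) (bn_ge2 : 2 <= b * n)
    (cm_ge2 : 2 <= c * m) (co_nm : coprime n m)
    (k'_gt0 : 0 < k') (b'_gt0 : 0 < b') (n'_gt0 : 0 < n') (c'_gt0 : 0 < c')
    (m'_gt0 : 0 < m') (k'_ge2 : 2 <= k') (bn'_ge2 : 2 <= b' * n')
    (cm'_ge2 : 2 <= c' * m') (co_nm' : coprime n' m') :
  isomorphic_in_reflection k b n c m k' b' n' c' m' <->
  perm_eq [:: (k, 1); (b * n, n); (c * m, m)]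
          [:: (k', 1); (b' * n', n'); (c' * m', m')].
Proof.
split; first exact: isomorphic_columns.
move=> cols; apply/col_iso_reflection/perm_col_iso => //=; exact: ltnW.
Qed.
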